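(* There exists an absolute constant $C>0$ such that for every $N\ge1$, every $1\le p<\infty$ and every $u\in\dot W^{1,p}(\mathbb R^N)$: (a) if $\gamma>0$, then $\sup_{\lambda>0}\lambda^p\nu_\gamma(E_{\lambda,\gamma/p}[u])\le C\,\sigma_{N-1}\frac{5^\gamma}{\gamma}\|\nabla u\|_{L^p(\mathbb R^N)}^p$; (b) if $\gamma<-1$, then $\sup_{\lambda>0}\lambda^p\nu_\gamma(E_{\lambda,\gamma/p}[u])\le \frac{C\,\sigma_{N-1}}{|\gamma|}\Big(1+\frac{1}{|\gamma+1|}\Big)\|\nabla u\|_{L^p(\mathbb R^N)}^p$. When $p=1$, both assertions hold for all $u\in\dot{BV}(\mathbb R^N)$ with $\|\nabla u\|_{L^1}$ replaced by $\|\nabla u\|_{\mathcal M}$.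
   Context: $\sigma_{N-1}$ is the surface area of $\mathbb S^{N-1}$. For $\gamma\in\mathbb R$, $\nu_\gamma(E)=\iint_{(x,y)\in E,\,x\ne y}|x-y|^{\gamma-N}\,dx\,dy$. For measurable $u$ and $b\in\mathbb R$, $E_{\lambda,b}[u]=\{(x,y):x\ne y,\ \frac{|u(x)-u(y)|}{|x-y|^{1+b}}>\lambda\}$. $\dot W^{1,p}(\mathbb R^N)$: locally integrable functions with distributional gradient in $L^p$. $\dot{BV}(\mathbb R^N)$: locally integrable $u$ with distributional gradient a finite vector-valued Borel measure, $\|\nabla u\|_{\mathcal M}$ its total variation. *)

(* Defs.v *)
From HB Require Import structures.
From mathcomp Require Import all_boot all_order all_algebra.
From mathcomp Require Import all_classical all_reals all_analysis.
Set Implicit Arguments. Unset Strict Implicit. Unset Printing Implicit Defensive.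
Import Order.TTheory GRing.Theory Num.Theory.
Import numFieldNormedType.Exports.
Local Open Scope classical_set_scope.
Local Open Scope ring_scope.

(* R^N is represented by row vectors 'rV[R]_N; coordinate i of x is    *)
(* x ord0 i.  We equip it with the product sigma-algebra of the Borel  *)
(* sigma-algebras (= the Borel sigma-algebra of R^N), exactly as       *)
(* MathComp-Analysis does for n.-tuple.                                 *)
Definition rV_measure_display : measure_display.
Proof. exact: default_measure_display. Qed.

Section measurable_rV.
Context (R : realType) (n : nat).
Let coors : 'I_n -> 'rV[R]_n -> R := fun i x => x ord0 i.

Let rV_set0 : g_sigma_preimage coors set0.
Proof. exact: sigma_algebra0. Qed.

Let rV_setC A : g_sigma_preimage coors A -> g_sigma_preimage coors (~` A).
Proof. exact: sigma_algebraC. Qed.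

Let rV_bigcup (F : _^nat) : (forall i, g_sigma_preimage coors (F i)) ->
  g_sigma_preimage coors (\bigcup_i (F i)).
Proof. exact: sigma_algebra_bigcup. Qed.

HB.instance Definition _ :=
  @isMeasurable.Build rV_measure_display 'rV[R]_n
  (g_sigma_preimage coors) rV_set0 rV_setC rV_bigcup.
End measurable_rV.

Local Open Scope ereal_scope.

Section defs.
Context (R : realType) (N : nat).
Implicit Types (x y : 'rV[R]_N).

(* Euclidean norm of a vector of R^N (note: the library norm on 'rV is  *)
(* the sup norm, so we use the Euclidean one explicitly).               *)
Definition enorm (v : 'rV[R]_N) : R := Num.sqrt (\sum_i v ord0 i ^+ 2).

Definition rbox (a b : 'rV[R]_N) : set 'rV[R]_N :=
  [set x | forall i, (a ord0 i < x ord0 i <= b ord0 i)%R].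

(* mu is (the Borel restriction of) Lebesgue measure on R^N: it gives   *)
(* every rbox its volume.  This determines mu uniquely on Borel sets.    *)
Definition is_lebesgue_borel (mu : {measure set 'rV[R]_N -> \bar R}) :=
  forall a b : 'rV[R]_N, (forall i, a ord0 i < b ord0 i)%R ->
    mu (rbox a b) = (\prod_i (b ord0 i - a ord0 i))%:E.

(* Lebesgue measure on the Lebesgue sigma-algebra = completion          *)
(* (Caratheodory extension) of the Borel Lebesgue measure mu.           *)
Definition leb (mu : {measure set 'rV[R]_N -> \bar R}) :=
  @completed_measure_extension _ _ _ mu.
Arguments leb : clear implicits.

Definition sphere_area (mu : {measure set 'rV[R]_N -> \bar R}) : R :=
  (N%:R * fine (mu [set x | (enorm x < 1)%R]))%R.

Definition evec (i : 'I_N) : 'rV[R]_N := delta_mx ord0 i.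
Fixpoint dpar (l : seq 'I_N) (f : 'rV[R]_N -> R) : 'rV[R]_N -> R :=
  match l with
  | [::] => f
  | i :: l' => fun x => 'D_(evec i) (dpar l' f) x
  end.

Definition smoothRN (f : 'rV[R]_N -> R) :=
  forall l : seq 'I_N, continuous (dpar l f) /\
    forall i x, derivable (dpar l f) x (evec i).

Definition test_fun (phi : 'rV[R]_N -> R) :=
  smoothRN phi /\ compact (closure [set x | phi x != 0%R]).

Variable mu : {measure set 'rV[R]_N -> \bar R}.
Notation L := (leb mu).
Local Notation lebT := (caratheodory_type (mu_ext mu)).

Definition loc_integrable (u : 'rV[R]_N -> R) :=
  measurable_fun setT (u : lebT -> R) /\
  forall K : set 'rV[R]_N, compact K -> L.-integrable K (EFin \o u).

Definition weak_gradient (u : 'rV[R]_N -> R) (g : 'I_N -> 'rV[R]_N -> R) :=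
  loc_integrable u /\
  (forall i, measurable_fun setT (g i : lebT -> R)) /\
  forall phi, test_fun phi -> forall i,
    \int[L]_x (u x * dpar [:: i] phi x)%:E = - \int[L]_x (g i x * phi x)%:E.

Definition gnorm (g : 'I_N -> 'rV[R]_N -> R) (x : 'rV[R]_N) : R :=
  enorm (\row_i g i x).

Definition grad_Lp_p (p : R) (g : 'I_N -> 'rV[R]_N -> R) : \bar R :=
  \int[L]_x ((gnorm g x) `^ p)%:E.

Definition W1p_grad (p : R) u g :=
  weak_gradient u g /\ grad_Lp_p p g < +oo.

(* BV: grad u = (mp_i - mn_i)_i, a finite R^N-valued Borel measure,     *)
(* written as differences of finite (positive) Borel measures.          *)
Definition BV_grad (u : 'rV[R]_N -> R)
    (mp mn : 'I_N -> {finite_measure set 'rV[R]_N -> \bar R}) :=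
  loc_integrable u /\
  forall phi, test_fun phi -> forall i,
    \int[L]_x (u x * dpar [:: i] phi x)%:E =
      - (\int[mp i]_x (phi x)%:E - \int[mn i]_x (phi x)%:E).

Definition grad_TV
    (mp mn : 'I_N -> {finite_measure set 'rV[R]_N -> \bar R}) : \bar R :=
  ereal_sup [set r | exists (n : nat) (A : nat -> set 'rV[R]_N),
     [/\ (forall k, measurable (A k)), trivIset setT A,
        \bigcup_(k in [set k | (k < n)%N]) A k = setT &
        r = \sum_(k < n) (enorm (\row_i fine (mp i (A k) - mn i (A k))))%:E]].

Definition nu_gamma (gamma : R) (E : set ('rV[R]_N * 'rV[R]_N)) : \bar R :=
  \int[L]_x \int[L]_y
     ((\1_[set z | z \in E /\ z.1 != z.2] (x, y) : R) *
       (enorm (x - y)) `^ (gamma - N%:R))%:E.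

Definition Eset (lambda b : R) (u : 'rV[R]_N -> R) : set ('rV[R]_N * 'rV[R]_N) :=
  [set z | z.1 != z.2 /\
     (lambda < `|u z.1 - u z.2| / (enorm (z.1 - z.2)) `^ (1 + b))%R].

Definition weak_quantity (p gamma : R) (u : 'rV[R]_N -> R) : \bar R :=
  ereal_sup [set (lambda `^ p)%:E * nu_gamma gamma (Eset lambda (gamma / p) u)
            | lambda in [set l : R | (0 < l)%R]].

End defs.
Arguments leb {R N} mu.

(* Main.v *)
(** A lower bound for a difference quotient forces mass on a segment: if [u] is
    smooth and [|u (x + h) - u x| > l |h|^(1 + g/p)], Young's inequality gives
    [l^p |h|^g < \int_0^1 |Du|^p (x + t h) dt].  The set of such pairs is measured
    by integrating over lines: on each line it is a one-dimensional weak-type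
    estimate (a Vitali covering argument when [g > 0], a chain of stopping points
    when [g < -1]), and polar coordinates produce the factor [sigma_(N-1)].
    For general [u] one mollifies: the segment masses of the convolved gradient
    measures have the same total mass, mollifications converge a.e. along a
    subsequence, and Fatou's lemma concludes.  [W^(1,p)] and [BV] are treated at
    once through densities [Du = D tau], with [tau] Lebesgue or a finite measure. *)
Require Import Defs.
From HB Require Import structures.
From mathcomp Require Import all_boot all_order all_algebra.
From mathcomp Require Import all_classical all_reals all_analysis.
From mathcomp Require Import measurable_realfun ring lra.
Set Implicit Arguments. Unset Strict Implicit. Unset Printing Implicit Defensive.
Import Order.TTheory GRing.Theory Num.Theory.
Import numFieldNormedType.Exports.
Local Open Scope classical_set_scope.
Local Open Scope ring_scope.

Local Open Scope ereal_scope.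

(** Parametrised by arc length, the condition on a segment reads [s^(g+1) < mass]. For [g > 0] a
    finite total mass bounds the bad lengths from above, as a covering argument requires; for
    [g < -1] it bounds them from below, and small intervals need no attention. Everything after the
    line estimates sees only [one_dim_bound g C], so the two ranges share the rest of the proof. In
    the passage to R^N, starting points fill a window of length [S] while segments of length at most
    [S] reach over [2 * S]; this is the 2 in [2 * C]. Mollifying before estimating gives an
    increment bound at every pair of points, so [u] is never differentiated along lines. Jensen's
    inequality is replaced by a tangent line inequality, which is linear in the density: for [p = 1]
    it puts no normalisation on [tau], so BV fits the same statement. The definitions integrate
    against completed Lebesgue measure, whereas Tonelli is applied to Borel functions; hence the
    Borel versions. The constant 8 is [2 * 4]: for [g < -1] one has [1 + 1/|g+1| = |g|/|g+1|], and
    the bound obtained is exactly the claimed one. *)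

Section row_vectors.
Context (R : realType) (N : nat).
Local Notation V := 'rV[R]_N.

Lemma measurable_coord (i : 'I_N) : measurable_fun setT (fun x : V => x ord0 i).
Proof.
move=> _ Y mY; rewrite setTI; apply: sub_sigma_algebra => /=.
rewrite -bigcup_seq/=; exists i => /=; first by rewrite mem_index_enum.
by exists Y => //; rewrite setTI.
Qed.

Lemma measurable_rVP d (T : measurableType d) (f : T -> V) :
  measurable_fun setT f <->
  forall i, measurable_fun setT (fun x => f x ord0 i).
Proof.
split=> [mf i|mf]; first exact: (measurableT_comp (measurable_coord i)).
apply: (@measurability _ _ _ _ setT f
  (\big[setU/set0]_(i < N) preimage_set_system setT
     (fun x : V => x ord0 i) measurable)) => //.
move=> _ [B + <-]; rewrite -bigcup_seq => -[i _ [C mC <-]].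
rewrite !setTI; have := mf i measurableT C mC; rewrite setTI.
exact.
Qed.

Lemma measurable_rbox (a b : V) : measurable (rbox a b).
Proof.
rewrite (_ : rbox a b =
  \bigcap_(i in [set: 'I_N]) ((fun x : V => x ord0 i) @^-1` `]a ord0 i, b ord0 i])).
  apply: fin_bigcap_measurable => // i _.
  rewrite -[X in measurable X]setTI; exact: measurable_coord.
apply/seteqP; split=> [x xab i _|x xab i] /=.
  by rewrite in_itv/=; exact: xab.
by have := xab i Logic.I; rewrite /= in_itv/=.
Qed.

Lemma rboxI (a b c d : V) : rbox a b `&` rbox c d =
  rbox (\row_i Num.max (a ord0 i) (c ord0 i)) (\row_i Num.min (b ord0 i) (d ord0 i)).
Proof.
apply/seteqP; split=> [x [xab xcd] i|x H].
  rewrite !mxE gt_max le_min; have /andP[-> ->] := xab i.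
  by have /andP[-> ->] := xcd i.
by split=> i; have := H i; rewrite !mxE gt_max le_min =>
  /andP[/andP[? ?] /andP[? ?]]; apply/andP.
Qed.

Definition rboxes : set (set V) := [set A | exists a b : V, A = rbox a b].

Definition cube (r : R) : set V := rbox (const_mx (- r)%R) (const_mx r).

Lemma cubeP r x : cube r x <-> forall i, (- r < x ord0 i <= r)%R.
Proof. by split=> H i; have := H i; rewrite !mxE. Qed.

Lemma bigcup_cube : \bigcup_n cube n%:R = setT.
Proof.
apply/seteqP; split=> // x _ /=.
pose M : R := (\sum_i `|x ord0 i|)%R.
exists (Num.truncn M).+1 => //; apply/cubeP => i.
have xM : (`|x ord0 i| < (Num.truncn M).+1%:R)%R.
  rewrite (le_lt_trans _ (truncnS_gt _))// /M (bigD1 i)//= lerDl.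
  by apply: sumr_ge0 => j _.
by move: xM; rewrite ltr_norml => /andP[-> /ltW ->].
Qed.

Lemma nondecreasing_cube : {homo cube : r s / (r <= s)%R >-> r `<=` s}.
Proof.
move=> r s rs x /cubeP xr; apply/cubeP => i; have /andP[x1 x2] := xr i.
by rewrite (le_lt_trans _ x1) ?lerN2// (le_trans x2).
Qed.

(** Boxes are stable under intersection; with this identity they form a generating pi-system, on
    which measures are compared and from which the approximation of indicators starts. *)
Lemma rboxes_gen : <<s rboxes >> = @measurable _ V.
Proof.
apply/seteqP; split.
  by apply: smallest_sub => [|_ [a [b ->]]];
    [exact: sigma_algebra_measurable | exact: measurable_rbox].
apply: smallest_sub; first exact: smallest_sigma_algebra.
move=> A; rewrite -bigcup_seq => -[i _ [B mB <-{A}]]; rewrite setTI.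
have: <<s rboxes >> = @measurable _ (g_sigma_algebraType rboxes) by [].
move=> ->; rewrite -[X in _ X]setTI.
suff: measurable_fun setT
    ((fun x : V => x ord0 i) : g_sigma_algebraType rboxes -> R) by exact.
apply: (measurability (@measurable_realfun.RGenOInfty.G R)) => [|_ [_ [r ->] <-]]; first exact: measurable_realfun.RGenOInfty.measurableE.
rewrite setTI.
(* The half-space above [r] in direction [i] is exhausted by boxes whose lower corner is [r] in that
   direction and [-n] in the others. *)
pose a n : V := \row_j (if j == i then r else - n%:R)%R.
rewrite (_ : _ @^-1` _ = \bigcup_n rbox (a n) (const_mx n%:R)).
  apply: bigcup_measurable => n _; apply: sub_sigma_algebra.
  by exists (a n), (const_mx n%:R).
apply/seteqP; split=> [x|x [n _ xn]] /=; rewrite in_itv/= andbT.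
  move=> rx; have : setT x by []; rewrite -bigcup_cube => -[n _ /cubeP xn].
  exists n => // j; rewrite !mxE; case: eqP => [->|_]; last exact: xn.
  by rewrite rx/=; have /andP[] := xn i.
by have := xn i; rewrite !mxE eqxx => /andP[].
Qed.

End row_vectors.

Arguments cube {R} N r.

(** * Lebesgue measure: uniqueness, affine maps, completion *)

Section lebesgue_affine.
Context (R : realType) (N : nat).
Local Notation V := 'rV[R]_N.
Variable mu : {measure set V -> \bar R}.
Hypothesis mu_leb : is_lebesgue_borel mu.

Lemma rbox_eq0 (a b : V) : ~ (forall i, (a ord0 i < b ord0 i)%R) -> rbox a b = set0.
Proof.
move=> nab; apply/seteqP; split=> // x xab; apply: nab => i.
by have /andP[h1 h2] := xab i; exact: lt_le_trans h2.
Qed.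

Lemma lebesgue_cube (r : R) : (0 < r)%R -> mu (cube N r) = ((r *+ 2) ^+ N)%:E.
Proof.
move=> r0; rewrite mu_leb => [|i]; last by rewrite !mxE gtrN.
congr EFin; rewrite (eq_bigr (fun=> r *+ 2)%R) => [|i _].
  by rewrite prodr_const card_ord.
by rewrite !mxE opprK mulr2n.
Qed.

Lemma lebesgue_cube_lty (r : R) : mu (cube N r) < +oo.
Proof.
apply: (@le_lt_trans _ _ (mu (cube N (Num.max r 1%R)))).
  apply: le_measure; rewrite ?inE; [exact: measurable_rbox..|].
  by apply: nondecreasing_cube; rewrite le_max lexx.
by rewrite lebesgue_cube ?ltry// lt_max ltr01 orbT.
Qed.

(** Agreement is asked on nondegenerate boxes only, as in [is_lebesgue_borel]; the other boxes are
    empty. The cubes provide the exhaustion by sets of finite measure. *)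
Lemma lebesgue_unique (m1 m2 : {measure set V -> \bar R}) :
  (forall a b : V, (forall i, a ord0 i < b ord0 i)%R -> m1 (rbox a b) = mu (rbox a b)) ->
  (forall a b : V, (forall i, a ord0 i < b ord0 i)%R -> m2 (rbox a b) = mu (rbox a b)) ->
  forall A, measurable A -> m1 A = m2 A.
Proof.
move=> H1 H2; have H (m : {measure set V -> \bar R}) : (forall a b : V,
    (forall i, a ord0 i < b ord0 i)%R -> m (rbox a b) = mu (rbox a b)) ->
    forall a b, m (rbox a b) = mu (rbox a b).
  move=> Hm a b; have [|nab] := pselect (forall i, (a ord0 i < b ord0 i)%R).
    exact: Hm.
  by rewrite rbox_eq0// !measure0.
apply: (measure_unique (@rboxes R N) (fun n => cube N n%:R)).
- by rewrite rboxes_gen.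
- by move=> _ _ [a [b ->]] [c [d ->]]; rewrite rboxI; eexists; eexists.
- by move=> i; exists (const_mx (- i%:R)%R), (const_mx i%:R).
- exact: bigcup_cube.
- by move=> _ [a [b ->]]; rewrite !H.
- by move=> k; rewrite H//; exact: lebesgue_cube_lty.
Qed.

Lemma measurable_affine (s : R) (b : V) :
  measurable_fun setT (fun x : V => b + s *: x)%R.
Proof.
apply/measurable_rVP => i; under eq_fun do rewrite !mxE.
by apply: measurable_funD => //; apply: measurable_funM => //;
  exact: measurable_coord.
Qed.

(** The rescaled push-forward agrees with [mu] on boxes. The case [s = 1] gives translation
    invariance, used along lines and in convolutions; dilations serve polar coordinates. *)
Lemma lebesgue_affine (s : R) (b : V) (A : set V) : (0 < s)%R -> measurable A ->
  mu A = (s ^+ N)%:E * mu ((fun x : V => b + s *: x)%R @^-1` A).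
Proof.
move=> s0 mA.
have sN0 : (0 <= s ^+ N)%R by rewrite exprn_ge0// ltW.
have := @lebesgue_unique mu (mscale (NngNum sN0)
  (pushforward mu (fun x : V => b + s *: x)%R)).
move=> ->//=; first exact: measurable_affine.
move=> mf c d cd; rewrite /mscale/= /pushforward.
have -> : (fun x : V => b + s *: x)%R @^-1` rbox c d =
    rbox (s^-1 *: (c - b))%R (s^-1 *: (d - b))%R.
  apply/seteqP; split=> x xcd i; have := xcd i; rewrite !mxE;
    rewrite ![(s^-1 * _)%R]mulrC ltr_pdivrMr// ler_pdivlMr// ltrBlDl lerBrDl;
    by rewrite (mulrC s).
rewrite mu_leb ?mu_leb//; last first.
  by move=> i; rewrite !mxE ltr_pM2l ?invr_gt0// ltrD2r.
rewrite -EFinM; congr EFin.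
rewrite -{1}(card_ord N) -prodr_const -big_split/=; apply: eq_bigr => i _.
by rewrite !mxE -mulrBr mulrA mulfV ?gt_eqF// mul1r opprB addrA subrK.
Qed.

Lemma ge0_integral_affine (s : R) (b : V) (f : V -> \bar R) : (0 < s)%R ->
  measurable_fun setT f -> (forall x, 0 <= f x) ->
  \int[mu]_x f x = (s ^+ N)%:E * \int[mu]_x f (b + s *: x)%R.
Proof.
move=> s0 mf f0.
have sN0 : (0 <= s ^+ N)%R by rewrite exprn_ge0// ltW.
have maff := measurable_affine s b.
rewrite (eq_measure_integral (mscale (NngNum sN0)
  (pushforward mu (fun x : V => b + s *: x)%R)))//=.
  by rewrite ge0_integral_mscale//= ge0_integral_pushforward.
by move=> A mA _; exact: lebesgue_affine.
Qed.

Lemma ge0_integral_shift (b : V) (f : V -> \bar R) :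
  measurable_fun setT f -> (forall x, 0 <= f x) ->
  \int[mu]_x f (x + b)%R = \int[mu]_x f x.
Proof.
move=> mf f0; rewrite (ge0_integral_affine b ltr01 mf f0) expr1n mul1e.
by apply: eq_integral => x _; rewrite scale1r addrC.
Qed.

Lemma lebesgue_sigma_finite : sigma_finite setT mu.
Proof.
exists (fun n => cube N n%:R); first by rewrite bigcup_cube.
by move=> n; split; [exact: measurable_rbox|exact: lebesgue_cube_lty].
Qed.

Lemma measurable_leb (A : set V) : measurable A ->
  measurable (A : set (caratheodory_type (mu_ext mu))).
Proof. by move=> mA; apply: sub_caratheodory; exact: sub_sigma_algebra. Qed.

Lemma lebE (A : set V) : measurable A -> leb mu A = mu A.
Proof. by move=> mA; rewrite /leb /completed_measure_extension measurable_mu_extE. Qed.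

Lemma measurable_fun_leb d (T : sigmaRingType d) (f : V -> T) :
  measurable_fun setT f ->
  measurable_fun setT (f : caratheodory_type (mu_ext mu) -> T).
Proof.
move=> mf _ A mA; have := mf measurableT A mA.
by rewrite !setTI => /measurable_leb.
Qed.

(** The identity map from the completed to the Borel sigma-algebra is measurable and pushes [leb mu]
    forward to [mu]. *)
Lemma ge0_integral_leb (f : V -> \bar R) : measurable_fun setT f ->
  (forall x, 0 <= f x) -> \int[leb mu]_x f x = \int[mu]_x f x.
Proof.
move=> mf f0.
have mid : measurable_fun setT (idfun : caratheodory_type (mu_ext mu) -> V).
  by move=> _ A mA; rewrite setTI; exact: measurable_leb.
rewrite [RHS](eq_measure_integral
  (pushforward (leb mu) (idfun : caratheodory_type (mu_ext mu) -> V)))//=.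
  by rewrite ge0_integral_pushforward.
by move=> A mA _; rewrite /pushforward/= -lebE.
Qed.

End lebesgue_affine.

(** * Powers and power weights *)

Section powR_monotony.
Context (R : realType).
Implicit Types r x y : R.
Local Open Scope ring_scope.

Lemma le_powR_base r x y : 0 <= r -> 0 <= x -> x <= y -> x `^ r <= y `^ r.
Proof. by move=> r0 x0 xy; apply: ge0_ler_powR; rewrite // nnegrE (le_trans x0). Qed.

Lemma ge_powR_base r x y : r <= 0 -> 0 < x -> x <= y -> y `^ r <= x `^ r.
Proof.
move=> r0 x0 xy; rewrite -(opprK r) ![_ `^ (- - r)]powRN.
rewrite lef_pV2 ?posrE ?powR_gt0//; last exact: lt_le_trans xy.
by rewrite le_powR_base ?oppr_ge0// ltW.
Qed.

Lemma powRK r x : r != 0 -> 0 <= x -> (x `^ r) `^ r^-1 = x.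
Proof. by move=> r0 x0; rewrite -powRrM mulfV// powRr1. Qed.

Lemma powRVK r x : r != 0 -> 0 <= x -> (x `^ r^-1) `^ r = x.
Proof. by move=> r0 x0; rewrite -powRrM mulVf// powRr1. Qed.

End powR_monotony.

Lemma ge0_integral_bigcup_nondecreasing_le d (T : measurableType d) (R : realType)
    (m : {measure set T -> \bar R}) (F : (set T)^nat) (f : T -> \bar R) (c : \bar R) :
  nondecreasing_seq F -> (forall n, measurable (F n)) ->
  measurable_fun setT f -> (forall x, 0 <= f x) ->
  (forall n, \int[m]_(x in F n) f x <= c) ->
  \int[m]_(x in \bigcup_n F n) f x <= c.
Proof.
move=> ndF mF mf f0 Fc.
have mFf n : measurable_fun (F n) f by apply: measurable_funTS.
have Ff0 (n : nat) (x : T) : F n x -> 0 <= f x by [].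
have /cvg_lim <- // := ge0_nondecreasing_set_cvg_integral (mu := m) ndF mF mFf Ff0.
apply: lime_le; last by near=> n.
apply: ereal_nondecreasing_is_cvgn.
exact: ge0_nondecreasing_set_nondecreasing_integral.
Unshelve. all: end_near. Qed.

Section power_integrals.
Context (R : realType).
Local Notation lambda := (@lebesgue_measure R).

(** The radial density [s^(g-1)] of the half-line, extended by zero so that integrals may run over
    the whole line. *)
Definition power_weight (g s : R) : R := (if 0 < s then s `^ (g - 1) else 0)%R.
Local Notation pw := power_weight.

Lemma power_weight_ge0 g s : (0 <= pw g s)%R.
Proof. by rewrite /pw; case: ifP => // _; exact: powR_ge0. Qed.

Lemma measurable_power_weight g : measurable_fun setT (pw g).
Proof.
apply: measurable_fun_ifT => //=.
exact: measurable_fun_ltr.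
Qed.

Lemma emeasurable_power_weight g : measurable_fun setT (fun s => (pw g s)%:E).
Proof. by apply/measurable_EFinP; exact: measurable_power_weight. Qed.

Lemma powR_continuous (g x : R) : (0 < x)%R ->
  {for x, continuous (fun s : R => s `^ g)%R}.
Proof.
move=> x0; apply: differentiable_continuous; apply/derivable1_diffP.
by apply: derivable_powR; rewrite in_itv/= x0.
Qed.

Lemma cvg_powR_neg (g : R) : (g < 0)%R -> (x `^ g)%R @[x --> +oo%R] --> (0 : R)%R.
Proof.
move=> g0; have g0' : (0 < - g)%R by rewrite oppr_gt0.
rewrite (_ : (fun x : R => x `^ g)%R = (fun x => (x `^ (- g))^-1))%R; last first.
  by apply/funext => x /=; rewrite -powRN opprK.
apply/(@gtr0_cvgV0 _ _ _ _ (fun x : R => x `^ (- g))%R).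
  by near=> x; apply: powR_gt0; near: x; exact: nbhs_pinfty_gt.
apply/cvgryPge => A.
near=> x; rewrite (@le_trans _ _ (Num.max A 1%R))// ?le_max ?lexx//.
have -> : Num.max A 1%R = ((Num.max A 1 `^ (- g)^-1) `^ (- g))%R.
  by rewrite -powRrM mulVf ?gt_eqF// powRr1// le_max ler01 orbT.
apply: ge0_ler_powR; rewrite ?ltW// ?nnegrE ?powR_ge0//;
  near: x; exact: nbhs_pinfty_ge.
Unshelve. all: end_near. Qed.

Lemma integral_power_weight_ge (g S : R) : (g < 0)%R -> (0 < S)%R ->
  \int[lambda]_(s in `[S, +oo[) (pw g s)%:E = (S `^ g / - g)%:E.
Proof.
move=> g0 S0.
rewrite (eq_integral (fun s : measurableTypeR R => (s `^ (g - 1))%:E)); last first.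
  move=> s; rewrite inE/= in_itv/= andbT => Ss.
  by rewrite /pw (lt_le_trans S0).
have Dg x : (S < x)%R -> derivable (fun s : R => s `^ g)%R x 1.
  by move=> Sx; apply: derivable_powR; rewrite in_itv/= (lt_trans S0).
rewrite (@ge0_continuous_FTC2y _ _ (fun s => g^-1 * s `^ g)%R S 0).
- by rewrite sub0e -EFinN invrN mulrN mulrC.
- by move=> x _; exact: powR_ge0.
- apply: derivable_within_continuous => x; rewrite in_itv/= andbT => Sx.
  by apply: derivable_powR; rewrite in_itv/= (lt_le_trans S0).
- by rewrite -[X in _ --> X](mulr0 (g^-1)%R); apply: cvgMl_tmp; exact: cvg_powR_neg.
- by move=> x Sx; apply: derivableM => //; exact: Dg.
- apply: cvg_at_right_filter; apply: cvgMl_tmp; exact: powR_continuous.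
- move=> x; rewrite in_itv/= andbT => Sx.
  rewrite derive1Ml; last exact: Dg.
  rewrite powR_derive1 ?in_itv/= ?(lt_trans S0)//.
  by rewrite mulrA mulVf ?mul1r// lt_eqF.
Qed.

Lemma integral_power_weight_le (g S : R) : (0 < g)%R -> (0 < S)%R ->
  \int[lambda]_(s in `]0%R, S]) (pw g s)%:E <= (S `^ g / g)%:E.
Proof.
move=> g0 S0.
(* The fundamental theorem of calculus is applied away from the singularity at 0; the denominator
   starts at 2 so that no interval degenerates. *)
have -> : `]0%R, S]%classic = \bigcup_n `[(S / n.+2%:R)%R, S]%classic.
  apply/seteqP; split=> [x|x [n _]] /=; rewrite !in_itv/= => /andP[x0 xS].
    exists (Num.truncn (S / x)) => //=; rewrite in_itv/= xS andbT.
    rewrite ler_pdivrMr// mulrC -ler_pdivrMr// (le_trans (ltW (truncnS_gt _)))//.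
    by rewrite ler_nat.
  by rewrite xS andbT (lt_le_trans _ x0)// divr_gt0.
have mpw : measurable_fun setT (EFin \o pw g).
  by apply/measurable_EFinP; exact: measurable_power_weight.
apply: ge0_integral_bigcup_nondecreasing_le => //.
- move=> m n mn; apply/subsetPset => x /=; rewrite !in_itv/= => /andP[Sx ->].
  rewrite andbT (le_trans _ Sx)// ler_pM2l// lef_pV2 ?posrE ?ltr0n//.
  by rewrite ler_nat.
- by move=> x; rewrite lee_fin power_weight_ge0.
move=> n; set a := (S / n.+2%:R)%R.
have a0 : (0 < a)%R by rewrite divr_gt0.
have aS : (a < S)%R.
  by rewrite ltr_pdivrMr// ltr_pMr// ltr1n.
rewrite (eq_integral (fun s : measurableTypeR R => (s `^ (g - 1))%:E)); last first.
  move=> s; rewrite inE/= in_itv/= => /andP[as_ _].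
  by rewrite /pw (lt_le_trans a0).
have Dg x : (a < x)%R -> derivable (fun s : R => s `^ g)%R x 1.
  by move=> ax; apply: derivable_powR; rewrite in_itv/= (lt_trans a0).
rewrite (@continuous_FTC2 _ _ (fun s => g^-1 * s `^ g)%R a S) => //.
- rewrite -EFinB lee_fin mulrC lerBlDr lerDl.
  by rewrite mulr_ge0 ?powR_ge0// invr_ge0 ltW.
- apply: derivable_within_continuous => x; rewrite in_itv/= => /andP[ax _].
  by apply: derivable_powR; rewrite in_itv/= (lt_le_trans a0).
- split=> [x||].
  + by rewrite in_itv/= => /andP[ax _]; apply: derivableM => //; exact: Dg.
  + by apply: cvg_at_right_filter; apply: cvgMl_tmp; exact: powR_continuous.
  + by apply: cvg_at_left_filter; apply: cvgMl_tmp; exact: powR_continuous.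
- move=> x; rewrite in_itv/= => /andP[ax _].
  rewrite derive1Ml; last exact: Dg.
  rewrite powR_derive1 ?in_itv/= ?(lt_trans a0)//.
  by rewrite mulrA mulVf ?mul1r// gt_eqF.
Qed.

End power_integrals.

(** * One-dimensional weak-type estimates *)

Section vitali_intervals.
Context (R : realType).
Local Open Scope ring_scope.

(** Option values let finite and empty families be indexed by all of [nat]; the absence of
    repetitions preserves disjointness under reindexing. *)
Lemma countable_enum (T : Type) (D : set T) : countable D ->
  exists e : nat -> option T, (forall x, D x <-> exists n, e n = Some x) /\
    forall m n x, e m = Some x -> e n = Some x -> m = n.
Proof.
elim/Ppointed: T => T in D *.
  by move=> _; exists (fun=> None); split=> // x; have := no x.
move=> /countable_injP[f finj].
exists (fun n => if pselect (exists2 x, D x & f x = n) is left H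
  then Some (sval (cid2 H)) else None); split.
  move=> x; split=> [Dx|[n]]; last first.
    by case: pselect => // H [<-]; case: cid2.
  exists (f x); case: pselect => [H|[]]; last by exists x.
  congr Some; case: cid2 => y /= Dy fyx.
  by apply: finj => //; rewrite inE.
move=> m n x; case: pselect => // H [<-]; case: pselect => // H' [].
by case: cid2 => y/= Dy <-; case: cid2 => z/= Dz <- ->.
Qed.

Lemma closure_ballP (c r x : R) : 0 < r ->
  closure (ball c r) x <-> c - r <= x <= c + r.
Proof.
move=> r0; rewrite -[closure _]/(closed_ball c r) closed_ballE// /closed_ball_/=.
by rewrite ler_distlC.
Qed.

(** An interval is coded by its left end and its length. Each member of [V] meets a selected
    interval at least half as long, so its left end lies at most its own length to the left of
    [a n]. Padding indices have [s n = 0], that is, an empty interval. *)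
Lemma vitali_intervals (V : set (R * R)) (M : R) :
  (forall i, V i -> 0 < i.2 <= M) ->
  exists a s : nat -> R, [/\ forall n, 0 <= s n,
    forall n, 0 < s n -> V (a n, s n),
    trivIset setT (fun n => `]a n, a n + s n]%classic) &
    forall i, V i -> exists n, [/\ 0 < s n, i.2 <= 2 * s n &
      a n - i.2 <= i.1 <= a n + s n]].
Proof.
move=> VM.
(* Radii have to be positive for every index, also outside [V]; hence the default 1. *)
pose rad (i : R * R) := if 0 < i.2 then i.2 / 2 else 1.
have rad0 i : 0 < rad i by rewrite /rad; case: ifPn => // ?; rewrite divr_gt0.
pose B (i : R * R) : set R := ball (i.1 + i.2 / 2) (rad i).
have BE i : 0 < i.2 -> forall x, closure (B i) x <-> i.1 <= x <= i.1 + i.2.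
  move=> i0 x; rewrite closure_ballP// /rad i0 addrK.
  by rewrite -addrA -splitr.
have radB i : (radius (B i))%:num = rad i by rewrite radius_ball_num// ltW.
have := @vitali_lemma_infinite R _ B V (M / 2).
case.
- by move=> i; exact: is_ball_ball.
- by move=> i; rewrite radB.
- move=> i /VM /andP[i0 iM]; rewrite radB /rad i0.
  by rewrite ler_pM2r// invr_gt0.
move=> D [cD DV tD cover].
have [e [eD einj]] := countable_enum cD.
pose a n := if e n is Some i then i.1 else 0.
pose s n := if e n is Some i then i.2 else 0.
have s0 n : 0 < s n -> exists2 i, e n = Some i & D i.
  rewrite /s; case en : (e n) => [i|]; last by rewrite ltxx.
  by move=> i0; exists i => //; apply/eD; exists n.
exists a, s; split.
- move=> n; rewrite /s; case en : (e n) => [i|//].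
  have /DV/VM/andP[/ltW//] : D i by apply/eD; exists n.
- move=> n /s0[i en Di]; rewrite /a /s en -surjective_pairing; exact: DV.
- move=> m n _ _ [x []]/=.
  rewrite !in_itv/= => /andP[am ms] /andP[an ns].
  have [i em Di] : exists2 i, e m = Some i & D i.
    by apply: s0; rewrite -(ltrD2l (a m)) addr0 (lt_le_trans am).
  have [j en Dj] : exists2 i, e n = Some i & D i.
    by apply: s0; rewrite -(ltrD2l (a n)) addr0 (lt_le_trans an).
  move: am ms an ns; rewrite /a /s em en => am ms an ns.
  suff ij : i = j by apply: (einj _ _ i) => //; rewrite ij.
  have /VM/andP[i0 _] := DV _ Di; have /VM/andP[j0 _] := DV _ Dj.
  apply: (tD i j) => //; exists x; split; apply/BE => //.
    by rewrite ms ltW.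
  by rewrite ns ltW.
- move=> i Vi; have /andP[i0 _] := VM _ Vi.
  have [j [Dj [x [xi xj]]]] := cover _ Vi.
  have /VM/andP[j0 _] := DV _ Dj.
  have radE k : 0 < k.2 -> rad k = k.2 / 2 by rewrite /rad => ->.
  move=> ij _; have {}ij : i.2 / 2 / 2 <= j.2 / 2 by rewrite -!radE// -!radB.
  have [n en] := (eD j).1 Dj.
  exists n; rewrite /a /s en; split => //.
    lra.
  move/BE : xi => /(_ i0) /andP[? ?]; move/BE : xj => /(_ j0) /andP[? ?].
  by apply/andP; split; lra.
Qed.

End vitali_intervals.

(** * Measurability, and the mass of an interval *)

Section measurability_helpers.
Context d (T : measurableType d) (R : realType).

Lemma measurable_fun_lte (f g : T -> \bar R) : measurable_fun setT f ->
  measurable_fun setT g -> measurable_fun setT (fun x => f x < g x).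
Proof.
move=> mf mg; apply: (measurable_fun_bool true).
exact: measurable_lte.
Qed.

Lemma integral_mkif (m : {measure set T -> \bar R}) (b : pred T) (f : T -> \bar R) :
  \int[m]_(x in [set x | b x]) f x = \int[m]_x (if b x then f x else 0).
Proof.
rewrite integral_mkcond; apply: eq_integral => x _; rewrite patchE.
by case: (boolP (b x)) => bx; [rewrite mem_set|rewrite memNset//=; exact/negP].
Qed.

Lemma measurable_set_bool (b : pred T) : measurable_fun setT b ->
  measurable [set x | b x].
Proof.
move=> mb; rewrite (_ : [set x | b x] = setT `&` b @^-1` [set true]).
  exact: mb.
by rewrite setTI; apply/seteqP; split => x.
Qed.

End measurability_helpers.

Section mass.
Context (R : realType).
Local Notation lambda := (@lebesgue_measure R).

Definition mass (phi : R -> \bar R) (a s : R) : \bar R :=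
  \int[lambda]_(t in `]a, (a + s)%R]) phi t.

Section measurable_mass.
Context d (T : measurableType d) (f : T * R -> \bar R).
Hypotheses (mf : measurable_fun setT f) (f0 : forall z, 0 <= f z).

(** The moving interval is absorbed into the integrand, so that Tonelli yields joint measurability
    in parameter, start and length. *)
Lemma measurable_fun_mass :
  measurable_fun setT (fun z : T * (R * R) => mass (fun t => f (z.1, t)) z.2.1 z.2.2).
Proof.
pose h (w : (T * (R * R)) * R) : \bar R :=
  if (w.1.2.1 < w.2)%R && (w.2 <= w.1.2.1 + w.1.2.2)%R then f (w.1.1, w.2) else 0.
have mh : measurable_fun setT h.
  have m1 : measurable_fun setT (fun w : (T * (R * R)) * R => w.1.2.1).
    by do 2 apply: measurableT_comp => //.
  have m2 : measurable_fun setT (fun w : (T * (R * R)) * R => w.1.2.2).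
    by do 2 apply: measurableT_comp => //.
  apply: measurable_fun_ifT => //.
    apply: measurable_and; first exact: measurable_fun_ltr.
    by apply: measurable_fun_ler => //; exact: measurable_funD.
  apply: (measurableT_comp mf); apply: measurable_fun_pair => //.
  exact: (measurableT_comp measurable_fst measurable_fst).
have h0 w : 0 <= h w by rewrite /h; case: ifP.
have := @measurable_fun_fubini_tonelli_F _ _ _ _ _ lambda h mh h0.
apply: eq_measurable_fun => -[x [a s]] _; rewrite /fubini_F /mass/= -integral_mkif.
by congr (integral _ _ _); apply/seteqP; split=> t/=; rewrite in_itv.
Qed.

End measurable_mass.
End mass.

Lemma measurable_fun_section d1 d2 (T1 : measurableType d1) (T2 : measurableType d2)
    (R : realType) (m : {sigma_finite_measure set T1 -> \bar R}) (b : T1 * T2 -> bool) :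
  measurable_fun setT b -> measurable_fun setT (fun y => m [set x | b (x, y)]).
Proof.
move=> mb; have /(measurable_fun_ysection m) := measurable_set_bool mb.
apply: eq_measurable_fun => y _; rewrite /=; congr (m _).
by rewrite /ysection; apply/seteqP; split=> x/=; rewrite inE.
Qed.

Section one_dimensional.
Context (R : realType).
Local Notation lambda := (@lebesgue_measure R).
Variable phi : R -> \bar R.
Hypotheses (mphi : measurable_fun setT phi) (phi0 : forall t, 0 <= phi t).

Lemma measurable_mass2 : measurable_fun setT (fun z : R * R => mass phi z.1 z.2).
Proof.
pose f (z : unit * R) := phi z.2.
have mf : measurable_fun setT f by exact: measurableT_comp.
have mg : measurable_fun setT (fun w : R * R => (tt, w)).
  exact: measurable_fun_pair.
exact: (measurableT_comp (@measurable_fun_mass _ _ _ f mf (fun z => phi0 _)) mg).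
Qed.

Lemma measurable_bad (g : R) :
  measurable_fun setT (fun z : R * R => (z.2 `^ g)%:E < mass phi z.1 z.2).
Proof.
apply: measurable_fun_lte; last exact: measurable_mass2.
apply/measurable_EFinP; apply: (measurableT_comp (measurable_powR g)).
exact: measurable_snd.
Qed.

Lemma measurable_bad1 (g s : R) :
  measurable [set a | (s `^ g)%:E < mass phi a s].
Proof.
apply: measurable_set_bool.
have mg : measurable_fun setT (fun a : R => (a, s)) by exact: measurable_fun_pair.
exact: (measurableT_comp (measurable_bad g) mg).
Qed.

Lemma mass_ge0 a s : 0 <= mass phi a s.
Proof. exact: integral_ge0. Qed.

Lemma mass_le a s : mass phi a s <= \int[lambda]_t phi t.
Proof. exact: ge0_subset_integral. Qed.

Lemma lebesgue_itvcc_le (a b c : R) : (a <= b)%R -> (b - a <= c)%R ->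
  lambda `[a, b] <= c%:E.
Proof.
move=> ab bac; rewrite lebesgue_measure_itv/= lte_fin.
by case: ifPn => [_|]; rewrite -?EFinB lee_fin// (le_trans _ bac)// subr_ge0.
Qed.

Lemma le_mass a s a' s' : (a <= a')%R -> (a' + s' <= a + s)%R ->
  mass phi a' s' <= mass phi a s.
Proof.
move=> aa' ss'; apply: ge0_subset_integral => //; first exact: measurable_funTS.
move=> t/=; rewrite !in_itv/= => /andP[ta ts].
by rewrite (le_lt_trans aa')//= (le_trans ts).
Qed.

Lemma massD a s t : (0 <= s)%R -> (0 <= t)%R ->
  mass phi a (s + t) = mass phi a s + mass phi (a + s) t.
Proof.
move=> s0 t0; rewrite /mass -ge0_integral_setU//=.
- congr (integral _ _ _); apply/seteqP; split=> x/=; rewrite !in_itv/= addrA.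
    move=> /andP[-> xst]/=; have [xs|xs] := leP x (a + s)%R; [by left|by right].
  move=> [/andP[-> xs]|/andP[xs ->]]; first by rewrite (le_trans xs)// lerDl.
  by rewrite andbT (le_lt_trans _ xs)// lerDl.
- exact: measurable_funTS.
- rewrite disj_set2E; apply/eqP/seteqP; split=> // x [] /=; rewrite !in_itv/=.
  by move=> /andP[_ xs] /andP[sx _]; move: (lt_le_trans sx xs); rewrite ltxx.
Qed.

(** A bad interval attributed to a selected one of length [s n] starts in a window of length
    [3 * s n] and has length at most [2 * s n]. Integrating the weight over these lengths gives
    [3 * s n * (2 * s n)^g / g], a multiple of [s n^(g+1)], and the selected interval is itself bad,
    so its mass exceeds this power. Disjointness sums the masses. *)
Lemma maximal_estimate_pos (g : R) : (0 < g)%R ->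
  \int[lambda]_s ((power_weight g s)%:E *
     lambda [set a | (s `^ (g + 1))%:E < mass phi a s]) <=
  (3 * 2 `^ g / g)%:E * \int[lambda]_t phi t.
Proof.
move=> g0; have C0 : (0 < 3 * 2 `^ g / g :> R)%R.
  by rewrite divr_gt0// mulr_gt0// powR_gt0.
have [->|phioo] := eqVneq (\int[lambda]_t phi t) +oo.
  by rewrite gt0_muley ?lte_fin// leey.
have I0 : 0 <= \int[lambda]_t phi t by exact: integral_ge0.
pose M0 := fine (\int[lambda]_t phi t).
have M0E : \int[lambda]_t phi t = M0%:E.
  by rewrite fineK// ge0_fin_numE// ltey.
pose V := [set i : R * R | (0 < i.2)%R /\ (i.2 `^ (g + 1))%:E < mass phi i.1 i.2].
have g1 : (0 < g + 1)%R by rewrite addr_gt0.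
(* Every bad length satisfies [s^(g+1) <= M0]: the lengths are bounded, as the covering lemma
   demands. *)
have VM i : V i -> (0 < i.2 <= M0 `^ (g + 1)^-1)%R.
  move=> [i0 ibad]; rewrite i0/=.
  have : (i.2 `^ (g + 1) <= M0)%R.
    by rewrite -lee_fin -M0E (le_trans (ltW ibad))// mass_le.
  move=> le1; rewrite -(@powRK _ (g + 1) i.2 (lt0r_neq0 g1) (ltW i0)).
  by rewrite le_powR_base ?invr_ge0 ?powR_ge0// ltW.
have [a [s [s0 sV tF cov]]] := vitali_intervals VM.
(* [c n t] bounds the measure of the bad starts of length [t] that are attributed to the [n]-th
   selected interval. *)
pose c n : R -> \bar R := fun t => if (t <= 2 * s n)%R then (3 * s n)%:E else 0.
have mc n : measurable_fun setT (c n).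
  by apply: measurable_fun_ifT => //; exact: measurable_fun_ler.
have c0 n t : 0 <= c n t.
  by rewrite /c; case: ifP => // _; rewrite lee_fin mulr_ge0.
have mpc n : measurable_fun setT (fun t => (power_weight g t)%:E * c n t).
  by apply: emeasurable_funM; first exact: emeasurable_power_weight.
have step1 t : (0 < t)%R ->
    lambda [set a | (t `^ (g + 1))%:E < mass phi a t] <= \sum_(n <oo) c n t.
  move=> t0; pose F n : set R := if (t <= 2 * s n)%R
    then `[(a n - 2 * s n)%R, (a n + s n)%R]%classic else set0.
  have mF n : measurable (F n) by rewrite /F; case: ifP.
  apply: le_trans.
    apply: (measure_sigma_subadditive lambda mF); first exact: measurable_bad1.
    move=> b/= bbad; have [n [sn0 tsn /andP[n1 n2]]] := cov (b, t) (conj t0 bbad).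
    move: tsn n1 n2 => /= tsn n1 n2.
    exists n => //; rewrite /F tsn/= in_itv/= n2 andbT.
    by rewrite (le_trans _ n1)// lerD2l lerN2.
  apply: lee_nneseries => // n _; rewrite /F /c; case: ifPn => [_|_].
    by apply: lebesgue_itvcc_le; have := s0 n; lra.
  by rewrite measure0.
apply: (@le_trans _ _ (\int[lambda]_t \sum_(n <oo) ((power_weight g t)%:E * c n t))).
  apply: ge0_le_integral => //.
  - by move=> t _; rewrite mule_ge0// lee_fin power_weight_ge0.
  - apply: emeasurable_funM; first exact: emeasurable_power_weight.
    exact: (measurable_fun_section lambda (measurable_bad (g + 1)%R)).
  - apply: ge0_emeasurable_sum; last by move=> n _; exact: mpc.
    by move=> n t _ _; rewrite mule_ge0// lee_fin power_weight_ge0.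
  - move=> t _; rewrite nneseriesZl//.
    have [t0|t0] := ltP 0%R t; last first.
      by rewrite /power_weight ltNge t0/= !mul0e.
    by apply: lee_wpmul2l; [rewrite lee_fin power_weight_ge0|exact: step1].
rewrite integral_nneseries//; last first.
  by move=> n t _; rewrite mule_ge0// lee_fin power_weight_ge0.
have step2 n : \int[lambda]_t ((power_weight g t)%:E * c n t) <=
    (3 * 2 `^ g / g)%:E * \int[lambda]_(t in `]a n, (a n + s n)%R]) phi t.
  have := s0 n; rewrite le_eqVlt => /predU1P[sn0|sn0].
    rewrite /c -sn0 mulr0 addr0 set_itvoc0 integral_set0 mule0 integral0_eq//.
    by move=> t _; case: ifP; rewrite ?mulr0 mule0.
  pose k t := ((3 * s n)%:E * (power_weight g t)%:E)%E.
  rewrite (_ : (fun t => _) = (k \_ `]0%R, (2 * s n)%R])); last first.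
    apply/funext => t; rewrite patchE /c /k /power_weight.
    have [/set_mem/=|] := boolP (t \in `]0%R, (2 * s n)%R]%classic).
      by rewrite in_itv/= => /andP[-> ->]; rewrite muleC.
    rewrite notin_setE/= in_itv/= => /negP; rewrite negb_and.
    by case/orP => /negbTE ->; rewrite ?mul0e ?mule0.
  rewrite -integral_mkcond ge0_integralZl//; last 3 first.
  - by apply: measurable_funTS; exact: emeasurable_power_weight.
  - by move=> t _; rewrite lee_fin power_weight_ge0.
  - by rewrite lee_fin mulr_ge0// ltW.
  apply: (@le_trans _ _ ((3 * s n)%:E * ((2 * s n) `^ g / g)%:E)).
    apply: lee_wpmul2l; first by rewrite lee_fin mulr_ge0// ltW.
    by apply: integral_power_weight_le => //; rewrite mulr_gt0.
  apply: (@le_trans _ _ ((3 * 2 `^ g / g)%:E * (s n `^ (g + 1))%:E)).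
    rewrite -!EFinM lee_fin powRM ?(ltW sn0)//.
    rewrite powRD ?(gt_eqF sn0) ?implybT// powRr1 ?(ltW sn0)//.
    by rewrite le_eqVlt; apply/orP; left; apply/eqP; ring.
  apply: lee_wpmul2l; first by rewrite lee_fin ltW.
  by have [_ /= /ltW] := sV _ sn0.
apply: (le_trans (lee_nneseries _ (fun n _ => step2 n))).
  by move=> n _ _; apply: integral_ge0 => t _; rewrite mule_ge0// lee_fin power_weight_ge0.
rewrite nneseriesZl; last by move=> n _; exact: integral_ge0.
rewrite -ge0_integral_bigcup//.
  apply: lee_wpmul2l; first by rewrite lee_fin ltW.
  apply: ge0_subset_integral => //; exact: bigcup_measurable.
exact: measurable_funTS.
Qed.

End one_dimensional.

(** * Exponents below -1: stopping points *)

Section maximal_estimate_neg.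
Context (R : realType).
Local Notation lambda := (@lebesgue_measure R).

Section positive_density.
Variable phi : R -> \bar R.
Hypotheses (mphi : measurable_fun setT phi) (phi0 : forall t, 0 <= phi t).
Hypothesis phioo : \int[lambda]_t phi t < +oo.
Hypothesis phi_gt0 : forall a s, (1 <= a)%R -> (0 < s)%R -> 0 < mass phi a s.
Variable b : R.
Hypothesis b0 : (b < 0)%R.

Let M0 := fine (\int[lambda]_t phi t).

Let M0E : \int[lambda]_t phi t = M0%:E.
Proof. by rewrite fineK// ge0_fin_numE// integral_ge0. Qed.

Let massE a s : mass phi a s = (fine (mass phi a s))%:E.
Proof.
by rewrite fineK// ge0_fin_numE ?mass_ge0// (le_lt_trans _ phioo)// mass_le.
Qed.

Let M0_gt0 : (0 < M0)%R.
Proof. by rewrite -lte_fin -M0E (lt_le_trans (phi_gt0 (lexx 1) ltr01))// mass_le. Qed.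

(** Since [b < 0], the condition [s^b <= M] means [delta M <= s]: this is the least length that a
    mass [M > 0] allows to be bad. *)
Let delta (M : R) := (M `^ b^-1)%R.

Let delta_gt0 M : (0 < M)%R -> (0 < delta M)%R.
Proof. exact: powR_gt0. Qed.

Let delta_le M s : (0 < s)%R -> (s `^ b <= M)%R -> (delta M <= s)%R.
Proof.
move=> s0 sM; rewrite -[leRHS](powRK (ltr0_neq0 b0) (ltW s0)).
by apply: ge_powR_base => //; rewrite ?powR_gt0// invr_le0 ltW.
Qed.

(** [r] is chosen in the set of lengths with [r^b <= mass phi t r], within [delta M0] of its
    infimum; attainment of the infimum is thereby avoided, and the slack is harmless because no bad
    length is below [delta M0]. The set is nonempty because there is mass to the right of [t] while
    [r^b] tends to 0. The lower bound on [r] makes the chain of points exhaust the half-line. *)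
Let next_point (t : R) : (1 <= t)%R -> exists r : R, [/\ (delta M0 <= r)%R,
  forall s, (0 < s)%R -> (s <= r - delta M0)%R -> mass phi t s <= (s `^ b)%:E &
  (r `^ b)%:E <= mass phi t r].
Proof.
move=> t1; pose S := [set r : R | (0 < r)%R /\ (r `^ b)%:E <= mass phi t r].
have Sdelta r : S r -> (delta M0 <= r)%R.
  move=> [r0 rS]; apply: delta_le => //.
  by rewrite -lee_fin -M0E (le_trans rS)// mass_le.
have S0 : S !=set0.
  pose m := fine (mass phi t 1).
  have m0 : (0 < m)%R by rewrite -lte_fin -massE phi_gt0.
  exists (Num.max 1 (delta m))%R; split; first by rewrite lt_max ltr01.
  apply: (@le_trans _ _ m%:E).
    rewrite lee_fin -[leRHS](powRVK (ltr0_neq0 b0) (ltW m0)).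
    by apply: ge_powR_base; [exact: ltW|exact: powR_gt0|rewrite le_max lexx orbT].
  by rewrite -massE; apply: le_mass => //; rewrite lerD2l le_max lexx.
have infS : has_inf S by split => //; exists (delta M0) => r /Sdelta.
have [r Sr rinf] := inf_adherent (delta_gt0 M0_gt0) infS.
exists r; split; [exact: Sdelta| |by case: Sr].
move=> s s0 sr; rewrite leNgt; apply/negP => sbad.
have /(ge_inf infS.2) : S s by split => //; exact: ltW.
by apply/negP; rewrite -ltNge; lra.
Qed.

Let nx (t : R) : R := if pselect (1 <= t)%R is left t1
  then t + sval (cid (next_point t1)) else t.

Let tt (k : nat) : R := iter k nx 1%R.

Let rr (k : nat) : R := (tt k.+1 - tt k)%R.

Let tt_ge k : (1 <= tt k)%R.
Proof.
elim: k => [//|k IH]; rewrite /tt iterS -/(tt k) /nx; case: pselect => // t1.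
case: cid => r/= [r1 _ _]; rewrite (le_trans t1)// lerDl (le_trans _ r1)// ltW//.
exact: delta_gt0.
Qed.

Let rrP k : [/\ (delta M0 <= rr k)%R,
  forall s, (0 < s)%R -> (s <= rr k - delta M0)%R -> mass phi (tt k) s <= (s `^ b)%:E &
  (rr k `^ b)%:E <= mass phi (tt k) (rr k)].
Proof.
have -> : rr k = sval (cid (next_point (tt_ge k))).
  rewrite /rr {1}/tt iterS -/(tt k) /nx; case: pselect => [t1|]; last first.
    by rewrite tt_ge.
  by rewrite (Prop_irrelevance t1 (tt_ge k)) addrAC subrr add0r.
by case: cid.
Qed.

Let rr_gt0 k : (0 < rr k)%R.
Proof. by have [h _ _] := rrP k; rewrite (lt_le_trans _ h)// delta_gt0. Qed.

Let ttS k : tt k.+1 = (tt k + rr k)%R.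
Proof. by rewrite /rr addrC subrK. Qed.

Let tt_lb k : (k%:R * delta M0 <= tt k)%R.
Proof.
elim: k => [|k IH]; first by rewrite mul0r ler01.
by rewrite ttS -natr1 mulrDl mul1r lerD//; case: (rrP k).
Qed.

Let tt_cover a : (1 <= a)%R -> exists k, (tt k <= a < tt k.+1)%R.
Proof.
move=> a1; have ex : exists k, (a < tt k)%R.
  exists (Num.truncn (a / delta M0)).+1; rewrite (lt_le_trans _ (tt_lb _))//.
  by rewrite -ltr_pdivrMr ?delta_gt0// truncnS_gt.
have [[|k] ak kmin] := ex_minnP ex; first by move: ak; rewrite /tt/= ltNge a1.
exists k; rewrite ak andbT leNgt; apply/negP => /kmin.
by rewrite ltnn.
Qed.

Let MM k := fine (mass phi (tt k) (rr k + rr k.+1)).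

(** A bad interval starting in cell [k] either ends before [tt k.+2], so that its mass is at most
    [MM k], or contains the whole next cell and is longer than [rr k.+1]. If it ended more than
    [delta M0] before [tt k.+1], it would lie in an initial piece of the cell whose mass is, by the
    stopping rule, at most a power [b] of a length no smaller than [s], hence at most [s^b]. *)
Let bad_delta k a s : (tt k <= a < tt k.+1)%R -> (0 < s)%R ->
  (s `^ b)%:E < mass phi a s ->
  (delta (MM k) <= s)%R /\ (tt k.+1 - delta M0 - s <= a)%R.
Proof.
move=> /andP[ka ak] s0 sbad.
have kk := rr_gt0 k; have Sk := ttS k; have SSk := ttS k.+1.
have d0 := delta_gt0 M0_gt0; split.
- apply: delta_le => //; rewrite -lee_fin -massE.
  have [as_|as_] := leP (a + s)%R (tt k.+2).
    by rewrite (le_trans (ltW sbad))//; apply: le_mass => //; lra.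
  have [_ _ rrb] := rrP k.+1.
  apply: (@le_trans _ _ (rr k.+1 `^ b)%:E).
    rewrite lee_fin; apply: ge_powR_base => //; first exact: ltW.
    lra.
  apply: (le_trans rrb); apply: le_mass => //; lra.
- rewrite leNgt; apply/negP => aks.
  have as0 : (0 < a + s - tt k)%R by lra.
  have [_ /(_ _ as0) rrk _] := rrP k.
  have : (s `^ b)%:E < ((a + s - tt k) `^ b)%:E.
    apply: (lt_le_trans sbad); apply: le_trans (rrk _); last by lra.
    by apply: le_mass => //; lra.
  rewrite lte_fin ltNge => /negP; apply.
  by apply: ge_powR_base => //; [exact: ltW|lra].
Qed.

Let MM_gt0 k : (0 < MM k)%R.
Proof. by rewrite -lte_fin -massE phi_gt0// addr_gt0. Qed.

Let MM_le k : (MM k <= M0)%R.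
Proof. by rewrite -lee_fin -massE -M0E mass_le. Qed.

Let mass_series : \sum_(k <oo) mass phi (tt k) (rr k) <= \int[lambda]_t phi t.
Proof.
have tF : trivIset setT (fun k => `]tt k, (tt k + rr k)%R]%classic).
  have nd m n : (m < n)%N -> (tt m.+1 <= tt n)%R.
    elim: n => // n IH; rewrite ltnS leq_eqVlt => /predU1P[->//|/IH mn].
    by rewrite (le_trans mn)// ttS lerDl ltW.
  move=> m n _ _ [x []]/=; rewrite !in_itv/= -!ttS => /andP[mx xm] /andP[nx_ xn].
  have [mn|nm|//] := ltngtP m n.
    by move: (lt_le_trans nx_ (le_trans xm (nd _ _ mn))); rewrite ltxx.
  by move: (lt_le_trans mx (le_trans xn (nd _ _ nm))); rewrite ltxx.
rewrite -ge0_integral_bigcup//; last exact: measurable_funTS.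
by apply: ge0_subset_integral => //; exact: bigcup_measurable.
Qed.

(** Each cell is counted in at most two of the [MM k]. *)
Let MM_series : \sum_(k <oo) (MM k)%:E <= 2%:E * \int[lambda]_t phi t.
Proof.
under eq_eseriesr do rewrite /MM -massE massD ?(ltW (rr_gt0 _))// -ttS.
rewrite nneseriesD; [|by move=> n _ _; exact: mass_ge0..].
rewrite mule_natl mule2n; apply: leeD; first exact: mass_series.
apply: le_trans mass_series.
rewrite [leRHS](nneseries_recl)//; last by move=> k _; exact: mass_ge0.
rewrite -(nneseries_addn 1 (f := fun k => mass phi (tt k) (rr k))); last first.
  by move=> k; exact: mass_ge0.
rewrite (eq_eseriesr (g := fun k => mass phi (tt (k + 1)) (rr (k + 1)))); last first.
  by move=> k _; rewrite addn1.
by rewrite leeDr// mass_ge0.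
Qed.

(** At length [s] the bad starts of cell [k] fill a window of length at most
    [s + delta M0 <= 2 * s], and only when [delta (MM k) <= s]. The weight times [2 * s] integrates
    from there to [2 * MM k / - b]; summing the [MM k] costs the second factor 2. *)
Lemma maximal_estimate_neg_pos :
  \int[lambda]_s ((power_weight (b - 1)%R s)%:E *
     lambda [set a | (1 <= a)%R && ((s `^ b)%:E < mass phi a s)]) <=
  (4 / - b)%:E * \int[lambda]_t phi t.
Proof.
pose c k : R -> \bar R := fun s => if (delta (MM k) <= s)%R then (2 * s)%:E else 0.
have mc k : measurable_fun setT (c k).
  apply: measurable_fun_ifT => //; first exact: measurable_fun_ler.
  by apply/measurable_EFinP; exact: measurable_funM.
have c0 k s : 0 <= c k s.
  rewrite /c; case: ifP => // ks; rewrite lee_fin mulr_ge0//.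
  by rewrite (le_trans _ ks)// ltW// delta_gt0.
have mpc k : measurable_fun setT (fun t => (power_weight (b - 1)%R t)%:E * c k t).
  by apply: emeasurable_funM; first exact: emeasurable_power_weight.
have mbad1 : measurable_fun setT (fun z : R * R =>
    (1 <= z.1)%R && ((z.2 `^ b)%:E < mass phi z.1 z.2)).
  by apply: measurable_and; [exact: measurable_fun_ler|exact: measurable_bad].
have step1 s : (0 < s)%R ->
    lambda [set a | (1 <= a)%R && ((s `^ b)%:E < mass phi a s)] <= \sum_(k <oo) c k s.
  move=> s0; pose F k : set R := if (delta (MM k) <= s)%R
    then `[(tt k.+1 - delta M0 - s)%R, tt k.+1]%classic else set0.
  have mF k : measurable (F k) by rewrite /F; case: ifP.
  apply: le_trans.
    apply: (measure_sigma_subadditive lambda mF).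
      have mg : measurable_fun setT (fun a : R => (a, s)) by exact: measurable_fun_pair.
      by apply: measurable_set_bool; exact: (measurableT_comp mbad1 mg).
    move=> a/= /andP[a1 abad]; have [k ka] := tt_cover a1.
    have [kd ks] := bad_delta ka s0 abad.
    exists k => //; rewrite /F kd/= in_itv/= ks/=.
    by case/andP : ka => _ /ltW.
  apply: lee_nneseries => // k _; rewrite /F /c; case: ifPn => [ks|_].
    have d0 := delta_gt0 M0_gt0.
    (* [delta] is nonincreasing and [MM k <= M0]. *)
    have : (delta M0 <= s)%R.
      by apply: le_trans ks; apply: ge_powR_base; rewrite ?MM_le// invr_le0 ltW.
    move: (tt k.+1) (delta M0) d0 => u d d0 ds.
    apply: lebesgue_itvcc_le.
      by rewrite -addrA gerDl -opprD oppr_le0 addr_ge0// ltW.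
    by rewrite -addrA -opprD opprB addrCA subrr addr0 mulr_natl mulr2n lerD2r.
  by rewrite measure0.
apply: (@le_trans _ _ (\int[lambda]_t \sum_(k <oo) ((power_weight (b - 1)%R t)%:E * c k t))).
  apply: ge0_le_integral => //.
  - by move=> t _; rewrite mule_ge0// lee_fin power_weight_ge0.
  - apply: emeasurable_funM; first exact: emeasurable_power_weight.
    exact: (measurable_fun_section lambda mbad1).
  - apply: ge0_emeasurable_sum; last by move=> k _; exact: mpc.
    by move=> k t _ _; rewrite mule_ge0// lee_fin power_weight_ge0.
  - move=> t _; rewrite nneseriesZl//.
    have [t0|t0] := ltP 0%R t; last first.
      by rewrite /power_weight ltNge t0/= !mul0e.
    by apply: lee_wpmul2l; [rewrite lee_fin power_weight_ge0|exact: step1].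
rewrite integral_nneseries//; last first.
  by move=> k t _; rewrite mule_ge0// lee_fin power_weight_ge0.
have b0' : (0 < - b)%R by rewrite oppr_gt0.
have step2 k : \int[lambda]_t ((power_weight (b - 1)%R t)%:E * c k t) <=
    (2 / - b)%:E * (MM k)%:E.
  have dk0 := delta_gt0 (MM_gt0 k).
  rewrite (_ : (fun t => _) =
      ((fun t => 2%:E * (power_weight b t)%:E) \_ `[delta (MM k), +oo[)); last first.
    apply/funext => t; rewrite patchE /c /power_weight.
    have [/set_mem/=|] := boolP (t \in `[delta (MM k), +oo[%classic).
      rewrite in_itv/= andbT => kt; have t0 := lt_le_trans dk0 kt.
      rewrite kt t0 -!EFinM; congr EFin.
      rewrite powRD ?(gt_eqF t0) ?implybT// powRN powRr1 ?(ltW t0)//.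
      by field; rewrite gt_eqF.
    rewrite notin_setE/= in_itv/= andbT => /negP/negbTE ->.
    by rewrite mule0.
  rewrite -integral_mkcond ge0_integralZl//; last 2 first.
  - by apply: measurable_funTS; exact: emeasurable_power_weight.
  - by move=> t _; rewrite lee_fin power_weight_ge0.
  rewrite integral_power_weight_ge// -!EFinM lee_fin powRVK ?ltr0_neq0// ?(ltW (MM_gt0 k))//.
  by rewrite [leLHS]mulrA [leRHS]mulrAC.
apply: (le_trans (lee_nneseries _ (fun n _ => step2 n))).
  by move=> n _ _; apply: integral_ge0 => t _; rewrite mule_ge0// lee_fin power_weight_ge0.
rewrite nneseriesZl; last by move=> n _; rewrite lee_fin ltW.
apply: (@le_trans _ _ ((2 / - b)%:E * (2%:E * \int[lambda]_t phi t))).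
  by apply: lee_wpmul2l; [rewrite lee_fin divr_ge0// ltW|exact: MM_series].
rewrite muleA -EFinM (_ : (2 / - b * 2 = 4 / - b)%R)//; by field; lra.
Qed.

End positive_density.

Lemma le_mass_fun (phi psi : R -> \bar R) a s : measurable_fun setT phi ->
  measurable_fun setT psi -> (forall t, 0 <= phi t) ->
  (forall t, phi t <= psi t) -> mass phi a s <= mass psi a s.
Proof.
move=> mphi mpsi phi0 le_phi; apply: ge0_le_integral => //;
  exact: measurable_funTS.
Qed.

(* The chain of stopping points needs positive mass to the right of each point,
   so a small integrable positive density is added. *)
Lemma maximal_estimate_neg (phi : R -> \bar R) (b : R) :
  measurable_fun setT phi -> (forall t, 0 <= phi t) -> (b < 0)%R ->
  \int[lambda]_s ((power_weight (b - 1)%R s)%:E *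
     lambda [set a | (1 <= a)%R && ((s `^ b)%:E < mass phi a s)]) <=
  (4 / - b)%:E * \int[lambda]_t phi t.
Proof.
move=> mphi phi0 b0; have b0' : (0 < - b)%R by rewrite oppr_gt0.
have C0 : (0 < 4 / - b)%R by rewrite divr_gt0.
have [->|phioo] := eqVneq (\int[lambda]_t phi t) +oo.
  by rewrite gt0_muley ?lte_fin// leey.
have fphi : \int[lambda]_t phi t < +oo by rewrite ltey.
(* This is [t^-2] on the half-line from 1, of integral 1. It decreases, so its mass on an interval
   is at least the length times the value at the right end. *)
pose p (t : R) : \bar R := (if 1 <= t then power_weight (-1) t else 0)%:E.
have mp : measurable_fun setT p.
  apply/measurable_EFinP; apply: measurable_fun_ifT => //.
    exact: measurable_fun_ler.
  exact: measurable_power_weight.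
have p0 t : 0 <= p t by rewrite /p lee_fin; case: ifP => // _; exact: power_weight_ge0.
have intp : \int[lambda]_t p t = 1.
  rewrite (_ : p = (fun t => (power_weight (-1) t)%:E) \_ `[1%R, +oo[); last first.
    apply/funext => t; rewrite /p patchE.
    have [/set_mem/=|] := boolP (t \in `[1%R, +oo[%classic).
      by rewrite in_itv/= andbT => ->.
    by rewrite notin_setE/= in_itv/= andbT => /negP/negbTE ->.
  rewrite -integral_mkcond integral_power_weight_ge ?oppr_lt0//.
  by rewrite powR1 opprK divr1.
apply/lee_addgt0Pr => e e0.
pose eta := (e / (4 / - b))%R.
have eta0 : (0 < eta)%R by rewrite divr_gt0.
pose psi t := phi t + eta%:E * p t.
have mep : measurable_fun setT (fun t => eta%:E * p t) by exact: measurable_funeM.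
have ep0 t : 0 <= eta%:E * p t by rewrite mule_ge0// lee_fin ltW.
have mpsi : measurable_fun setT psi by exact: emeasurable_funD.
have psi0 t : 0 <= psi t by rewrite adde_ge0.
have intpsi : \int[lambda]_t psi t = \int[lambda]_t phi t + eta%:E.
  rewrite ge0_integralD// ge0_integralZl//; last by rewrite lee_fin ltW.
  by rewrite intp mule1.
have -> : e%:E = (4 / - b)%:E * eta%:E.
  by rewrite -EFinM /eta mulrC divfK// gt_eqF.
rewrite -ge0_muleDr ?lee_fin ?integral_ge0 ?(ltW eta0)// -intpsi.
apply: le_trans (maximal_estimate_neg_pos mpsi psi0 _ _ b0); last 2 first.
- by rewrite intpsi lte_add_pinfty// ltry.
- move=> a s a1 s0; apply: (@lt_le_trans _ _ (mass (cst (eta * (a + s) `^ (-1 - 1))%:E) a s)).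
    rewrite /mass integral_cst//= lebesgue_measure_itv/= lte_fin ltrDl s0.
    rewrite -EFinB addrAC subrr add0r -EFinM lte_fin.
    apply: mulr_gt0 => //; apply: mulr_gt0 => //; apply: powR_gt0.
    by rewrite addr_gt0// (lt_le_trans ltr01).
  apply: ge0_le_integral => //.
  - by move=> t _; rewrite lee_fin mulr_ge0 ?powR_ge0// ltW.
  - exact: measurable_funTS.
  - move=> t /=; rewrite in_itv/= => /andP[at_ tas].
    have t1 : (1 <= t)%R by rewrite (le_trans a1)// ltW.
    have t0 := lt_le_trans ltr01 t1.
    rewrite /psi /p t1 /power_weight t0 -[leLHS]add0e leeD// -EFinM lee_fin.
    rewrite ler_pM2l//; apply: ge_powR_base => //.
have mbad f : measurable_fun setT f -> (forall t, 0 <= f t) -> measurable_fun setT (fun z : R * R =>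
    (1 <= z.1)%R && ((z.2 `^ b)%:E < mass f z.1 z.2)).
  move=> mf f0; apply: measurable_and; first exact: measurable_fun_ler.
  exact: measurable_bad.
have mbad1 f s : measurable_fun setT f -> (forall t, 0 <= f t) ->
    measurable [set a | (1 <= a)%R && ((s `^ b)%:E < mass f a s)].
  move=> mf f0; apply: measurable_set_bool.
  have mg : measurable_fun setT (fun a : R => (a, s)) by exact: measurable_fun_pair.
  exact: (measurableT_comp (mbad _ mf f0) mg).
apply: ge0_le_integral => //.
- by move=> s _; rewrite mule_ge0// lee_fin power_weight_ge0.
- apply: emeasurable_funM; first exact: emeasurable_power_weight.
  exact: (measurable_fun_section lambda (mbad _ mphi phi0)).
- apply: emeasurable_funM; first exact: emeasurable_power_weight.
  exact: (measurable_fun_section lambda (mbad _ mpsi psi0)).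
- move=> s _; apply: lee_wpmul2l; first by rewrite lee_fin power_weight_ge0.
  apply: le_measure; rewrite ?inE; [exact: mbad1|exact: mbad1|].
  move=> a/= /andP[-> abad]; rewrite (lt_le_trans abad)//.
  by apply: le_mass_fun => // t; rewrite /psi leeDl.
Qed.

End maximal_estimate_neg.

(** * Affine changes of variable on the line *)

Section lebesgue_measure_affine.
Context (R : realType).
Local Notation lambda := (@lebesgue_measure R).

Lemma measurable_affine1 (c a : R) :
  measurable_fun setT (fun t : R => a + c * t)%R.
Proof. by apply: measurable_funD => //; exact: measurable_funM. Qed.

Lemma lebesgue_measure_affine (c a : R) (A : set R) : (0 < c)%R -> measurable A ->
  lambda A = c%:E * lambda ((fun t : R => a + c * t)%R @^-1` A).
Proof.
move=> c0 mA.
have := @lebesgue_measure_unique R (mscale (NngNum (ltW c0))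
  (pushforward lambda ((fun t => a + c * t)%R : R -> measurableTypeR R))).
move=> -> //; first exact: measurable_affine1.
move=> mf _ [[u v]] _ <-; change (lambda `]u, v] = c%:E * lambda ((fun t : R => a + c * t)%R @^-1` `]u, v])).
rewrite (_ : _ @^-1` _ = `](c^-1 * (u - a))%R, (c^-1 * (v - a))%R]%classic); last first.
  apply/seteqP; split=> x/=; rewrite !in_itv/= ![(c^-1 * _)%R]mulrC ltr_pdivrMr//;
    by rewrite ler_pdivlMr// ltrBlDl lerBrDl (mulrC c).
rewrite !lebesgue_measure_itv/= !lte_fin ltr_pM2l ?invr_gt0// ltrD2r.
case: ifPn => _; last by rewrite mule0.
rewrite -!EFinB -EFinM; congr EFin.
by rewrite -mulrBr mulrA mulfV ?gt_eqF// mul1r opprB addrA subrK.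
Qed.

Lemma ge0_integral_affine1 (c a : R) (D : set R) (f : R -> \bar R) : (0 < c)%R ->
  measurable D -> measurable_fun setT f -> (forall t, 0 <= f t) ->
  \int[lambda]_(t in D) f t =
  c%:E * \int[lambda]_(t in (fun t => a + c * t)%R @^-1` D) f (a + c * t)%R.
Proof.
move=> c0 mD mf f0; have maff := measurable_affine1 c a.
rewrite (eq_measure_integral (mscale (NngNum (ltW c0))
  (pushforward lambda ((fun t => a + c * t)%R : R -> measurableTypeR R))))//=.
  rewrite ge0_integral_mscale//=; last exact: measurable_funTS.
  rewrite ge0_integral_pushforward//; exact: measurable_funTS.
by move=> A mA _; exact: lebesgue_measure_affine.
Qed.

Lemma mass_affine (phi : R -> \bar R) (c a r : R) : (0 < c)%R ->
  measurable_fun setT phi -> (forall t, 0 <= phi t) ->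
  mass phi a (c * r) = c%:E * mass (fun t => phi (a + c * t)%R) 0 r.
Proof.
move=> c0 mphi phi0; rewrite /mass (ge0_integral_affine1 a c0)//.
congr (_ * integral _ _ _); apply/seteqP; split=> x/=; rewrite !in_itv/= add0r;
  by rewrite ltrDl lerD2l ler_pM2l// pmulr_rgt0.
Qed.

End lebesgue_measure_affine.

Lemma integral_bool d (T : measurableType d) (R : realType) (m : {measure set T -> \bar R}) (b : T -> bool) :
  measurable_fun setT b -> \int[m]_x (b x)%:R%:E = m [set x | b x].
Proof.
move=> mb; have mB := measurable_set_bool mb.
have := @integral_indic _ _ _ m setT measurableT _ mB; rewrite setIT => <-.
by apply: eq_integral => x _; rewrite indicE mem_setE.
Qed.

Section fubini_sets.
Context d1 d2 (T1 : measurableType d1) (T2 : measurableType d2) (R : realType).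
Variables (m1 : {sigma_finite_measure set T1 -> \bar R})
  (m2 : {sigma_finite_measure set T2 -> \bar R}).

Lemma fubini_bool (b : T1 * T2 -> bool) : measurable_fun setT b ->
  \int[m1]_x m2 [set y | b (x, y)] = \int[m2]_y m1 [set x | b (x, y)].
Proof.
move=> mb.
have mb1 y : measurable_fun setT (fun x => b (x, y)).
  by apply: (measurableT_comp mb); exact: measurable_fun_pair.
have mb2 x : measurable_fun setT (fun y => b (x, y)).
  by apply: (measurableT_comp mb); exact: measurable_fun_pair.
rewrite (eq_integral (fun x => \int[m2]_y (b (x, y))%:R%:E)); last first.
  by move=> x _; rewrite integral_bool.
rewrite [RHS](eq_integral (fun y => \int[m1]_x (b (x, y))%:R%:E)); last first.
  by move=> y _; rewrite integral_bool.
have := @fubini_tonelli _ _ _ _ _ m1 m2 (fun z => (b z)%:R%:E); apply.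
  apply/measurable_EFinP.
  rewrite (_ : (fun z => _) = fun z => if b z then 1%R else 0%R); last first.
    by apply/funext => z; case: (b z).
  exact: measurable_fun_ifT.
by move=> z; rewrite lee_fin.
Qed.

End fubini_sets.

(** The interface between the line and R^N. The exponent is [g + 1] because masses are taken in arc
    length, whereas segments will carry averages. Restricting to [1 <= a] costs nothing: starts are
    later averaged over a window beginning at 1. *)
Definition one_dim_bound (R : realType) (g C : R) := forall phi : R -> \bar R,
  measurable_fun setT phi -> (forall t, 0 <= phi t) ->
  \int[lebesgue_measure]_s ((power_weight g s)%:E *
     lebesgue_measure [set a : R | (1 <= a)%R && ((s `^ (g + 1))%:E < mass phi a s)]) <=
  C%:E * \int[lebesgue_measure]_t phi t.

Lemma one_dim_bound_pos (R : realType) (g : R) : (0 < g)%R ->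
  one_dim_bound g (3 * 2 `^ g / g).
Proof.
move=> g0 phi mphi phi0; apply: le_trans (maximal_estimate_pos mphi phi0 g0).
have mbad := measurable_bad mphi phi0 (g + 1)%R.
have mbad1 : measurable_fun setT (fun z : R * R =>
    (1 <= z.1)%R && ((z.2 `^ (g + 1))%:E < mass phi z.1 z.2)).
  by apply: measurable_and => //; exact: measurable_fun_ler.
apply: ge0_le_integral => //.
- by move=> s _; rewrite mule_ge0// lee_fin power_weight_ge0.
- apply: emeasurable_funM; first exact: emeasurable_power_weight.
  exact: (measurable_fun_section lebesgue_measure mbad1).
- apply: emeasurable_funM; first exact: emeasurable_power_weight.
  exact: (measurable_fun_section lebesgue_measure mbad).
- move=> s _; apply: lee_wpmul2l; first by rewrite lee_fin power_weight_ge0.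
  have mg : measurable_fun setT (fun a : R => (a, s)) by exact: measurable_fun_pair.
  apply: le_measure; rewrite ?inE.
  + by apply: measurable_set_bool; exact: (measurableT_comp mbad1 mg).
  + exact: measurable_bad1.
  + by move=> a/= /andP[].
Qed.

Lemma one_dim_bound_neg (R : realType) (g : R) : (g < -1)%R ->
  one_dim_bound g (4 / - (g + 1)).
Proof.
move=> g1 phi mphi phi0; have b0 : (g + 1 < 0)%R by lra.
by have := maximal_estimate_neg mphi phi0 b0; rewrite addrK.
Qed.

(** * Lines, polar coordinates and segments *)

Section transference.
Context (R : realType) (N : nat).
Local Notation V := 'rV[R]_N.
Local Notation lambda := (@lebesgue_measure R).
Local Notation pw := (@power_weight R).
Variable mu : {sigma_finite_measure set V -> \bar R}.
Hypothesis mu_leb : is_lebesgue_borel mu.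
Variables g C : R.
Hypotheses (C_ge0 : (0 <= C)%R) (gC : one_dim_bound g C).
Variable f : V -> \bar R.
Hypotheses (mf : measurable_fun setT f) (f0 : forall x, 0 <= f x).

Lemma measurable_line : measurable_fun setT (fun w : (V * V) * R => w.1.1 + w.2 *: w.1.2)%R.
Proof.
apply/measurable_rVP => i; under eq_fun do rewrite !mxE.
have mfst : measurable_fun setT (fun w : (V * V) * R => w.1.1 ord0 i).
  apply: (measurableT_comp (measurable_coord i)).
  exact: (measurableT_comp measurable_fst measurable_fst).
have msnd : measurable_fun setT (fun w : (V * V) * R => w.1.2 ord0 i).
  apply: (measurableT_comp (measurable_coord i)).
  exact: (measurableT_comp measurable_snd measurable_fst).
by apply: measurable_funD => //; exact: measurable_funM.
Qed.

Section fixed_direction.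
Variable h : V.

Let phi (x : V) (t : R) : \bar R := f (x + t *: h)%R.

Let mphi : measurable_fun setT (fun z : V * R => phi z.1 z.2).
Proof.
apply: (measurableT_comp mf).
apply: (measurableT_comp measurable_line (g := fun z : V * R => ((z.1, h), z.2))).
by apply: measurable_fun_pair => //; exact: measurable_fun_pair.
Qed.

Let mphi1 x : measurable_fun setT (phi x).
Proof. by apply: (measurableT_comp mphi (g := fun t => (x, t))); exact: measurable_fun_pair. Qed.

Let bad (z : V * (R * R)) : bool := (z.2.2 `^ (g + 1))%:E < mass (phi z.1) z.2.1 z.2.2.

Let mbad : measurable_fun setT bad.
Proof.
apply: measurable_fun_lte; last exact: (measurable_fun_mass mphi (fun z => f0 _)).
apply/measurable_EFinP; apply: (measurableT_comp (measurable_powR _)).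
exact: (measurableT_comp measurable_snd measurable_snd).
Qed.

Let bad_shift x a s : bad (x, (a, s)) = bad ((x + a *: h)%R, (0%R, s)).
Proof.
rewrite /bad/=; congr (_ < _).
have := @mass_affine R (phi x) 1 a s ltr01 (mphi1 x) (fun t => f0 _).
rewrite mul1r mul1e => ->; congr mass; apply/funext => t.
by rewrite /phi mul1r scalerDl addrA.
Qed.

Let mbad_as a s : measurable_fun setT (fun x : V => bad (x, (a, s))).
Proof.
apply: (measurableT_comp mbad (g := fun x : V => (x, (a, s)))).
exact: measurable_fun_pair.
Qed.

Let W s := mu [set x | bad (x, (0%R, s))].

Let W_shift a s : mu [set x | bad (x, (a, s))] = W s.
Proof.
have mA : measurable [set x : V | bad (x, (0%R, s))].
  by apply: measurable_set_bool; exact: mbad_as.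
rewrite /W (lebesgue_affine mu_leb (a *: h)%R ltr01 mA) expr1n mul1e; congr (mu _).
by apply/funext => x /=; rewrite (bad_shift x a) scale1r [(a *: h + x)%R]addrC.
Qed.

Variable S : R.
Hypothesis S0 : (0 < S)%R.

Let bad1 (x : V) (a s : R) : bool := (1 <= a <= 1 + S)%R && bad (x, (a, s)).

Let mbad1 : measurable_fun setT (fun w : R * (V * R) => bad1 w.2.1 w.1 w.2.2).
Proof.
apply: measurable_and.
  by apply: measurable_and; exact: measurable_fun_ler.
apply: (measurableT_comp mbad (g := fun w : R * (V * R) => (w.2.1, (w.1, w.2.2)))).
apply: measurable_fun_pair; first exact: (measurableT_comp measurable_fst measurable_snd).
apply: measurable_fun_pair => //.
exact: (measurableT_comp measurable_snd measurable_snd).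
Qed.

(** By translation invariance the measure of the bad base points is the same for every start [a],
    hence equals its mean over a window of length [S]. *)
Let average s : S%:E * W s = \int[mu]_x lambda [set a | bad1 x a s].
Proof.
have mb : measurable_fun setT (fun z : V * R => bad1 z.1 z.2 s).
  apply: (measurableT_comp mbad1 (g := fun z : V * R => (z.2, (z.1, s)))).
  by apply: measurable_fun_pair => //; exact: measurable_fun_pair.
rewrite (fubini_bool mu lambda mb).
rewrite (_ : (fun a => _) = (fun a => W s) \_ `[1%R, (1 + S)%R]); last first.
  apply/funext => a; rewrite patchE /bad1.
  have [/set_mem/=|] := boolP (a \in `[1%R, (1 + S)%R]%classic).
    by rewrite in_itv/= => -> /=; exact: W_shift.
  rewrite notin_setE/= in_itv/= => /negP/negbTE ->/=.
  by rewrite -[RHS](@measure0 _ _ _ mu); congr (mu _); apply/seteqP; split.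
rewrite -integral_mkcond integral_cst//= lebesgue_measure_itv/= lte_fin ltrDl S0.
by rewrite -EFinB addrAC subrr add0r muleC.
Qed.

(** For starts up to [1 + S] and lengths up to [S] only this stretch of the line is seen; truncating
    to it makes the total mass over all lines proportional to [S]. *)
Let psi (x : V) (t : R) : \bar R := if (1 < t <= 1 + 2 * S)%R then phi x t else 0.

Let mpsi : measurable_fun setT (fun z : V * R => psi z.1 z.2).
Proof.
apply: measurable_fun_ifT => //; apply: measurable_and;
  [exact: measurable_fun_ltr|exact: measurable_fun_ler].
Qed.

Let psi0 x t : 0 <= psi x t. Proof. by rewrite /psi; case: ifP => // _; exact: f0. Qed.

Let mpsi1 x : measurable_fun setT (psi x).
Proof. by apply: (measurableT_comp mpsi (g := fun t => (x, t))); exact: measurable_fun_pair. Qed.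

Let bad1_psi x a s : (s <= S)%R -> bad1 x a s ->
  (1 <= a)%R && ((s `^ (g + 1))%:E < mass (psi x) a s).
Proof.
move=> sS /andP[/andP[a1 aS]]; rewrite a1 /bad/= => /lt_le_trans; apply.
rewrite le_eqVlt; apply/orP; left; apply/eqP.
apply: eq_integral => t /set_mem/=; rewrite in_itv/= => /andP[at_ tas].
rewrite /psi (_ : (1 < t <= 1 + 2 * S)%R)//; apply/andP; split; last by lra.
exact: le_lt_trans at_.
Qed.

Let integral_psi : \int[mu]_x \int[lambda]_t psi x t = (2 * S)%:E * \int[mu]_x f x.
Proof.
rewrite [LHS](_ : _ = \int[lambda]_t \int[mu]_x psi x t); last first.
  exact: (@fubini_tonelli _ _ _ _ _ mu lambda _ mpsi (fun z => psi0 _ _)).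
rewrite (_ : (fun t => _) = (fun=> \int[mu]_x f x) \_ `]1%R, (1 + 2 * S)%R]); last first.
  apply/funext => t; rewrite patchE /psi.
  have [/set_mem/=|] := boolP (t \in `]1%R, (1 + 2 * S)%R]%classic).
    by rewrite in_itv/= => ->; rewrite (ge0_integral_shift mu_leb).
  rewrite notin_setE/= in_itv/= => /negP/negbTE ->.
  by rewrite integral0.
have S2 : (0 < 2 * S)%R by rewrite mulr_gt0.
rewrite -integral_mkcond integral_cst//= lebesgue_measure_itv/= lte_fin ltrDl S2.
by rewrite -EFinB addrAC subrr add0r muleC.
Qed.

(** The averaging puts a factor [S] on the left, the truncated density a factor [2 * S] on the
    right; what remains does not depend on [S]. *)
Lemma transference_local :
  \int[lambda]_(s in `]-oo, S]) ((pw g s)%:E * W s) <= (2 * C)%:E * \int[mu]_x f x.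
Proof.
have mW : measurable_fun setT W.
  have mb : measurable_fun setT (fun z : V * R => bad (z.1, (0%R, z.2))).
    have mg : measurable_fun setT (fun z : V * R => (z.1, (0%R : R, z.2))).
      by apply: measurable_fun_pair => //; exact: measurable_fun_pair.
    exact: (measurableT_comp mbad mg).
  exact: (measurable_fun_section mu mb).
have W0 s : 0 <= W s by exact: measure_ge0.
have mpwW : measurable_fun setT (fun s => (pw g s)%:E * W s).
  by apply: emeasurable_funM; first exact: emeasurable_power_weight.
have pwW0 s : 0 <= (pw g s)%:E * W s by rewrite mule_ge0// lee_fin power_weight_ge0.
have Sfin : S%:E \is a fin_num by [].
have S0' : 0 < S%:E by rewrite lte_fin.
rewrite -(lee_pmul2l Sfin S0').
rewrite -ge0_integralZl//; last 2 first.
- exact: measurable_funTS.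
- exact: ltW.
pose k s := (if (s <= S)%R then pw g s else 0)%R.
have mk : measurable_fun setT k.
  apply: measurable_fun_ifT => //; first exact: measurable_fun_ler.
  exact: measurable_power_weight.
have k0 s : (0 <= k s)%R by rewrite /k; case: ifP => // _; exact: power_weight_ge0.
rewrite (_ : \int[lambda]_(s in _) _ =
    \int[lambda]_s \int[mu]_x ((k s)%:E * lambda [set a | bad1 x a s])); last first.
  rewrite integral_mkcond; apply: eq_integral => s _; rewrite patchE.
  have m1 : measurable_fun setT (fun x => lambda [set a | bad1 x a s]).
    apply: (measurableT_comp (measurable_fun_section lambda mbad1)
      (g := fun x : V => (x, s))).
    exact: measurable_fun_pair.
  rewrite ge0_integralZl// ?lee_fin// -average /k.
  have [/set_mem/=|] := boolP (s \in `]-oo, S]%classic).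
    by rewrite in_itv/= => ->; rewrite muleCA.
  by rewrite notin_setE/= in_itv/= => /negP/negbTE ->; rewrite mul0e.
have mtot : measurable_fun setT (fun z : R * V => (k z.1)%:E * lambda [set a | bad1 z.2 a z.1]).
  apply: emeasurable_funM; first by apply/measurable_EFinP; exact: measurableT_comp.
  apply: (measurableT_comp (measurable_fun_section lambda mbad1)
    (g := fun z : R * V => (z.2, z.1))).
  exact: measurable_fun_pair.
rewrite [leLHS](_ : _ =
    \int[mu]_x \int[lambda]_s ((k s)%:E * lambda [set a | bad1 x a s])); last first.
  apply: (@fubini_tonelli _ _ _ _ _ lambda mu _ mtot) => z.
  by rewrite mule_ge0// lee_fin.
apply: (@le_trans _ _ (\int[mu]_x (C%:E * \int[lambda]_t psi x t))).
  apply: ge0_le_integral => //.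
  - by move=> x _; apply: integral_ge0 => s _; rewrite mule_ge0// lee_fin.
  - have tot0 z : 0 <= (k z.1)%:E * lambda [set a | bad1 z.2 a z.1].
      by rewrite mule_ge0// lee_fin.
    exact: (@measurable_fun_fubini_tonelli_G _ _ _ _ _ lambda _ mtot tot0).
  - apply: measurable_funeM.
    exact: (@measurable_fun_fubini_tonelli_F _ _ _ _ _ lambda _ mpsi (fun z => psi0 _ _)).
  - move=> x _; apply: le_trans (gC (mpsi1 x) (psi0 x)).
    have mpb := measurable_bad (mpsi1 x) (psi0 x) (g + 1)%R.
    have mpb1 : measurable_fun setT (fun z : R * R =>
        (1 <= z.1)%R && ((z.2 `^ (g + 1))%:E < mass (psi x) z.1 z.2)).
      by apply: measurable_and => //; exact: measurable_fun_ler.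
    apply: ge0_le_integral => //.
    + by move=> s _; rewrite mule_ge0// lee_fin.
    + apply: (measurableT_comp mtot (g := fun s : R => (s, x))).
      exact: measurable_fun_pair.
    + apply: emeasurable_funM; first exact: emeasurable_power_weight.
      exact: (measurable_fun_section lambda mpb1).
    + move=> s _; rewrite /k; have [sS|sS] := leP s S; last first.
        by rewrite mul0e mule_ge0// lee_fin power_weight_ge0.
      apply: lee_wpmul2l; first by rewrite lee_fin power_weight_ge0.
      have mg : measurable_fun setT (fun a : R => (a, s)) by exact: measurable_fun_pair.
      apply: le_measure; rewrite ?inE.
      * apply: measurable_set_bool.
        apply: (measurableT_comp mbad1 (g := fun a : R => (a, (x, s)))).
        exact: measurable_fun_pair.
      * by apply: measurable_set_bool; exact: (measurableT_comp mpb1 mg).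
      * by move=> a/=; exact: bad1_psi.
rewrite ge0_integralZl// ?lee_fin//; last 2 first.
- exact: (@measurable_fun_fubini_tonelli_F _ _ _ _ _ lambda _ mpsi (fun z => psi0 _ _)).
- by move=> x _; exact: integral_ge0.
rewrite integral_psi !muleA -!EFinM.
by rewrite (_ : (C * (2 * S) = S * (2 * C))%R)//; ring.
Qed.

End fixed_direction.

Lemma measurable_transference (h : V) : measurable_fun setT (fun s =>
  mu [set x | (s `^ (g + 1))%:E < mass (fun t => f (x + t *: h)%R) 0 s]).
Proof.
pose b (z : V * R) := (z.2 `^ (g + 1))%:E < mass (fun t => f (z.1 + t *: h)%R) 0 z.2.
have mb : measurable_fun setT b.
  apply: measurable_fun_lte.
    apply/measurable_EFinP; apply: (measurableT_comp (measurable_powR _)).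
    exact: measurable_snd.
  have mphi : measurable_fun setT (fun z : V * R => f (z.1 + z.2 *: h)%R).
    apply: (measurableT_comp mf).
    apply: (measurableT_comp measurable_line (g := fun z : V * R => ((z.1, h), z.2))).
    by apply: measurable_fun_pair => //; exact: measurable_fun_pair.
  have mg : measurable_fun setT (fun z : V * R => (z.1, (0%R : R, z.2))).
    by apply: measurable_fun_pair => //; exact: measurable_fun_pair.
  exact: (measurableT_comp (measurable_fun_mass mphi (fun z => f0 _)) mg).
exact: (measurable_fun_section mu mb).
Qed.

(** The local bounds are uniform in the cut-off, which is removed by monotone convergence. *)
Lemma transference (h : V) :
  \int[lambda]_s ((pw g s)%:E *
    mu [set x | (s `^ (g + 1))%:E < mass (fun t => f (x + t *: h)%R) 0 s]) <=
  (2 * C)%:E * \int[mu]_x f x.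
Proof.
have -> : [set: measurableTypeR R] = \bigcup_n [set` `]-oo, (n.+1%:R : R)]].
  apply/seteqP; split=> // s _; exists (Num.truncn s) => //=.
  by rewrite in_itv/= ltW// truncnS_gt.
apply: ge0_integral_bigcup_nondecreasing_le => //.
- move=> m n mn; apply/subsetPset => x /=; rewrite !in_itv/= => xm.
  by rewrite (le_trans xm)// ler_nat.
- apply: emeasurable_funM; first exact: emeasurable_power_weight.
  exact: measurable_transference.
- by move=> s; rewrite mule_ge0// lee_fin power_weight_ge0.
- by move=> n; exact: transference_local.
Qed.

End transference.

(** * Euclidean norm, polar coordinates, radial bound *)

Section enorm_theory.
Context (R : realType) (N : nat).
Implicit Types h : 'rV[R]_N.
Local Open Scope ring_scope.

Lemma enorm_ge0 h : 0 <= enorm h. Proof. exact: sqrtr_ge0. Qed.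

Lemma enorm_sum_ge0 h : 0 <= \sum_i h ord0 i ^+ 2.
Proof. by apply: sumr_ge0 => i _; exact: sqr_ge0. Qed.

Lemma le_enorm h i : `|h ord0 i| <= enorm h.
Proof.
rewrite -sqrtr_sqr ler_sqrt ?enorm_sum_ge0// (bigD1 i)//= lerDl.
by apply: sumr_ge0 => j _; exact: sqr_ge0.
Qed.

Lemma enorm_gt0 h : (0 < enorm h) = (h != 0).
Proof.
rewrite lt_neqAle enorm_ge0 andbT eq_sym; congr (~~ _).
apply/eqP/eqP => [h0|->]; last first.
  by rewrite /enorm big1 ?sqrtr0// => i _; rewrite mxE expr0n.
apply/rowP => i; rewrite mxE; apply/eqP; rewrite -normr_le0 -h0.
exact: le_enorm.
Qed.

Lemma enormZ (s : R) h : 0 <= s -> enorm (s *: h) = s * enorm h.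
Proof.
move=> s0; rewrite /enorm (eq_bigr (fun i => s ^+ 2 * h ord0 i ^+ 2)) => [|i _].
  by rewrite -mulr_sumr sqrtrM ?sqr_ge0// sqrtr_sqr ger0_norm.
by rewrite mxE exprMn.
Qed.

Lemma measurable_enorm : measurable_fun setT (@enorm R N).
Proof.
apply: (@measurableT_comp _ _ _ _ _ _ (@Num.sqrt R)).
  by apply: continuous_measurable_fun; exact: sqrt_continuous.
apply: measurable_sum => i; apply: measurable_funX.
exact: measurable_coord.
Qed.

Lemma measurable_enorm_row d (X : measurableType d) (D : 'I_N -> X -> R) :
  (forall i, measurable_fun setT (D i)) ->
  measurable_fun setT (fun x => enorm (\row_i D i x)).
Proof.
move=> mD; apply: (measurableT_comp measurable_enorm).
apply/measurable_rVP => i; rewrite (_ : (fun x => _) = D i)//.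
by apply/funext => y; rewrite mxE.
Qed.

Lemma enorm_ball_cube : [set h : 'rV[R]_N | enorm h < 1] `<=` cube N 1.
Proof.
move=> h /= h1; apply/cubeP => i.
have := le_lt_trans (le_enorm h i) h1.
by rewrite ltr_norml => /andP[-> /ltW].
Qed.

End enorm_theory.

Section polar.
Context (R : realType) (N : nat).
Local Notation V := 'rV[R]_N.
Local Notation lambda := (@lebesgue_measure R).
Local Notation pw := (@power_weight R).
Variable mu : {sigma_finite_measure set V -> \bar R}.
Hypotheses (mu_leb : is_lebesgue_borel mu) (N_gt0 : (0 < N)%N).

Let NR_gt0 : (0 < N%:R :> R)%R. Proof. by rewrite ltr0n. Qed.

Lemma measurable_ball : measurable [set h : V | (enorm h < 1)%R].
Proof.
by apply: measurable_set_bool; apply: measurable_fun_ltr => //; exact: measurable_enorm.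
Qed.

Lemma ball_fin_num : mu [set h : V | (enorm h < 1)%R] \is a fin_num.
Proof.
rewrite ge0_fin_numE//; apply: (le_lt_trans _ (lebesgue_cube_lty mu_leb 1)).
apply: le_measure; rewrite ?inE; [exact: measurable_ball|exact: measurable_rbox|].
exact: enorm_ball_cube.
Qed.

Lemma sphere_areaE :
  (sphere_area mu)%:E = N%:R%:E * mu [set h : V | (enorm h < 1)%R].
Proof. by rewrite /sphere_area EFinM fineK// ball_fin_num. Qed.

(* Polar coordinates without a sphere: for [h != 0],
   [|h|^-N = N * \int_(|h|)^oo s^(-N-1) ds], and then one dilates by [s]. *)
Lemma polar (G : V -> \bar R) : measurable_fun setT G -> (forall h, 0 <= G h) ->
  G 0%R = 0 ->
  \int[mu]_h ((enorm h `^ - N%:R)%:E * G h) =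
  N%:R%:E * \int[mu]_(h in [set h | (enorm h < 1)%R])
    \int[lambda]_s ((pw 0 s)%:E * G (s *: h)%R).
Proof.
move=> mG G0 G00.
have menorm1 : measurable_fun setT (fun z : V * R => enorm z.1).
  exact: (measurableT_comp (@measurable_enorm R N) measurable_fst).
pose K (z : V * R) : \bar R :=
  if (enorm z.1 < z.2)%R then (pw (- N%:R) z.2)%:E * G z.1 else 0.
have mK : measurable_fun setT K.
  apply: measurable_fun_ifT => //.
    exact: measurable_fun_ltr.
  apply: emeasurable_funM.
    exact: (measurableT_comp (emeasurable_power_weight _) measurable_snd).
  exact: (measurableT_comp mG measurable_fst).
have K0 z : 0 <= K z.
  by rewrite /K; case: ifP => // _; rewrite mule_ge0// lee_fin power_weight_ge0.
have step1 h : (enorm h `^ - N%:R)%:E * G h = N%:R%:E * \int[lambda]_s K (h, s).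
  have [->|h0] := eqVneq h 0%R.
    rewrite G00 mule0 integral0_eq ?mule0// => s _.
    by rewrite /K/= G00 mule0; case: ifP.
  have e0 : (0 < enorm h)%R by rewrite enorm_gt0.
  rewrite (_ : (fun s => _) = (fun s => G h * (pw (- N%:R) s)%:E) \_ `]enorm h, +oo[); last first.
    apply/funext => s; rewrite patchE /K/=.
    have [/set_mem/=|] := boolP (s \in `]enorm h, +oo[%classic).
      by rewrite in_itv/= andbT => ->; rewrite muleC.
    by rewrite notin_setE/= in_itv/= andbT => /negP/negbTE ->.
  rewrite -integral_mkcond ge0_integralZl//; last 2 first.
  - by apply: measurable_funTS; exact: emeasurable_power_weight.
  - by move=> s _; rewrite lee_fin power_weight_ge0.
  rewrite integral_itv_obnd_cbnd; last first.
    by apply: measurable_funTS; exact: emeasurable_power_weight.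
  rewrite integral_power_weight_ge// ?oppr_lt0// opprK muleCA -EFinM muleC.
  by congr (_ * _%:E); rewrite mulrC divfK// gt_eqF.
under eq_integral do rewrite step1.
have mI := @measurable_fun_fubini_tonelli_F _ _ _ _ _ lambda _ mK K0.
have I0 h : setT h -> 0 <= \int[lambda]_s K (h, s).
  by move=> _; apply: integral_ge0 => s _; exact: K0.
have NR0 : 0 <= N%:R%:E :> \bar R by rewrite lee_fin ler0n.
rewrite (ge0_integralZl _ measurableT mI I0 NR0); congr (_ * _).
rewrite (@fubini_tonelli _ _ _ _ _ mu lambda K mK K0).
pose K' (z : V * R) : \bar R :=
  if (enorm z.1 < 1)%R then (pw 0 z.2)%:E * G (z.2 *: z.1)%R else 0.
have mZ : measurable_fun setT (fun z : V * R => z.2 *: z.1)%R.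
  apply/measurable_rVP => i; under eq_fun do rewrite !mxE.
  apply: measurable_funM => //.
  exact: (measurableT_comp (measurable_coord i) measurable_fst).
have mK' : measurable_fun setT K'.
  apply: measurable_fun_ifT => //.
    exact: measurable_fun_ltr.
  apply: emeasurable_funM.
    exact: (measurableT_comp (emeasurable_power_weight _) measurable_snd).
  exact: (measurableT_comp mG mZ).
have K'0 z : 0 <= K' z.
  by rewrite /K'; case: ifP => // _; rewrite mule_ge0// lee_fin power_weight_ge0.
transitivity (\int[lambda]_s \int[mu]_h K' (h, s)); last first.
  rewrite -(@fubini_tonelli _ _ _ _ _ mu lambda K' mK' K'0) integral_mkif.
  apply: eq_integral => h _; rewrite /K'/=.
  by case: ifP => // _; rewrite integral0.
apply: eq_integral => s _.
have [s0|s0] := leP s 0%R.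
  have pw0 g : pw g s = 0%R by rewrite /power_weight ltNge s0.
  by rewrite !integral0_eq// => h _; rewrite /K /K'/= pw0 mul0e; case: ifP.
have mKs : measurable_fun setT (fun h => K (h, s)).
  by apply: (measurableT_comp mK (g := fun h => (h, s))); exact: measurable_fun_pair.
have mK's : measurable_fun setT (fun h => K' (h, s)).
  by apply: (measurableT_comp mK' (g := fun h => (h, s))); exact: measurable_fun_pair.
(* Dilation by [s] maps the unit ball to the ball of radius [s], and its Jacobian turns [s^(-N-1)]
   into [s^-1 = pw 0 s]. *)
rewrite (ge0_integral_affine mu_leb 0%R s0 mKs)// -ge0_integralZl//; last 2 first.
- apply: (measurableT_comp mKs); exact: measurable_affine.
- by rewrite lee_fin exprn_ge0// ltW.
apply: eq_integral => h _; rewrite /K /K'/= add0r enormZ ?(ltW s0)//.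
rewrite gtr_pMr//; case: ifP => _; last by rewrite mule0.
rewrite muleA -EFinM /power_weight s0 -powR_mulrn ?(ltW s0)//.
rewrite -powRD ?(gt_eqF s0) ?implybT//.
by congr ((_ `^ _)%:E * _); rewrite addrA subrr.
Qed.

End polar.

Section radial_estimate.
Context (R : realType) (N : nat).
Local Notation V := 'rV[R]_N.
Local Notation lambda := (@lebesgue_measure R).
Local Notation pw := (@power_weight R).
Variable mu : {sigma_finite_measure set V -> \bar R}.
Hypotheses (mu_leb : is_lebesgue_borel mu) (N_gt0 : (0 < N)%N).
Variables g C : R.
Hypotheses (C_ge0 : (0 <= C)%R) (gC : one_dim_bound g C).
Variable f : V -> \bar R.
Hypotheses (mf : measurable_fun setT f) (f0 : forall x, 0 <= f x).

Definition segment_mass (x h : V) : \bar R := mass (fun t => f (x + t *: h)%R) 0 1.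

Lemma measurable_segment_mass :
  measurable_fun setT (fun z : V * V => segment_mass z.1 z.2).
Proof.
have mphi : measurable_fun setT (fun w : (V * V) * R => f (w.1.1 + w.2 *: w.1.2)%R).
  exact: (measurableT_comp mf (@measurable_line R N)).
have mg : measurable_fun setT (fun z : V * V => (z, (0%R : R, 1%R : R))).
  exact: measurable_fun_pair.
exact: (measurableT_comp (measurable_fun_mass mphi (fun z => f0 _)) mg).
Qed.

(** The guard [h != 0] makes the radial integrand vanish at the origin, as the polar formula
    asks. *)
Definition bad_segment (x h : V) : bool :=
  (h != 0%R) && ((enorm h `^ g)%:E < segment_mass x h).

Lemma measurable_bad_segment :
  measurable_fun setT (fun z : V * V => bad_segment z.1 z.2).
Proof.
have me : measurable_fun setT (fun z : V * V => enorm z.2).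
  exact: (measurableT_comp (@measurable_enorm R N) measurable_snd).
apply: measurable_and.
  apply: (eq_measurable_fun (fun z : V * V => 0 < enorm z.2)%R).
    by move=> z _; rewrite enorm_gt0.
  exact: measurable_fun_ltr.
apply: measurable_fun_lte; last exact: measurable_segment_mass.
by apply/measurable_EFinP; apply: (measurableT_comp (measurable_powR _)).
Qed.

(** The segment mass for [s *: h] is [s^-1] times the mass over a parameter interval of length [s].
    Hence the condition at [s *: h] is the one-dimensional one for the density [|h|^-g * f], and the
    factor [|h|^g] left in the weight compensates this rescaling. *)
Let ray_estimate (h : V) : h != 0%R ->
  \int[lambda]_s ((pw 0 s)%:E * ((enorm (s *: h) `^ g)%:E *
    mu [set x | bad_segment x (s *: h)%R])) <= (2 * C)%:E * \int[mu]_x f x.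
Proof.
move=> h0; have e0 : (0 < enorm h)%R by rewrite enorm_gt0.
pose f' x := (enorm h `^ - g)%:E * f x.
have eg0 a : (0 < enorm h `^ a)%R by exact: powR_gt0.
have mf' : measurable_fun setT f' by exact: measurable_funeM.
have f'0 x : 0 <= f' x by rewrite mule_ge0// lee_fin ltW.
have key (s : R) (x : V) : (0 < s)%R ->
    bad_segment x (s *: h)%R = ((s `^ (g + 1))%:E < mass (fun t => f' (x + t *: h)%R) 0 s).
  move=> s0; rewrite /bad_segment.
  have mphi : measurable_fun setT (fun t : R => f (x + t *: h)%R).
    apply: (measurableT_comp mf); apply/measurable_rVP => i.
    by under eq_fun do rewrite !mxE; apply: measurable_funD => //; exact: measurable_funM.
  have := mass_affine 0 1 s0 mphi (fun t => f0 _); rewrite mulr1.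
  have -> : mass (fun t => f (x + (0 + s * t) *: h)%R) 0 1 = segment_mass x (s *: h)%R.
    by congr mass; apply/funext => t; rewrite add0r scalerA mulrC.
  move=> massE.
  have -> : mass (fun t => f' (x + t *: h)%R) 0 s =
      (enorm h `^ - g)%:E * mass (fun t => f (x + t *: h)%R) 0 s.
    rewrite /mass ge0_integralZl//; first exact: measurable_funTS.
    by rewrite lee_fin ltW.
  rewrite scaler_eq0 negb_or (gt_eqF s0) h0/= massE enormZ ?(ltW s0)// powRM ?(ltW e0) ?(ltW s0)//.
  have c0 : (0 < (enorm h `^ (- g)) * s)%R by rewrite mulr_gt0.
  have ce0 : 0 < ((enorm h `^ (- g)) * s)%:E by rewrite lte_fin.
  rewrite [in RHS]muleA -EFinM -[LHS](lte_pmul2l _ ce0)// -EFinM; congr (_%:E < _).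
  rewrite powRD ?(gt_eqF s0) ?implybT// powRr1 ?(ltW s0)// powRN.
  by field; rewrite gt_eqF.
have -> : \int[mu]_x f x = (enorm h `^ g)%:E * \int[mu]_x f' x.
  rewrite ge0_integralZl ?lee_fin ?(ltW (eg0 _))// muleA -EFinM -powRD ?subrr ?powRr0 ?mul1e//.
  by rewrite (gt_eqF e0) implybT.
rewrite muleCA; apply: le_trans (lee_wpmul2l _ (transference mu_leb C_ge0 gC mf' f'0 h)); last first.
  by rewrite lee_fin ltW.
rewrite -ge0_integralZl ?lee_fin ?(ltW (eg0 _))//; last 2 first.
- apply: emeasurable_funM; first exact: emeasurable_power_weight.
  exact: measurable_transference.
- by move=> s _; rewrite mule_ge0// lee_fin power_weight_ge0.
rewrite le_eqVlt; apply/orP; left; apply/eqP; apply: eq_integral => s _.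
have [s0|s0] := leP s 0%R.
  have pw0 a : pw a s = 0%R by rewrite /power_weight ltNge s0.
  by rewrite !pw0 !mul0e mule0.
have s0' := ltW s0.
rewrite enormZ// powRM ?(ltW e0)// EFinM !muleA -!EFinM.
rewrite (_ : (pw 0 s * s `^ g * enorm h `^ g = enorm h `^ g * pw g s)%R); last first.
  rewrite mulrC /power_weight s0 -powRD ?(gt_eqF s0) ?implybT//.
  by congr (_ * _ `^ _)%R; rewrite sub0r addrC.
congr (_ * mu _); apply/funext => x /=.
by rewrite key.
Qed.

(** The bound along a ray does not depend on [h]; integrated over the unit ball and multiplied by
    [N] it produces the sphere area. *)
Lemma radial_estimate :
  \int[mu]_h ((enorm h `^ (g - N%:R))%:E * mu [set x | bad_segment x h]) <=
  (sphere_area mu * (2 * C))%:E * \int[mu]_x f x.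
Proof.
pose G h := (enorm h `^ g)%:E * mu [set x | bad_segment x h].
have mbs : measurable_fun setT (fun h => mu [set x | bad_segment x h]).
  exact: (measurable_fun_section mu measurable_bad_segment).
have mG : measurable_fun setT G.
  apply: emeasurable_funM => //; apply/measurable_EFinP.
  exact: (measurableT_comp (measurable_powR _) (@measurable_enorm R N)).
have G0 h : 0 <= G h by rewrite mule_ge0// lee_fin powR_ge0.
have bad0 : mu [set x | bad_segment x 0%R] = 0.
  rewrite -[RHS](@measure0 _ _ _ mu); congr (mu _); apply/seteqP; split=> // x.
  by rewrite /= /bad_segment eqxx.
have G00 : G 0%R = 0 by rewrite /G bad0 mule0.
rewrite (eq_integral (fun h => (enorm h `^ - N%:R)%:E * G h)); last first.
  move=> h _; rewrite /G muleA -EFinM.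
  have [->|h0] := eqVneq h 0%R; first by rewrite bad0 !mule0.
  have e0 : (0 < enorm h)%R by rewrite enorm_gt0.
  by rewrite -powRD ?(gt_eqF e0) ?implybT// addrC.
rewrite (polar mu_leb N_gt0 mG G0 G00) EFinM (sphere_areaE mu_leb) -!muleA.
apply: lee_wpmul2l; first by rewrite lee_fin ler0n.
apply: (@le_trans _ _ (\int[mu]_(h in [set h | (enorm h < 1)%R])
    ((2 * C)%:E * \int[mu]_x f x))).
  apply: ge0_le_integral => //.
  - exact: measurable_ball.
  - by move=> h _; apply: integral_ge0 => s _; rewrite mule_ge0// lee_fin power_weight_ge0.
  - apply: measurable_funTS.
    have mZ : measurable_fun setT (fun z : V * R => z.2 *: z.1)%R.
      apply/measurable_rVP => i; under eq_fun do rewrite !mxE.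
      apply: measurable_funM => //.
      exact: (measurableT_comp (measurable_coord i) measurable_fst).
    have mK : measurable_fun setT (fun z : V * R => (pw 0 z.2)%:E * G (z.2 *: z.1)%R).
      apply: emeasurable_funM.
        exact: (measurableT_comp (emeasurable_power_weight _) measurable_snd).
      exact: (measurableT_comp mG mZ).
    have K0 (z : V * R) : 0 <= (pw 0 z.2)%:E * G (z.2 *: z.1)%R.
      by rewrite mule_ge0// lee_fin power_weight_ge0.
    exact: (@measurable_fun_fubini_tonelli_F _ _ _ _ _ lambda _ mK K0).
  - move=> h _; have [->|h0] := eqVneq h 0%R; last exact: ray_estimate.
    rewrite integral0_eq; last by move=> s _; rewrite scaler0 G00 mule0.
    by rewrite mule_ge0 ?integral_ge0// lee_fin mulr_ge0.
rewrite (@integral_cst _ _ _ mu _ (@measurable_ball R N)); by rewrite [leRHS]muleC.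
Qed.

End radial_estimate.

(** * Smooth mollifiers *)

Section flat_functions.
Context (R : realType).
Local Open Scope ring_scope.
Implicit Types t w : R.

(* [flat k t = t^-k * exp(-1/t)] for [t > 0]; these functions are closed under
   differentiation up to linear combinations. *)
Definition flat (k : nat) t : R := if 0 < t then t^-1 ^+ k * expR (- t^-1) else 0.

Lemma flat_ge0 k t : 0 <= flat k t.
Proof.
rewrite /flat; case: ifP => // t0.
by rewrite mulr_ge0 ?expR_ge0// exprn_ge0// invr_ge0 ltW.
Qed.

Lemma exprn_expR_le k w : 0 <= w -> w ^+ k * expR (- w) <= k`!%:R.
Proof.
move=> w0; rewrite expRN ler_pdivrMr ?expR_gt0//.
case: k => [|k]; first by rewrite expr0 fact0 mul1r -expR0 ler_expR.
rewrite -ler_pdivrMl ?ltr0n ?fact_gt0// mulrC.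
by apply: le_trans (expR_ge1Dxn k w0); rewrite lerDr.
Qed.

Lemma flat_le k t : flat k t <= k`!%:R.
Proof.
by rewrite /flat; case: ifP => // t0; apply: exprn_expR_le; rewrite invr_ge0 ltW.
Qed.

(** Second order vanishing at 0 on the right gives derivative 0 there, for every [k] at once. *)
Lemma flat_quadratic k t : flat k t <= k.+2`!%:R * t ^+ 2.
Proof.
rewrite /flat; case: ifP => [t0|_]; last by rewrite mulr_ge0// sqr_ge0.
rewrite -ler_pdivrMr ?exprn_gt0// mulrAC -exprVn -exprD addn2.
by apply: exprn_expR_le; rewrite invr_ge0 ltW.
Qed.

Lemma is_derive_flat k t :
  is_derive t 1 (flat k) (flat k.+2 t - k%:R * flat k.+1 t).
Proof.
have [t0|t0|->] := ltgtP t 0.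
- have -> : flat k.+2 t - k%:R * flat k.+1 t = 0.
    by rewrite /flat !ltNge (ltW t0)/= mulr0 subr0.
  apply: (@near_eq_is_derive _ _ _ (cst 0)) => //.
  near=> s; rewrite /flat ltNge ltW//=.
  by near: s; exact: lt_nbhsl.
- apply: (@near_eq_is_derive _ _ _ (fun s : R => s^-1 ^+ k * expR (- s^-1))).
    near=> s; rewrite /flat ifT//.
    by near: s; exact: lt_nbhsr.
  have t0' : t != 0 by rewrite gt_eqF.
  have dV : is_derive t 1 (fun s : R => s^-1) (- t ^- 2 *: 1).
    exact: (@is_deriveV _ id).
  have dE : is_derive t 1 (expR \o (- (fun s : R => s^-1)))
      (expR (- t^-1) * - (- t ^- 2 *: 1)).
    exact: is_derive1_comp.
  rewrite (_ : (fun s => _) = (fun s : R => s^-1) ^+ k * (expR \o (- (fun s : R => s^-1)))).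
    apply: (is_derive_eq (is_deriveM (is_deriveX k dV) dE)).
    rewrite /flat t0 !fctE /GRing.scale/= mulr1 opprK -!exprVn.
    case: k => [|k]; first by rewrite !mul0r !expr0; ring.
    by rewrite /= !exprS; ring.
  by apply/funext => s; rewrite !fctE.
- have -> : flat k.+2 0 - k%:R * flat k.+1 0 = 0 :> R.
    by rewrite /flat ltxx mulr0 subr0.
  have : h^-1 *: (flat k (h *: 1 + 0) - flat k 0) @[h --> (0 : R)^'] --> (0 : R).
    apply/cvgrPdist_le => e e0; near=> h.
    have h0 : h != 0 by near: h; exact: nbhs_dnbhs_neq.
    have hb : `|h| <= e / k.+2`!%:R.
      near: h; apply: dnbhs0_le; rewrite divr_gt0// ltr0n fact_gt0.
    rewrite sub0r normrN addr0 /GRing.scale/= mulr1 [flat k 0]/flat ltxx subr0.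
    rewrite normrM normfV ler_pdivrMl ?normr_gt0// ger0_norm ?flat_ge0//.
    apply: (le_trans (flat_quadratic k h)).
    rewrite -real_normK ?num_real// expr2 mulrA mulrC ler_wpM2l//.
    by rewrite mulrC -ler_pdivlMr// ltr0n fact_gt0.
  move=> H; apply: DeriveDef; first by apply/cvg_ex; exists 0.
  exact/cvg_lim.
Unshelve. all: end_near. Qed.

Lemma continuous_flat k : continuous (flat k).
Proof.
move=> t; apply: differentiable_continuous; apply/derivable1_diffP.
by apply: ex_derive; exact: is_derive_flat.
Qed.


End flat_functions.

(** * An algebra of explicit smooth functions *)

Section smooth_algebra.
Context (R : realType) (N : nat).
Local Notation V := 'rV[R]_N.
Local Open Scope ring_scope.

(** A syntactic class closed under partial derivatives: boundedness, continuity, Borel measurability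
    and smoothness of all orders follow by structural induction. *)
Inductive smooth_alg : (V -> R) -> Prop :=
| smooth_flat k a b i : smooth_alg (fun x => flat k (a + b * x ord0 i))
| smooth_cst c : smooth_alg (fun=> c)
| smooth_add f g : smooth_alg f -> smooth_alg g -> smooth_alg (fun x => f x + g x)
| smooth_mul f g : smooth_alg f -> smooth_alg g -> smooth_alg (fun x => f x * g x).

Lemma smooth_prod (I : Type) (r : seq I) (F : I -> V -> R) :
  (forall i, smooth_alg (F i)) -> smooth_alg (fun x => \prod_(i <- r) F i x).
Proof.
move=> sF; elim: r => [|i r IH].
  under eq_fun do rewrite big_nil; exact: smooth_cst.
by under eq_fun do rewrite big_cons; exact: smooth_mul.
Qed.

Lemma smooth_sum (I : Type) (r : seq I) (F : I -> V -> R) :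
  (forall i, smooth_alg (F i)) -> smooth_alg (fun x => \sum_(i <- r) F i x).
Proof.
move=> sF; elim: r => [|i r IH].
  under eq_fun do rewrite big_nil; exact: smooth_cst.
by under eq_fun do rewrite big_cons; exact: smooth_add.
Qed.

Lemma smooth_bounded f : smooth_alg f -> exists M, forall x, `|f x| <= M.
Proof.
elim=> [k a b i|c|{}f g _ [M fM] _ [K gK]|{}f g _ [M fM] _ [K gK]].
- by exists k`!%:R => x; rewrite ger0_norm ?flat_ge0// flat_le.
- by exists `|c|.
- by exists (M + K) => x; rewrite (le_trans (ler_normD _ _))// lerD.
- by exists (M * K) => x; rewrite normrM ler_pM.
Qed.

Lemma smooth_continuous f : smooth_alg f -> continuous f.
Proof.
elim=> [k a b i|c|{}f g _ cf _ cg|{}f g _ cf _ cg] x.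
- apply: (@continuous_comp _ _ _ (fun y : V => a + b * y ord0 i) (flat k)); last exact: continuous_flat.
  apply: continuousD; first exact: cst_continuous.
  apply: continuousM; first exact: cst_continuous.
  exact: coord_continuous.
- exact: cst_continuous.
- by apply: continuousD; [exact: cf|exact: cg].
- by apply: continuousM; [exact: cf|exact: cg].
Qed.

Lemma smooth_measurable f : smooth_alg f -> measurable_fun setT f.
Proof.
elim=> [k a b i|c|{}f g _ mf _ mg|{}f g _ mf _ mg].
- apply: (measurableT_comp (f := flat k)).
    by apply: continuous_measurable_fun; exact: continuous_flat.
  apply: measurable_funD => //; apply: measurable_funM => //.
  exact: measurable_coord.
- exact: measurable_cst.
- exact: measurable_funD.
- exact: measurable_funM.
Qed.

Lemma is_derive_affine_coord (E : R -> R) (d a b : R) (i : 'I_N) (x v : V) :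
  is_derive (a + b * x ord0 i) 1 E d ->
  is_derive x v (fun y => E (a + b * y ord0 i)) (b * v ord0 i * d).
Proof.
set p := a + b * x ord0 i; set w := b * v ord0 i => -[dE <-].
have dEd : differentiable E p by exact/derivable1_diffP.
have quot : (fun h : R => h^-1 *: (((fun y : V => E (a + b * y ord0 i)) \o shift x) (h *: v)
      - E p)) = (fun h : R => h^-1 *: ((E \o shift p) (h *: w) - E p)).
  apply/funext => h /=; congr (_ *: (E _ - _)).
  by rewrite !mxE /p /w /GRing.scale/=; ring.
have dw : derivable E p w by exact: diff_derivable.
apply: DeriveDef; first by rewrite /derivable quot.
have -> : 'D_v (fun y : V => E (a + b * y ord0 i)) x = 'D_w E p by rewrite /derive quot.
rewrite !deriveE//.
by rewrite -[in LHS](mulr1 w) -[_ * 1]/(w *: 1) linearZ.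
Qed.

(** The formula holds for all directions with coefficients again in the class; it serves both
    iterated partial derivatives and derivatives along segments. *)
Lemma smooth_derive f : smooth_alg f -> exists D : 'I_N -> V -> R,
  (forall i, smooth_alg (D i)) /\
  forall x v, is_derive x v f (\sum_i v ord0 i * D i x).
Proof.
elim=> [k a b i|c|{}f g sf [Df [sDf fD]] sg [Dg [sDg gD]]
       |{}f g sf [Df [sDf fD]] sg [Dg [sDg gD]]].
- exists (fun j => if j == i then
    fun x => b * (flat k.+2 (a + b * x ord0 i) + (- k%:R) * flat k.+1 (a + b * x ord0 i))
    else fun=> 0); split=> [j|x v].
    case: eqP => _; last exact: smooth_cst.
    apply: smooth_mul; first exact: smooth_cst.
    apply: smooth_add; first exact: smooth_flat.
    by apply: smooth_mul; [exact: smooth_cst|exact: smooth_flat].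
  rewrite (bigD1 i)//= eqxx big1 ?addr0; last first.
    by move=> j /negbTE ->; rewrite mulr0.
  apply: (is_derive_eq (is_derive_affine_coord v (is_derive_flat k (a + b * x ord0 i)))).
  by rewrite mulNr; ring.
- exists (fun _ _ => 0); split=> [i|x v]; first exact: smooth_cst.
  rewrite big1; last by move=> i _; rewrite mulr0.
  exact: is_derive_cst.
- exists (fun i x => Df i x + Dg i x); split=> [i|x v]; first exact: smooth_add.
  apply: (is_derive_eq (is_deriveD (fD x v) (gD x v))).
  by rewrite -big_split/=; apply: eq_bigr => i _; rewrite mulrDr.
- exists (fun i x => f x * Dg i x + g x * Df i x); split=> [i|x v].
    by apply: smooth_add; exact: smooth_mul.
  apply: (is_derive_eq (is_deriveM (fD x v) (gD x v))).
  rewrite /GRing.scale/= !mulr_sumr -big_split/=; apply: eq_bigr => i _; ring.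
Qed.

Lemma smooth_dpar (i : 'I_N) (phi : V -> R) : smooth_alg phi -> smooth_alg (dpar [:: i] phi).
Proof.
move=> /smooth_derive[D [sD phiD]]; rewrite (_ : dpar _ _ = D i)//.
apply/funext => x /=; have [_ ->] := phiD x (evec R i).
rewrite (bigD1 i)//= big1 ?addr0; last first.
  by move=> j ji; rewrite /evec mxE (negbTE ji) andbF mul0r.
by rewrite /evec mxE !eqxx mul1r.
Qed.

Lemma smooth_smoothRN f : smooth_alg f -> smoothRN f.
Proof.
move=> sf l.
have {sf} sl : smooth_alg (dpar l f).
  by elim: l => [//|i l IH]; exact: smooth_dpar IH.
split; first exact: smooth_continuous.
by move=> i x; have [D [_ lD]] := smooth_derive sl; apply: ex_derive; exact: lD.
Qed.

End smooth_algebra.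

(** * Existence of mollifiers *)

Section mollifier.
Context (R : realType) (N : nat).
Local Notation V := 'rV[R]_N.
Variable mu : {measure set V -> \bar R}.
Hypothesis mu_leb : is_lebesgue_borel mu.

(** The support is measured coordinatewise, in keeping with boxes and cubes. Evenness gives the
    reflected kernel [y -> rho (z - y)] integral 1 as well. *)
Record mollifier (r : R) (rho : V -> R) : Prop := Mollifier {
  mollifier_smooth : smooth_alg rho;
  mollifier_ge0 : forall x, (0 <= rho x)%R;
  mollifier_even : forall x, rho (- x)%R = rho x;
  mollifier_supp : forall x, rho x != 0%R -> forall i, (`|x ord0 i| < r)%R;
  mollifier_int : \int[mu]_x (rho x)%:E = 1 }.

(** The two factors of a coordinate are both positive exactly when [c * |x_i| < 1]; they are
    exchanged by [x -> - x], whence evenness. *)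
Let bump (c : R) (x : V) : R :=
  (\prod_i (flat 0 (1 + c * x ord0 i) * flat 0 (1 + - c * x ord0 i)))%R.

Let bump_ge0 c x : (0 <= bump c x)%R.
Proof. by apply: prodr_ge0 => i _; rewrite mulr_ge0// flat_ge0. Qed.

Let bump_smooth c : smooth_alg (bump c).
Proof. by apply: smooth_prod => i; apply: smooth_mul; exact: smooth_flat. Qed.

Let bump_even c x : bump c (- x)%R = bump c x.
Proof. by apply: eq_bigr => i _; rewrite mxE !mulrN !mulNr opprK mulrC. Qed.

Let bump_supp c x : (0 < c)%R -> bump c x != 0%R -> forall i, (`|x ord0 i| < c^-1)%R.
Proof.
move=> c0 /prodf_neq0 H i; have := H i isT.
rewrite mulf_eq0 negb_or => /andP[].
rewrite /flat; case: ifP => [h1 _|]; last by rewrite eqxx.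
case: ifP => [h2 _|]; last by rewrite eqxx.
rewrite ltr_norml -div1r ltr_pdivlMr// ltrNl ltr_pdivlMr//.
by apply/andP; split; lra.
Qed.

Let flat_lb (t : R) : (2^-1 <= t)%R -> (expR (- 2) <= flat 0 t)%R.
Proof.
move=> t2; have t0 : (0 < t)%R by apply: lt_le_trans t2.
rewrite /flat t0 expr0 mul1r ler_expR lerN2 -(invrK (2 : R)%R) lef_pV2 ?posrE//.
Qed.

(** On the cube of half the size every argument of [flat 0] is at least 1/2. The bound serves to
    make the integral positive, so that the bump can be normalised. *)
Let bump_lb c x : (0 < c)%R -> cube N (c *+ 2)^-1 x ->
  ((expR (- 2) * expR (- 2)) ^+ N <= bump c x)%R.
Proof.
move=> c0 /cubeP xc; rewrite -{1}(card_ord N) -prodr_const.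
apply: ler_prod => i _; rewrite mulr_ge0 ?expR_ge0//=.
have c2 : (0 < (c *+ 2)^-1)%R by rewrite invr_gt0 mulrn_wgt0.
have cE : (c * (c *+ 2)^-1 = 2^-1)%R by field; rewrite gt_eqF.
have /andP[x1 x2] := xc i.
have y1 : (- 2^-1 < c * x ord0 i)%R by rewrite -cE -mulrN ltr_pM2l.
have y2 : (c * x ord0 i <= 2^-1)%R by rewrite -cE ler_pM2l.
by rewrite ler_pM ?expR_ge0// flat_lb//; lra.
Qed.

Let mbump c : measurable_fun setT (fun x => (bump c x)%:E).
Proof. by apply/measurable_EFinP; exact: smooth_measurable. Qed.

Lemma exists_mollifier (r : R) : (0 < r)%R -> exists rho, mollifier r rho.
Proof.
move=> r0; pose c := (r^-1)%R; have c0 : (0 < c)%R by rewrite invr_gt0.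
pose I := \int[mu]_x (bump c x)%:E.
have Ioo : I < +oo.
  have [M bM] := smooth_bounded (bump_smooth c).
  apply: (@le_lt_trans _ _ (\int[mu]_(x in cube N r) (cst M%:E x))).
    rewrite integral_mkcond; apply: ge0_le_integral => //.
    - by move=> x _; rewrite lee_fin.
    - by apply/(measurable_restrictT _ (measurable_rbox _ _)); exact: measurable_cst.
    - move=> x _; rewrite patchE; case: ifPn => [_|].
        by rewrite lee_fin (le_trans (ler_norm _)).
      rewrite notin_setE => xr; rewrite lee_fin le_eqVlt; apply/orP; left.
      apply/negPn/negP => b0; apply: xr; apply/cubeP => i.
      have := bump_supp c0 b0 i; rewrite invrK ltr_norml => /andP[-> ?].
      exact: ltW.
  rewrite integral_cst; last exact: measurable_rbox.
  by rewrite lte_mul_pinfty ?lee_fin ?(le_trans _ (bM 0%R))// lebesgue_cube_lty.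
have I0 : 0 < I.
  have c2 : (0 < (c *+ 2)^-1)%R by rewrite invr_gt0 mulrn_wgt0.
  pose k := ((expR (- 2) * expR (- 2)) ^+ N : R)%R.
  have k0 : (0 < k)%R by rewrite exprn_gt0// mulr_gt0// expR_gt0.
  apply: (@lt_le_trans _ _ (\int[mu]_(x in cube N (c *+ 2)^-1) (cst k%:E x))).
    rewrite integral_cst; last exact: measurable_rbox.
    rewrite lebesgue_cube// -EFinM lte_fin mulr_gt0// exprn_gt0//.
    by rewrite mulrn_wgt0.
  rewrite integral_mkcond; apply: ge0_le_integral => //.
  - by move=> x _; rewrite patchE; case: ifP => // _; rewrite lee_fin ltW.
  - by apply/(measurable_restrictT _ (measurable_rbox _ _)); exact: measurable_cst.
  - move=> x _; rewrite patchE; case: ifPn => [/set_mem xc|_].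
      by rewrite lee_fin; exact: bump_lb.
    by rewrite lee_fin.
have IE : I = (fine I)%:E by rewrite fineK// ge0_fin_numE// ltW.
have fI0 : (0 < fine I)%R by rewrite -lte_fin -IE.
exists (fun x => (fine I)^-1 * bump c x)%R; split.
- by apply: smooth_mul => //; exact: smooth_cst.
- by move=> x; rewrite mulr_ge0// invr_ge0 ltW.
- by move=> x; rewrite bump_even.
- move=> x; rewrite mulf_eq0 negb_or => /andP[_ b0] i.
  by rewrite -[r]invrK; exact: bump_supp.
- under eq_integral do rewrite EFinM.
  rewrite ge0_integralZl//; last 2 first.
  + by move=> x _; rewrite lee_fin.
  + by rewrite lee_fin invr_ge0 ltW.
  by rewrite -/I IE -EFinM mulVf// gt_eqF.
Qed.

End mollifier.

Section measurable_rV_functions.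
Context (R : realType) (N : nat).
Local Notation V := 'rV[R]_N.
Context d (T : measurableType d).

Lemma measurable_rVD (f g : T -> V) : measurable_fun setT f ->
  measurable_fun setT g -> measurable_fun setT (fun x => f x + g x)%R.
Proof.
move=> /measurable_rVP mf /measurable_rVP mg; apply/measurable_rVP => i.
by under eq_fun do rewrite mxE; exact: measurable_funD.
Qed.

Lemma measurable_rVN (f : T -> V) : measurable_fun setT f ->
  measurable_fun setT (fun x => - f x)%R.
Proof.
move=> /measurable_rVP mf; apply/measurable_rVP => i.
by under eq_fun do rewrite mxE -mulN1r; exact: measurable_funM.
Qed.

Lemma measurable_rVZ (s : T -> R) (f : T -> V) : measurable_fun setT s ->
  measurable_fun setT f -> measurable_fun setT (fun x => s x *: f x)%R.
Proof.
move=> ms /measurable_rVP mf; apply/measurable_rVP => i.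
by under eq_fun do rewrite mxE; exact: measurable_funM.
Qed.

End measurable_rV_functions.

(** * Convolution against a measure, and the tangent inequality *)

Section convolution.
Context (R : realType) (N : nat).
Local Notation V := 'rV[R]_N.
Variable mu : {sigma_finite_measure set V -> \bar R}.
Hypothesis mu_leb : is_lebesgue_borel mu.
Variable tau : {sigma_finite_measure set V -> \bar R}.

Definition conv (w : V -> R) (rho : V -> R) (z : V) : \bar R :=
  \int[tau]_y (w y * rho (z - y)%R)%:E.

Variables (r : R) (rho : V -> R).
Hypothesis rhoP : mollifier mu r rho.

Let mrho := smooth_measurable (mollifier_smooth rhoP).

Section density.
Variable w : V -> R.
Hypotheses (mw : measurable_fun setT w) (w0 : forall y, (0 <= w y)%R).

Lemma measurable_conv_kernel :
  measurable_fun setT (fun z : V * V => (w z.2 * rho (z.1 - z.2)%R)%:E).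
Proof.
apply/measurable_EFinP; apply: measurable_funM; first exact: measurableT_comp.
apply: (measurableT_comp mrho); apply: measurable_rVD => //.
exact: measurable_rVN.
Qed.

Let kernel_ge0 (z : V * V) : 0 <= (w z.2 * rho (z.1 - z.2)%R)%:E.
Proof. by rewrite lee_fin mulr_ge0// (mollifier_ge0 rhoP). Qed.

Lemma measurable_conv : measurable_fun setT (conv w rho).
Proof.
exact: (@measurable_fun_fubini_tonelli_F _ _ _ _ _ tau _
  measurable_conv_kernel kernel_ge0).
Qed.

Lemma conv_ge0 z : 0 <= conv w rho z.
Proof. by apply: integral_ge0 => y _; exact: (kernel_ge0 (z, y)). Qed.

(** Tonelli and translation invariance of [mu]: mollification preserves total mass, whatever the
    measure [tau] carrying the density. *)
Lemma integral_conv : \int[mu]_z conv w rho z = \int[tau]_y (w y)%:E.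
Proof.
rewrite /conv (@fubini_tonelli _ _ _ _ _ mu tau _ measurable_conv_kernel kernel_ge0).
apply: eq_integral => y _ /=; under eq_integral do rewrite EFinM.
have mrE : measurable_fun setT (fun z : V => (rho z)%:E) by exact/measurable_EFinP.
rewrite ge0_integralZl ?lee_fin//; last 2 first.
- by apply: (measurableT_comp mrE); exact: measurable_rVD.
- by move=> z _; rewrite lee_fin (mollifier_ge0 rhoP).
rewrite (ge0_integral_shift mu_leb (- y)%R mrE) ?(mollifier_int rhoP) ?mule1//.
by move=> z; rewrite lee_fin (mollifier_ge0 rhoP).
Qed.

End density.
End convolution.

Section young.
Context (R : realType).
Local Open Scope ring_scope.

(** The graph of [a^p] lies above its tangent at [m]; this is Young's inequality for [a] and
    [m^(p-1)] with exponents [p] and [p/(p-1)]. There is equality at [a = m], so nothing is lost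
    when [m] is the threshold in question. *)
Lemma young_tangent (p m a : R) : 1 <= p -> 0 < m -> 0 <= a ->
  p * m `^ (p - 1) * a <= a `^ p + (p - 1) * m `^ p.
Proof.
rewrite le_eqVlt => /predU1P[<-|p1] m0 a0.
  by rewrite subrr powRr0 mul0r addr0 !mul1r powRr1.
have p0 : 0 < p by rewrite (lt_trans ltr01).
have q0 : 0 < p / (p - 1) by rewrite divr_gt0// subr_gt0.
have pq : p^-1 + (p / (p - 1))^-1 = 1.
  by field; rewrite !gt_eqF// subr_gt0.
have := conjugate_powR a0 (powR_ge0 m (p - 1)) p0 q0 pq.
have p10 : p - 1 != 0 by rewrite gt_eqF// subr_gt0.
rewrite -powRrM (_ : (p - 1) * (p / (p - 1)) = p); last by field.
rewrite (_ : a `^ p / p + _ = (a `^ p + (p - 1) * m `^ p) / p); last first.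
  by field; rewrite p10 gt_eqF.
by rewrite ler_pdivlMr// mulrC [a * _]mulrC mulrA.
Qed.

End young.

(** * Reflected mollifiers and their derivatives *)

Section mollifier_derivatives.
Context (R : realType) (N : nat).
Local Notation V := 'rV[R]_N.
Variable mu : {measure set V -> \bar R}.
Variables (r : R) (rho : V -> R).
Hypothesis rhoP : mollifier mu r rho.
Local Open Scope ring_scope.

(** A closed ball of the sup norm: the half-open [cube] is not compact, whereas test functions need
    compact supports. *)
Definition dbox (a : V) (b : R) : set V := [set x | forall i, `|a ord0 i - x ord0 i| <= b].

Lemma dbox_compact a b : compact (dbox a b).
Proof.
rewrite (_ : dbox a b =
    [set v : V | forall i, `[a ord0 i - b, a ord0 i + b]%classic (v ord0 i)]).
  apply: (@rV_compact _ _ (fun i => `[a ord0 i - b, a ord0 i + b]%classic)) => i.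
  exact: segment_compact.
by apply/seteqP; split=> x xab i; have := xab i; rewrite /= in_itv/= ler_distlC.
Qed.

Lemma dbox_closed a b : closed (dbox a b).
Proof. by apply: compact_closed; [exact: norm_hausdorff|exact: dbox_compact]. Qed.

Lemma smooth_reflect f z : smooth_alg f -> @smooth_alg R N (fun y => f (z - y)).
Proof.
elim=> [k a b i|c|{}f g _ sf _ sg|{}f g _ sf _ sg].
- rewrite (_ : (fun y => _) = fun y : V => flat k ((a + b * z ord0 i) + (- b) * y ord0 i)).
    exact: smooth_flat.
  by apply/funext => y; rewrite !mxE; congr flat; ring.
- exact: smooth_cst.
- exact: smooth_add.
- exact: smooth_mul.
Qed.

Lemma mollifier_test_fun z : test_fun (fun y => rho (z - y)).
Proof.
split; first by apply/smooth_smoothRN/smooth_reflect/(mollifier_smooth rhoP).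
apply: (@subclosed_compact _ _ (dbox z r)); [exact: closed_closure|exact: dbox_compact|].
have -> : dbox z r = closure (dbox z r) by apply/closure_id; exact: dbox_closed.
apply: closureS => y /= yz i.
by have := mollifier_supp rhoP yz i; rewrite !mxE => /ltW.
Qed.

Variable D : 'I_N -> V -> R.
Hypotheses (sD : forall i, smooth_alg (D i))
  (rhoD : forall x v, is_derive x v rho (\sum_i v ord0 i * D i x)).

Lemma derive_reflect z (v y : V) :
  'D_v (fun y => rho (z - y)) y = - \sum_i v ord0 i * D i (z - y).
Proof.
have -> : 'D_v (fun y => rho (z - y)) y = 'D_(- v) rho (z - y).
  rewrite /derive; set f1 := fun h : R => _; set f2 := fun h : R => _.
  suff -> : f1 = f2 by [].
  apply/funext => h; rewrite /f1 /f2 /=.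
  by congr (_ *: (rho _ - _)); rewrite scalerN opprD addrCA.
have [_ ->] := rhoD (z - y) (- v).
by rewrite -sumrN; apply: eq_bigr => i _; rewrite mxE mulNr.
Qed.

Lemma dpar_reflect z i (y : V) :
  dpar [:: i] (fun y => rho (z - y)) y = - D i (z - y).
Proof.
rewrite /= derive_reflect (bigD1 i)//= big1 ?addr0; last first.
  by move=> j ji; rewrite /evec mxE (negbTE ji) andbF mul0r.
by rewrite /evec mxE !eqxx mul1r.
Qed.

(** Outside the closed box [rho] vanishes in a neighbourhood, so its derivatives vanish too. *)
Lemma derivative_supp i x : D i x != 0 -> dbox 0 r x.
Proof.
move=> Dx; apply: contrapT => xr; move/eqP : Dx; apply.
have nx : \near x, ~ dbox 0 r x.
  by apply: (@open_nbhs_nbhs _ x (~` dbox 0 r)); split => //;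
    apply: closed_openC; exact: dbox_closed.
have [_ <-] := is_derive_cst (0 : R) x (evec R i).
have -> : 'D_(evec R i) (cst (0 : R)) x = 'D_(evec R i) rho x.
  apply: near_eq_derive; near=> y; apply/esym/eqP/negPn/negP => y0.
  have : ~ dbox 0 r y by near: y.
  apply=> j; have := mollifier_supp rhoP y0 j.
  by rewrite mxE sub0r normrN => /ltW.
have [_ ->] := rhoD x (evec R i).
rewrite (bigD1 i)//= big1 ?addr0; last first.
  by move=> j ji; rewrite /evec mxE (negbTE ji) andbF mul0r.
by rewrite /evec mxE !eqxx mul1r.
Unshelve. all: end_near. Qed.

Definition ddir (h x : V) : R := \sum_i h ord0 i * D i x.

Lemma smooth_ddir h : smooth_alg (ddir h).
Proof.
by apply: smooth_sum => i; apply: smooth_mul => //; exact: smooth_cst.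
Qed.

Lemma mollifier_FTC (x h : V) :
  (\int[lebesgue_measure]_(t in `[0%R, 1%R]) (ddir h (x + t *: h))%:E =
  (rho (x + h))%:E - (rho x)%:E)%E.
Proof.
pose F (t : R) := rho (x + t *: h).
have Fd (t : R) : is_derive t 1 F (ddir h (x + t *: h)).
  have quot : (fun s : R => s^-1 *: ((F \o shift t) (s *: 1) - F t)) =
      (fun s : R => s^-1 *: ((rho \o shift (x + t *: h)) (s *: h) - rho (x + t *: h))).
    apply/funext => s /=; congr (_ *: (rho _ - _)).
    by rewrite [s *: 1]mulr1 scalerDl addrCA.
  have [dr dE] := rhoD (x + t *: h) h.
  apply: DeriveDef; first by rewrite /derivable quot.
  by rewrite /derive quot -/(derive rho _ _) dE.
have Fc (t : R) : {for t, continuous F}.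
  by apply/differentiable_continuous/derivable1_diffP; apply: ex_derive; exact: Fd.
have lc : continuous (fun t : R => x + t *: h).
  move=> t; apply: (@cvgD _ V _ (nbhs t) _ (fun=> x) (fun s : R => s *: h)); first exact: cvg_cst.
  exact: (@cvgZr_tmp _ V).
rewrite (@continuous_FTC2 _ _ F 0 1) => //.
- by rewrite /F scale1r scale0r addr0.
- apply: continuous_subspaceT => t.
  apply: (@continuous_comp _ _ _ (fun t : R => x + t *: h) (ddir h)); first exact: lc.
  exact: smooth_continuous (smooth_ddir h) _.
- split=> [t _||]; first by apply: ex_derive; exact: Fd.
    by apply: cvg_at_right_filter; exact: Fc.
  by apply: cvg_at_left_filter; exact: Fc.
- by move=> t _; rewrite derive1E; apply: derive_val.
Qed.

End mollifier_derivatives.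

(** * Borel versions of Lebesgue functions *)

Section borel_version.
Context (R : realType) (N : nat).
Local Notation V := 'rV[R]_N.
Variable mu : {measure set V -> \bar R}.
Hypothesis mu_leb : is_lebesgue_borel mu.
Local Notation lebT := (caratheodory_type (mu_ext mu)).
Local Notation L := (leb mu).

(** Countable Borel covers with excess below [1/(n+1)] come from the infimum defining the outer
    measure; their intersection has no excess. Finiteness allows the subtraction of [L E]. *)
Lemma borel_envelope_lty (E : set V) : measurable (E : set lebT) -> L E < +oo ->
  exists B : set V, [/\ measurable B, E `<=` B & L (B `\` E) = 0].
Proof.
move=> mE Eoo.
have Efin : L E \is a fin_num by rewrite ge0_fin_numE.
have cov (n : nat) : exists U : set V,
    [/\ measurable U, E `<=` U & L U < L E + (n.+1%:R^-1)%:E].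
  have n0 : (0 < n.+1%:R^-1 :> R)%R by rewrite invr_gt0.
  have [_ /= [A [mA EA] <-] AE] := lb_ereal_inf_adherent n0 Efin.
  exists (\bigcup_k A k); split=> //; first exact: bigcup_measurable.
  apply: le_lt_trans AE.
  have mU : measurable (\bigcup_k A k) by exact: bigcup_measurable.
  rewrite lebE//.
  by apply: measure_sigma_subadditive => // k; exact: mA.
have [U HU] := choice cov.
have mU k : measurable (U k) by have [] := HU k.
have mB : measurable (\bigcap_n U n) by exact: bigcap_measurable.
exists (\bigcap_n U n); split=> //; first by move=> x Ex n _; have [_ + _] := HU n; apply.
have mD (n : nat) : L (\bigcap_n U n `\` E) <= (n.+1%:R^-1)%:E.
  have [_ EU UE] := HU n.
  have mUl := measurable_leb mu (mU n).
  apply: (@le_trans _ _ (L (U n `\` E))).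
    apply: le_measure; rewrite ?inE.
    - by apply: measurableD => //; exact: measurable_leb.
    - exact: measurableD.
    - by apply: setSD; exact: bigcap_inf.
  have -> : L (U n `\` E) = L (U n) - L (U n `&` E).
    exact: (measureD mUl mE (lt_le_trans UE (leey _))).
  by rewrite setIidr// leeBlDr// addeC ltW.
apply/eqP; rewrite eq_le measure_ge0 andbT.
apply/lee_addgt0Pr => _/posnumP[e]; rewrite add0e; near \oo => n.
apply: (le_trans (mD n)); rewrite lee_fin ltW//.
by near: n; exact: near_infty_natSinv_lt.
Unshelve. all: end_near. Qed.

Lemma borel_envelope (E : set V) : measurable (E : set lebT) ->
  exists B : set V, [/\ measurable B, E `<=` B & L (B `\` E) = 0].
Proof.
move=> mE.
have mEn (n : nat) : measurable (E `&` cube N n%:R : set lebT).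
  by apply: measurableI => //; apply: measurable_leb; exact: measurable_rbox.
have fin n : exists B : set V, [/\ measurable B, E `&` cube N n%:R `<=` B &
    L (B `\` (E `&` cube N n%:R)) = 0].
  apply: borel_envelope_lty => //.
  apply: (@le_lt_trans _ _ (L (cube N n%:R))).
    apply: le_measure; rewrite ?inE//.
    by apply: measurable_leb; exact: measurable_rbox.
  by rewrite lebE; [exact: lebesgue_cube_lty|exact: measurable_rbox].
have [B HB] := choice fin.
have mB k : measurable (B k) by have [] := HB k.
exists (\bigcup_n B n); split.
- exact: bigcup_measurable.
- move=> x Ex; have : setT x by [].
  rewrite -(@bigcup_cube R N) => -[n _ xn]; exists n => //.
  by have [_ + _] := HB n; apply.
- apply/eqP; rewrite eq_le measure_ge0 andbT.
  apply: (@le_trans _ _ (\sum_(n <oo) L (B n `\` (E `&` cube N n%:R)))).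
    apply: measure_sigma_subadditive => [n||].
    + by apply: measurableD => //; exact: measurable_leb.
    + by apply: measurableD => //; apply: measurable_leb; exact: bigcup_measurable.
    + by move=> x [[n _ Bx] Ex]; exists n => //; split=> // -[].
  by rewrite eseries0// => n _ _; have [] := HB n.
Qed.

(** Superlevel sets at rational heights are replaced by Borel envelopes. The countably many null
    errors lie in one Borel null set, on which the function is reset to 0; off it the superlevel
    sets are those of the envelopes. *)
Lemma borel_version (f : V -> R) : measurable_fun setT (f : lebT -> R) ->
  exists (f' : V -> R) (M : set V), [/\ measurable_fun setT f', measurable M,
    mu M = 0 & forall x, ~ M x -> f x = f' x].
Proof.
move=> mf.
(* An enumeration of the rationals; indices that code none repeat 0. *)
pose q_ (n : nat) : R := ratr (odflt 0%R (unpickle n) : rat).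
have mS n : measurable ([set x | (q_ n < f x)%R] : set lebT).
  rewrite -[X in measurable X]setTI.
  rewrite (_ : [set x | _] = (f : lebT -> R) @^-1` `]q_ n, +oo[); first exact: mf.
  by apply/seteqP; split=> x /=; rewrite in_itv/= andbT.
have [B HB] := choice (fun n => borel_envelope (mS n)).
have mB n : measurable (B n) by have [] := HB n.
have nul n : exists M : set V, [/\ measurable M, B n `\` [set x | (q_ n < f x)%R] `<=` M &
    mu M = 0].
  have [_ BS B0] := HB n.
  have mD : measurable (B n `\` [set x | (q_ n < f x)%R] : set lebT).
    by apply: measurableD => //; exact: measurable_leb.
  have [M [mM DM M0]] := borel_envelope mD.
  exists M; split=> //; rewrite -lebE//.
  have -> : L M = L (M `\` (B n `\` [set x | (q_ n < f x)%R])) +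
      L (M `&` (B n `\` [set x | (q_ n < f x)%R])).
    exact: (measureDI (leb mu) (measurable_leb mu mM) mD).
  by rewrite setIidr// M0 add0e; exact: B0.
have [M HM] := choice nul.
pose MM := \bigcup_n M n.
have mM n : measurable (M n) by have [] := HM n.
have mMM : measurable MM by exact: bigcup_measurable.
exists (fun x => if pselect (MM x) then 0%R else f x), MM.
split=> //.
- apply: (measurability (@RGenOInfty.G R)) => [|/= _ [_] [r] -> <-].
    exact: RGenOInfty.measurableE.
  rewrite setTI.
  (* Since the version is 0 on [MM], this set belongs to the superlevel set precisely when
     [r < 0]. *)
  have -> : (fun x => if pselect (MM x) then 0%R else f x) @^-1` `]r, +oo[%classic =
      (\bigcup_(n in [set n | (r < q_ n)%R]) (B n `\` MM)) `|`
      (if (r < 0)%R then MM else set0).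
    apply/seteqP; split=> x /=; rewrite in_itv/= andbT.
      case: pselect => [Mx ->|nMx rx]; first by right.
      left; have [q] := rat_in_itvoo rx.
      rewrite in_itv/= => /andP[rq qx].
      have qE : q_ (pickle q) = ratr q by rewrite /q_ pickleK.
      exists (pickle q) => /=; first by rewrite qE.
      by split=> //; have [_ + _] := HB (pickle q); apply; rewrite /= qE.
    case=> [[n /= rn [Bx nMx]]|].
      case: pselect => [Mx//|nMx']; apply: (lt_trans rn).
      apply: contrapT => fx; apply: nMx; exists n => //.
      by have [_ + _] := HM n; apply; split.
    by case: ifPn => // r0 Mx; case: pselect => [Mx'|]//.
  apply: measurableU; last by case: ifP.
  by apply: bigcup_measurable => n _; exact: measurableD.
- apply/eqP; rewrite eq_le measure_ge0 andbT.
  apply: (@le_trans _ _ (\sum_(n <oo) mu (M n))).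
    by apply: measure_sigma_subadditive => //.
  by rewrite eseries0// => n _ _; have [] := HM n.
- by move=> x nMx; case: pselect.
Qed.

(** The preimage differs from a Borel set only inside [M], and every subset of a null set is
    measurable for the completed measure. *)
Lemma measurable_leb_ae d (T : measurableType d) (f f' : V -> T) (M : set V) :
  measurable M -> mu M = 0 -> (forall x, ~ M x -> f x = f' x) ->
  measurable_fun setT f' -> measurable_fun setT (f : lebT -> T).
Proof.
move=> mM M0 ff' mf' _ Y mY; rewrite setTI.
have -> : f @^-1` Y = (f' @^-1` Y `\` M) `|` (f @^-1` Y `&` M).
  apply/seteqP; split=> x /=.
    by have [Mx fx|nMx fx] := pselect (M x); [right|left; rewrite -ff'].
  by case=> [[fx nMx]|[]//]; rewrite ff'.
apply: (@measurableU _ lebT); first apply: (@measurableD _ lebT).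
- by have := @measurable_fun_leb _ _ mu _ _ _ mf' measurableT _ mY; rewrite setTI.
- exact: measurable_leb.
- apply: (@measure_is_complete_caratheodory _ _ (mu_ext mu)).
  exists M; split; [exact: measurable_leb|by rewrite -M0 -lebE|exact: subIsetr].
Qed.

Lemma integral_leb_ae (f f' : V -> \bar R) (M : set V) :
  measurable M -> mu M = 0 -> (forall x, ~ M x -> f x = f' x) ->
  measurable_fun setT f' -> \int[L]_x f x = \int[mu]_x f' x.
Proof.
move=> mM M0 ff' mf'; rewrite (@ae_eq_integral _ lebT R L _ f').
- rewrite integralE [RHS]integralE; congr (_ - _); apply: ge0_integral_leb => //.
    exact: measurable_funepos.
  exact: measurable_funeneg.
- exact: measurableT.
- exact: (measurable_leb_ae mM M0 ff' mf').
- exact: measurable_fun_leb.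
- exists M; split; [exact: measurable_leb|by rewrite -M0 -lebE|].
  by move=> x /= fx; apply: contrapT => nMx; apply: fx => _; exact: ff'.
Qed.

End borel_version.

(** * The mollified inequality *)

Section mollified_increment.
Context (R : realType) (N : nat).
Local Notation V := 'rV[R]_N.
Local Notation lambda := (@lebesgue_measure R).

Lemma enorm_dot (a b : V) :
  (\sum_i `|a ord0 i| * `|b ord0 i| <= enorm a * enorm b)%R.
Proof.
have triv (c d : V) : ~~ (0 < enorm c)%R ->
    (\sum_i `|c ord0 i| * `|d ord0 i| = 0)%R.
  move=> c0; have ce0 : enorm c = 0%R.
    by apply/eqP; rewrite eq_le enorm_ge0 andbT leNgt.
  apply: big1 => i _; have := le_enorm c i; rewrite ce0 normr_le0 => /eqP ->.
  by rewrite normr0 mul0r.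
have [a0|/triv ->] := boolP (0 < enorm a)%R; last by rewrite mulr_ge0 ?enorm_ge0.
have [b0|/triv tb] := boolP (0 < enorm b)%R; last first.
  rewrite (eq_bigr (fun i => `|b ord0 i| * `|a ord0 i|)%R) => [|i _].
    by rewrite tb mulr_ge0 ?enorm_ge0.
  by rewrite mulrC.
set A := enorm a in a0 *; set B := enorm b in b0 *.
have A2 : (\sum_i a ord0 i ^+ 2 = A ^+ 2)%R by rewrite sqr_sqrtr ?enorm_sum_ge0.
have B2 : (\sum_i b ord0 i ^+ 2 = B ^+ 2)%R by rewrite sqr_sqrtr ?enorm_sum_ge0.
(* Each product is bounded by half of [B / A * s^2 + A / B * t^2]; these weights make the bounds add
   up to [A * B]. *)
have -> : (A * B = \sum_i (B / A * a ord0 i ^+ 2 + A / B * b ord0 i ^+ 2) / 2)%R.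
  rewrite -mulr_suml big_split/= -!mulr_sumr A2 B2.
  by field; rewrite !gt_eqF.
apply: ler_sum => i _; rewrite -(real_normK (num_real (a ord0 i))) -(real_normK (num_real (b ord0 i))).
set s := `|a ord0 i|%R; set t := `|b ord0 i|%R.
have -> : ((B / A * s ^+ 2 + A / B * t ^+ 2) / 2 =
    s * t + (B * s - A * t) ^+ 2 / (2 * A * B))%R.
  by field; rewrite !gt_eqF.
by rewrite lerDl divr_ge0 ?sqr_ge0// !mulr_ge0// ltW.
Qed.

Lemma integrable_compact_supp (nu : {measure set V -> \bar R}) (w f : V -> R) (k : R) :
  measurable_fun setT w -> nu.-integrable (cube N k) (EFin \o w) ->
  smooth_alg f -> (forall y, f y != 0%R -> cube N k y) ->
  nu.-integrable setT (fun y => (w y * f y)%:E).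
Proof.
move=> mw wk sf fk; have [M fM] := smooth_bounded sf.
have M0 : (0 <= M)%R by apply: le_trans (fM 0%R).
have mk : measurable (cube N k) by exact: measurable_rbox.
apply: (@le_integrable _ _ _ nu _ _ _ (fun y => M%:E * ((EFin \o w) \_ (cube N k)) y)) => //.
- apply/measurable_EFinP; apply: measurable_funM => //; exact: smooth_measurable.
- move=> y _; rewrite abseM/= patchE.
  have [f0|f0] := eqVneq (f y) 0%R; first by rewrite f0 mulr0 normr0 mule_ge0 ?lee_fin ?normr_ge0 ?abse_ge0.
  rewrite mem_set; last exact: fk.
  by rewrite /= -EFinM lee_fin normrM mulrC ler_wpM2r// (le_trans (fM y))// ler_norm.
- apply: integrableZl; first exact: measurableT.
  exact: ((integrable_mkcond _ mk).1 wk).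
Qed.

Variable mu : {sigma_finite_measure set V -> \bar R}.
Hypothesis mu_leb : is_lebesgue_borel mu.
Variable tau : {sigma_finite_measure set V -> \bar R}.
Variables (u : V -> R) (g : 'I_N -> V -> R).
Hypotheses (mu_u : measurable_fun setT u) (mg : forall i, measurable_fun setT (g i)).
Hypotheses (uK : forall k : R, mu.-integrable (cube N k) (EFin \o u))
  (gK : forall (k : R) i, tau.-integrable (cube N k) (EFin \o g i)).
Hypothesis weak : forall phi, smooth_alg phi -> (forall x, 0 <= phi x)%R ->
  test_fun phi -> forall i,
  \int[mu]_x (u x * dpar [:: i] phi x)%:E = - \int[tau]_x (g i x * phi x)%:E.
Variables (r : R) (rho : V -> R).
Hypothesis rhoP : mollifier mu r rho.

Definition mollified (z : V) : R := fine (\int[mu]_y (u y * rho (z - y)%R)%:E).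

(** The additional 1 pays for the strict lower inequality in [cube]. *)
Lemma dbox_cube (z y : V) (k : R) : (forall i, `|z ord0 i| <= k)%R ->
  dbox z r y -> cube N (k + r + 1)%R y.
Proof.
move=> zk zy; apply/cubeP => i; have := zy i.
have := zk i; rewrite ler_norml ler_distlC => /andP[a b] /andP[c d].
by apply/andP; split; lra.
Qed.

Let srho (z : V) : smooth_alg (fun y => rho (z - y)%R).
Proof. exact/smooth_reflect/(mollifier_smooth rhoP). Qed.

Let supp_rho (z y : V) : rho (z - y)%R != 0%R -> cube N (enorm z + r + 1)%R y.
Proof.
move=> zy; apply: (@dbox_cube z) => i; first exact: le_enorm.
by have := mollifier_supp rhoP zy i; rewrite !mxE => /ltW.
Qed.

Lemma integrable_mollified (z : V) :
  mu.-integrable setT (fun y => (u y * rho (z - y)%R)%:E).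
Proof. exact: integrable_compact_supp (supp_rho (z := z)). Qed.

Let gnorm_row (y : V) : R := enorm (\row_i g i y).

Let mgn : measurable_fun setT gnorm_row.
Proof. exact: measurable_enorm_row. Qed.

(** The increment of [rho] along the segment is the integral of its directional derivative, so
    Fubini writes the increment of the mollification as an integral over [t] of [u] against that
    derivative. For each [t] the weak gradient hypothesis transfers the derivative to the density
    [g] of [tau], and Cauchy-Schwarz separates [h] from [g]. *)
Lemma mollified_increment (x h : V) :
  `|mollified (x + h)%R - mollified x|%:E <=
  \int[lambda]_(t in `]0%R, 1%R]%classic) ((enorm h)%:E * conv tau gnorm_row rho (x + t *: h)%R).
Proof.
have [D [sD rhoD]] := smooth_derive (mollifier_smooth rhoP).
have sdd := smooth_ddir sD h.
pose z (t : R) : V := (x + t *: h)%R.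
(* A bound for the coordinates of all points of the segment: one cube then contains the supports for
   every [t]. *)
pose k : R := (enorm x + enorm h)%R.
have zk t : `]0%R, 1%R]%classic t -> (forall i, `|z t ord0 i| <= k)%R.
  rewrite /= in_itv/= => /andP[t0 t1] i; rewrite !mxE.
  rewrite (le_trans (ler_normD _ _))// lerD ?le_enorm//.
  rewrite normrM (gtr0_norm t0) (le_trans _ (le_enorm h i))//.
  by rewrite ler_piMl.
pose A : set R := `]0%R, 1%R]%classic.
have mA : measurable A by exact: measurable_itv.
pose F (w : measurableTypeR R * V) : \bar R :=
  (u w.2 * ddir D h (z w.1 - w.2)%R * \1_A w.1)%:E.
have mz : measurable_fun setT (fun w : measurableTypeR R * V => z w.1 - w.2)%R.
  apply: measurable_rVD; last exact: measurable_rVN.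
  apply: measurable_rVD => //.
  exact: measurable_rVZ.
have mF : measurable_fun setT F.
  apply/measurable_EFinP; apply: measurable_funM; last first.
    exact: (measurableT_comp (measurable_indic mA)).
  apply: measurable_funM; first exact: measurableT_comp.
  exact: (measurableT_comp (smooth_measurable sdd)).
have ddir0 t y : A t -> ddir D h (z t - y)%R != 0%R -> cube N (k + r + 1)%R y.
  move=> At d0; apply: (dbox_cube (zk _ At)) => i.
  apply: contrapT => nri; move/eqP: d0; apply.
  apply: big1 => j _.
  suff -> : D j (z t - y)%R = 0%R by rewrite mulr0.
  apply/eqP/negPn/negP => /(derivative_supp rhoP rhoD) /(_ i).
  by move=> H; apply: nri; move: H; rewrite !mxE sub0r normrN.
have uint t : A t -> mu.-integrable setT (fun y => (u y * ddir D h (z t - y)%R)%:E).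
  move=> At; apply: (integrable_compact_supp mu_u (uK _)).
    exact: smooth_reflect.
  by move=> y; exact: ddir0.
have [M dM] := smooth_bounded sdd.
have M0 : (0 <= M)%R by apply: le_trans (dM 0%R).
have iF : (lambda \x mu).-integrable setT F.
  apply/integrable12ltyP; first exact: mF.
  pose W := \int[mu]_(y in cube N (k + r + 1)%R) (`|u y|)%:E.
  have Woo : W < +oo by have /integrableP[] := uK (k + r + 1)%R.
  have W0 : 0 <= W by apply: integral_ge0 => y _; rewrite lee_fin.
  have mE : measurable (cube N (k + r + 1)%R) by exact: measurable_rbox.
  have mau : measurable_fun setT (fun y => (`|u y|)%:E).
    by apply/measurable_EFinP; exact: measurableT_comp.
  apply: (@le_lt_trans _ _ (\int[lambda]_t (M%:E * W * (\1_A t : R)%:E))).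
    apply: ge0_le_integral => //.
    - by move=> t _; exact: integral_ge0.
    - apply: (@measurable_fun_fubini_tonelli_F _ _ _ _ _ mu (abse \o F)) => //.
        exact: measurableT_comp.
      by move=> w; rewrite /= lee_fin.
    - by apply: measurable_funeM; apply/measurable_EFinP; exact: measurable_indic.
    move=> t _; rewrite indicE; case: (boolP (t \in A)) => [/set_mem At|/negbTE nAt]; last first.
      rewrite mule0 (eq_integral (cst 0)) ?integral0// => y _.
      by rewrite /F/= indicE nAt mulr0 normr0.
    rewrite mule1 /W -ge0_integralZl_EFin//; last first.
      exact: measurable_funTS.
    rewrite [leRHS]integral_mkcond; apply: ge0_le_integral => //.
    - by apply: measurableT_comp => //; exact: (measurableT_comp mF (pair1_measurable t)).
    - by apply/(measurable_restrictT _ mE); apply: measurable_funTS; exact: measurable_funeM.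
    move=> y _; rewrite patchE /F/=.
    have [->|/(ddir0 _ _ At) yk] := eqVneq (ddir D h (z t - y)%R) 0%R.
      by rewrite mulr0 mul0r normr0; case: ifP => // _; rewrite mule_ge0 ?lee_fin.
    rewrite mem_set// -EFinM lee_fin indicE mem_set// mulr1 normrM mulrC.
    by rewrite ler_wpM2r.
  rewrite ge0_integralZl//; last 2 first.
    by apply/measurable_EFinP; exact: measurable_indic.
    by rewrite mule_ge0 ?lee_fin.
  have lA : lambda A = 1.
    by rewrite lebesgue_measure_itv/= lte_fin ltr01 sube0.
  rewrite integral_indic// setIT.
  apply: (@le_lt_trans _ _ (M%:E * W * lambda A)); first exact: lexx.
  rewrite lA.
  by rewrite mule1 lte_mul_pinfty ?lee_fin.
(* The test function is [y -> rho (z t - y)]; the sign from the reflection cancels the sign from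
   integration by parts. *)
have Gint t : A t -> \int[mu]_y (u y * ddir D h (z t - y)%R)%:E =
   \int[tau]_y ((\sum_i h ord0 i * g i y) * rho (z t - y))%:E.
  move=> At; under eq_integral.
    move=> y _; rewrite /ddir mulr_sumr -sumEFin; over.
  rewrite /= integral_sum//; last first.
    move=> i; apply: (integrable_compact_supp (k := (k + r + 1)%R) mu_u (uK _)).
      by apply: (@smooth_reflect _ _ (fun x => h ord0 i * D i x)%R);
        apply: smooth_mul => //; exact: smooth_cst.
    move=> y; rewrite mulf_eq0 negb_or => /andP[_ /(derivative_supp rhoP rhoD) dD].
    apply: (dbox_cube (zk _ At)) => j.
    by have := dD j; rewrite !mxE sub0r normrN.
  under [RHS]eq_integral.
    move=> y _; rewrite mulr_suml -sumEFin; over.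
  have gi (i : 'I_N) : tau.-integrable setT (fun y => (g i y * rho (z t - y)%R)%:E).
    exact: (integrable_compact_supp (mg i) (gK _ i) (srho (z t)) (@supp_rho (z t))).
  rewrite /= integral_sum//; last first.
    move=> i; under eq_fun do rewrite -mulrA EFinM.
    by apply: integrableZl.
  apply: eq_bigr => i _; under [RHS]eq_integral do rewrite -mulrA EFinM.
  rewrite integralZl//.
  have := weak (srho (z t)) (fun y => mollifier_ge0 rhoP _) (mollifier_test_fun rhoP (z t)) i.
  have -> : \int[mu]_y (u y * dpar [:: i] (fun y => rho (z t - y)%R) y)%:E =
      \int[mu]_y (u y * - D i (z t - y)%R)%:E.
    by apply: eq_integral => y _; rewrite (dpar_reflect rhoD).
  have uDi : mu.-integrable setT (fun y => (u y * D i (z t - y)%R)%:E).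
    apply: (integrable_compact_supp mu_u (uK (k + r + 1)%R)).
      by apply: smooth_reflect.
    move=> y /(derivative_supp rhoP rhoD) dD.
    apply: (dbox_cube (zk _ At)) => j.
    by have := dD j; rewrite !mxE sub0r normrN.
  have -> : (fun y => (u y * - D i (z t - y)%R)%:E) = (fun y => - ((u y * D i (z t - y)%R)%:E)).
    by apply/funext => y; rewrite mulrN EFinN.
  rewrite integralN; last exact: integrable_add_def.
  move=> /oppe_inj <-.
  by rewrite -integralZl//; apply: eq_integral => y _; rewrite -EFinM; congr EFin; ring.
have Gle t : A t -> `|\int[tau]_y ((\sum_i h ord0 i * g i y) * rho (z t - y))%:E| <=
    (enorm h)%:E * conv tau gnorm_row rho (z t).
  move=> At; have mK : measurable_fun setT (fun y : V => rho (z t - y)%R).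
    exact: smooth_measurable.
  have ms : measurable_fun setT (fun y : V => \sum_i h ord0 i * g i y)%R.
    by apply: measurable_sum => i; exact: measurable_funM.
  apply: le_trans (le_abse_integral _ _ _) _ => //.
    by apply/measurable_EFinP; exact: measurable_funM.
  rewrite /conv -ge0_integralZl_EFin ?enorm_ge0//; last 2 first.
    by move=> y _; rewrite lee_fin mulr_ge0 ?enorm_ge0 ?(mollifier_ge0 rhoP).
    by apply/measurable_EFinP; exact: measurable_funM.
  apply: ge0_le_integral => //.
  - by apply/measurableT_comp => //; apply/measurable_EFinP; exact: measurable_funM.
  - by apply: measurable_funeM; apply/measurable_EFinP; exact: measurable_funM.
  move=> y _; rewrite /= -EFinM lee_fin normrM (ger0_norm (mollifier_ge0 rhoP _)) mulrA.
  rewrite ler_wpM2r ?(mollifier_ge0 rhoP)//.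
  apply: le_trans (ler_norm_sum _ _ _) _.
  apply: le_trans (enorm_dot _ _); apply: ler_sum => i _.
  by rewrite mxE normrM.
have IE : (mollified (x + h)%R - mollified x)%:E = \int[lambda]_t \int[mu]_y F (t, y).
  rewrite (Fubini iF) EFinB !fineK; last 2 first.
  - exact: integrable_fin_num (integrable_mollified _).
  - exact: integrable_fin_num (integrable_mollified _).
  rewrite -integralB_EFin//; [|exact: integrable_mollified..].
  apply: eq_integral => y _.
  have -> : (fun t => F (t, y)) = (fun t => (u y * ddir D h (z t - y)%R)%:E) \_ A.
    apply/funext => t; rewrite patchE /F/= indicE.
    by case: (t \in A); rewrite ?mulr1 ?mulr0.
  rewrite -integral_mkcond integral_itv_obnd_cbnd; last first.
    apply: measurable_funTS; apply/measurable_EFinP; apply: measurable_funM => //.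
    exact: (measurableT_comp (smooth_measurable sdd) (measurableT_comp mz (pair2_measurable y))).
  have FTC := mollifier_FTC sD rhoD (x - y)%R h.
  under eq_integral do rewrite EFinM.
  rewrite integralZl//; last first.
    apply: measurable_bounded_integrable => //.
    - have lA : lambda `[0%R, 1%R]%classic < +oo.
        by rewrite lebesgue_measure_itv/= lte_fin ltr01 sube0 ltry.
      exact: lA.
    - apply: measurable_funTS.
      exact: (measurableT_comp (smooth_measurable sdd) (measurableT_comp mz (pair2_measurable y))).
    - exists M; split; first exact: num_real.
      by move=> K MK t _ /=; rewrite (le_trans (dM _))// ltW.
  under eq_integral do rewrite /z addrAC.
  by rewrite FTC addrAC -EFinB -EFinM mulrBr.
have GA (t : R) : `|\int[mu]_y F (t, y)| <=
    ((fun t => (enorm h)%:E * conv tau gnorm_row rho (z t)) \_ A) t.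
  rewrite patchE; case: ifPn => [/set_mem At|/negbTE nAt].
    rewrite (eq_integral (fun y => (u y * ddir D h (z t - y)%R)%:E)).
      by rewrite Gint// Gle.
    by move=> y _; rewrite /F/= indicE mem_set// mulr1.
  rewrite (eq_integral (cst 0)) ?integral0 ?abse0// => y _.
  by rewrite /F/= indicE nAt mulr0.
rewrite -[leLHS]/(`|(mollified (x + h)%R - mollified x)%:E|) IE.
have mG : measurable_fun setT (fun t : measurableTypeR R => \int[mu]_y F (t, y)).
  exact: (measurable_fubini_F iF).
apply: le_trans (le_abse_integral _ _ mG) _ => //.
rewrite [leRHS]integral_mkcond; apply: ge0_le_integral => //.
- exact: measurableT_comp.
- apply/(measurable_restrictT _ mA); apply: measurable_funTS; apply: measurable_funeM.
  apply: (measurableT_comp (measurable_conv tau rhoP mgn (fun y => enorm_ge0 _))).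
  by apply: measurable_rVD => //; exact: measurable_rVZ.
Qed.

End mollified_increment.

(** * From increments to segment masses *)

Section mollified_weak_type.
Context (R : realType) (N : nat).
Local Notation V := 'rV[R]_N.
Local Notation lambda := (@lebesgue_measure R).
Variable mu : {sigma_finite_measure set V -> \bar R}.
Variable tau : {sigma_finite_measure set V -> \bar R}.
Variables (r : R) (rho : V -> R).
Hypothesis rhoP : mollifier mu r rho.
Variables (p : R) (p1 : (1 <= p)%R).
Hypothesis tau_rho : p = 1%R \/ forall z, \int[tau]_y (rho (z - y)%R)%:E <= 1.

(** The tangent inequality is integrated against [rho (z - y)]. Its constant term acquires the
    factor [\int rho d tau]: this is at most 1 by hypothesis, or is multiplied by [p - 1 = 0]. *)
Lemma conv_young (m : R) (w : V -> R) z : (0 < m)%R ->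
  measurable_fun setT w -> (forall y, 0 <= w y)%R ->
  (p * m `^ (p - 1))%:E * conv tau w rho z <=
  conv tau (fun y => w y `^ p)%R rho z + ((p - 1) * m `^ p)%:E.
Proof.
move=> m0 mw w0; have rho0 := mollifier_ge0 rhoP.
have mK : measurable_fun setT (fun y : V => rho (z - y)%R).
  by apply: smooth_measurable; exact: smooth_reflect (mollifier_smooth rhoP).
have mwp : measurable_fun setT (fun y : V => w y `^ p)%R.
  exact: (measurableT_comp (measurable_powR _)).
have p10 : (0 <= p - 1)%R by rewrite subr_ge0.
have pm0 : (0 <= p * m `^ (p - 1))%R by rewrite mulr_ge0 ?powR_ge0// (le_trans ler01).
have pm1 : (0 <= (p - 1) * m `^ p)%R by rewrite mulr_ge0 ?powR_ge0.
apply: (@le_trans _ _ (conv tau (fun y => w y `^ p)%R rho z +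
    ((p - 1) * m `^ p)%:E * \int[tau]_y (rho (z - y)%R)%:E)); last first.
  rewrite leeD2l//; case: tau_rho => [->|taur]; first by rewrite subrr mul0r mul0e.
  by rewrite -[leRHS]mule1 lee_wpmul2l// lee_fin.
rewrite /conv -!ge0_integralZl_EFin//; last 4 first.
- by move=> y _; rewrite lee_fin.
- exact/measurable_EFinP.
- by move=> y _; rewrite lee_fin mulr_ge0.
- by apply/measurable_EFinP; exact: measurable_funM.
rewrite -ge0_integralD//; last 4 first.
- by move=> y _; rewrite lee_fin mulr_ge0 ?powR_ge0.
- by apply/measurable_EFinP; exact: measurable_funM.
- by move=> y _; rewrite -EFinM lee_fin mulr_ge0.
- by apply: measurable_funeM; exact/measurable_EFinP.
apply: ge0_le_integral => //.
- by move=> y _; rewrite -EFinM lee_fin !mulr_ge0 ?powR_ge0// (le_trans ler01).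
- by apply: measurable_funeM; apply/measurable_EFinP; exact: measurable_funM.
- apply: emeasurable_funD; first by apply/measurable_EFinP; exact: measurable_funM.
  by apply: measurable_funeM; exact/measurable_EFinP.
move=> y _; rewrite -!EFinM -EFinD lee_fin mulrA -mulrDl ler_wpM2r//.
exact: young_tangent.
Qed.

(** With [m = l * |h|^(g/p)], a quotient above [l] forces the mean over the segment of the mollified
    [w] above [m]. The tangent inequality at this very [m] puts the mean of the mollified [w^p]
    above [m^p = l^p * |h|^g]. *)
Lemma bad_segment_increment (w : V -> R) (v : V -> R) (l g : R) (x h : V) :
  measurable_fun setT w -> (forall y, 0 <= w y)%R -> (0 < l)%R -> h != 0%R ->
  `|v (x + h)%R - v x|%:E <=
    \int[lambda]_(t in `]0%R, 1%R]%classic) ((enorm h)%:E * conv tau w rho (x + t *: h)%R) ->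
  (l < `|v (x + h) - v x| / enorm h `^ (1 + g / p))%R ->
  bad_segment g (fun z => (l `^ (- p))%:E * conv tau (fun y => w y `^ p)%R rho z) x h.
Proof.
move=> mw w0 l0 h0 vle lv; rewrite /bad_segment h0/=.
have e0 : (0 < enorm h)%R by rewrite enorm_gt0.
have p0 : (0 < p)%R by rewrite (lt_le_trans ltr01).
pose m := (l * enorm h `^ (g / p))%R.
have m0 : (0 < m)%R by rewrite mulr_gt0 ?powR_gt0.
have mwp : measurable_fun setT (fun y : V => w y `^ p)%R.
  exact: (measurableT_comp (measurable_powR _)).
have mline : measurable_fun setT (fun t : R => x + t *: h)%R.
  by apply: measurable_rVD => //; exact: measurable_rVZ.
have wp0 y : (0 <= w y `^ p)%R by exact: powR_ge0.
pose a t := conv tau w rho (x + t *: h)%R.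
pose b t := conv tau (fun y => w y `^ p)%R rho (x + t *: h)%R.
have ma : measurable_fun setT a by exact: (measurableT_comp (measurable_conv tau rhoP mw w0)).
have mb : measurable_fun setT b by exact: (measurableT_comp (measurable_conv tau rhoP mwp wp0)).
have a0 t : 0 <= a t by exact: (conv_ge0 _ rhoP).
have b0 t : 0 <= b t by exact: (conv_ge0 _ rhoP).
pose A : set R := `]0%R, 1%R]%classic.
have mA : measurable A by exact: measurable_itv.
have lA : lambda A = 1 by rewrite lebesgue_measure_itv/= lte_fin ltr01 sube0.
have mI : m%:E < \int[lambda]_(t in A) a t.
  have eI : (enorm h)%:E * m%:E < (enorm h)%:E * \int[lambda]_(t in A) a t.
    rewrite -ge0_integralZl_EFin//; [|exact: measurable_funTS|exact: ltW].
    apply: lt_le_trans vle; rewrite -EFinM lte_fin.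
    move: lv; rewrite ltr_pdivlMr ?powR_gt0// powRD; last by rewrite (gt_eqF e0) implybT.
    by rewrite powRr1 ?(ltW e0)// /m; congr (_ < _)%R; ring.
  by rewrite lte_pmul2l in eI.
have key : (p * m `^ (p - 1))%:E * \int[lambda]_(t in A) a t <=
    \int[lambda]_(t in A) b t + ((p - 1) * m `^ p)%:E.
  have pm0 : (0 <= p * m `^ (p - 1))%R by rewrite mulr_ge0 ?powR_ge0// ltW.
  rewrite -ge0_integralZl_EFin//; last exact: measurable_funTS.
  have -> : ((p - 1) * m `^ p)%:E = \int[lambda]_(t in A) (cst ((p - 1) * m `^ p)%:E t).
    by rewrite integral_cst// [X in _ * X]lA mule1.
  have pm1 : 0 <= ((p - 1) * m `^ p)%:E by rewrite lee_fin mulr_ge0 ?powR_ge0// subr_ge0.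
  rewrite -ge0_integralD//; last exact: measurable_funTS.
  apply: ge0_le_integral => //.
  - by move=> t _; rewrite mule_ge0.
  - by apply: measurable_funeM; exact: measurable_funTS.
  - by apply: emeasurable_funD => //; exact: measurable_funTS.
  - by move=> t _; exact: conv_young.
(* The left side exceeds [p * m^p]; removing [(p - 1) * m^p] leaves exactly [m^p]. *)
have mJ : (m `^ p)%:E < \int[lambda]_(t in A) b t.
  have : (p * m `^ (p - 1))%:E * m%:E < \int[lambda]_(t in A) b t + ((p - 1) * m `^ p)%:E.
    by apply: lt_le_trans key; rewrite lte_pmul2l// lte_fin mulr_gt0 ?powR_gt0.
  rewrite -EFinM -mulrA (mulrC _ m) (mulr_powRB1 (ltW m0) p0).
  case: (\int[lambda]_(t in A) b t) => [j||//] H; last by rewrite ltry.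
  by move: H; rewrite -EFinD !lte_fin; lra.
rewrite /segment_mass /mass add0r ge0_integralZl_EFin ?powR_ge0//; last 2 first.
- by move=> t _; exact: b0.
- exact: measurable_funTS.
have -> : (enorm h `^ g)%:E = (l `^ (- p))%:E * (m `^ p)%:E.
  rewrite -EFinM /m powRM ?powR_ge0 ?(ltW l0)// -powRrM divfK ?gt_eqF//.
  rewrite mulrA -powRD; last by rewrite (gt_eqF l0) implybT.
  by rewrite addNr powRr0 mul1r.
by rewrite lte_pmul2l// lte_fin powR_gt0.
Qed.

End mollified_weak_type.

(** * Almost everywhere convergence of mollifications *)

Section mollifier_defect.
Context (R : realType) (N : nat).
Local Notation V := 'rV[R]_N.
Variable mu : {sigma_finite_measure set V -> \bar R}.
Hypothesis mu_leb : is_lebesgue_borel mu.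

Lemma mollifier_int_reflect r rho (z : V) : mollifier mu r rho ->
  \int[mu]_y (rho (z - y)%R)%:E = 1.
Proof.
move=> rhoP; rewrite -(mollifier_int rhoP).
have mrE : measurable_fun setT (fun z : V => (rho z)%:E).
  by apply/measurable_EFinP; exact: smooth_measurable (mollifier_smooth rhoP).
rewrite -(ge0_integral_shift mu_leb (- z)%R mrE); last first.
  by move=> y; rewrite lee_fin (mollifier_ge0 rhoP).
by apply: eq_integral => y _; rewrite -(mollifier_even rhoP) opprB.
Qed.

(** It dominates the L^1 distance between [f] and its mollification. With the absolute value inside,
    it is subadditive in [f] and needs no integrability to make sense. *)
Definition defect (rho : V -> R) (f : V -> R) : \bar R :=
  \int[mu]_x \int[mu]_y (rho (x - y)%R * `|f y - f x|)%:E.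

Section one_mollifier.
Variables (r : R) (rho : V -> R).
Hypothesis rhoP : mollifier mu r rho.

Let mrho := smooth_measurable (mollifier_smooth rhoP).
Let rho0 := mollifier_ge0 rhoP.

Lemma measurable_defect_kernel (f : V -> R) : measurable_fun setT f ->
  measurable_fun setT (fun z : V * V => (rho (z.1 - z.2)%R * `|f z.2 - f z.1|)%:E).
Proof.
move=> mf; apply/measurable_EFinP; apply: measurable_funM.
  by apply: (measurableT_comp mrho); apply: measurable_rVD => //; exact: measurable_rVN.
apply: measurableT_comp => //.
by apply: measurable_funB; exact: measurableT_comp.
Qed.

Lemma defect_kernel_ge0 (f : V -> R) (x y : V) : 0 <= (rho (x - y)%R * `|f y - f x|)%:E.
Proof. by rewrite lee_fin mulr_ge0. Qed.

Lemma measurable_defect_section (f : V -> R) : measurable_fun setT f ->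
  measurable_fun setT (fun x : V => \int[mu]_y (rho (x - y)%R * `|f y - f x|)%:E).
Proof.
move=> mf; apply: (@measurable_fun_fubini_tonelli_F _ _ _ _ _ mu _
  (measurable_defect_kernel mf)) => -[x y].
exact: defect_kernel_ge0.
Qed.

Lemma measurable_defect_kernel1 (f : V -> R) (x : V) : measurable_fun setT f ->
  measurable_fun setT (fun y : V => (rho (x - y)%R * `|f y - f x|)%:E).
Proof.
by move=> mf; exact: (measurableT_comp (measurable_defect_kernel mf) (pair1_measurable x)).
Qed.

Lemma defect_triangle (f g k : V -> R) : measurable_fun setT f ->
  measurable_fun setT g -> measurable_fun setT k ->
  (forall x y, `|f y - f x| <= `|g y - g x| + `|k y - k x|)%R ->
  defect rho f <= defect rho g + defect rho k.
Proof.
move=> mf mg mk fgk; rewrite /defect -ge0_integralD//; last 4 first.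
- by move=> x _; apply: integral_ge0 => y _; exact: defect_kernel_ge0.
- exact: measurable_defect_section.
- by move=> x _; apply: integral_ge0 => y _; exact: defect_kernel_ge0.
- exact: measurable_defect_section.
apply: ge0_le_integral => //.
- by move=> x _; apply: integral_ge0 => y _; exact: defect_kernel_ge0.
- exact: measurable_defect_section.
- by apply: emeasurable_funD; exact: measurable_defect_section.
move=> x _; rewrite -ge0_integralD//; last 4 first.
- by move=> y _; exact: defect_kernel_ge0.
- exact: measurable_defect_kernel1.
- by move=> y _; exact: defect_kernel_ge0.
- exact: measurable_defect_kernel1.
apply: ge0_le_integral => //.
- by move=> y _; exact: defect_kernel_ge0.
- exact: measurable_defect_kernel1.
- by apply: emeasurable_funD; exact: measurable_defect_kernel1.
by move=> y _; rewrite -EFinD lee_fin -mulrDr ler_wpM2l.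
Qed.

Lemma defect_le_norm (f : V -> R) : measurable_fun setT f ->
  defect rho f <= 2%:E * \int[mu]_x (`|f x|)%:E.
Proof.
move=> mf; have maf : measurable_fun setT (fun x => `|f x|)%R by exact: measurableT_comp.
have mrx (x : V) : measurable_fun setT (fun y : V => rho (x - y)%R).
  by apply: (measurableT_comp mrho); apply: measurable_rVD => //; exact: measurable_rVN.
have -> : 2%:E * \int[mu]_x (`|f x|)%:E =
    \int[mu]_x conv mu (fun y => `|f y|)%R rho x + \int[mu]_x (`|f x|)%:E.
  rewrite (integral_conv mu_leb mu rhoP)//.
  by rewrite (_ : 2%:E = 1%:E + 1%:E)// ge0_muleDl ?lee_fin// mul1e.
rewrite /defect -ge0_integralD//; last 3 first.
- by move=> x _; exact: (conv_ge0 _ rhoP).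
- exact: (measurable_conv _ rhoP).
- exact/measurable_EFinP.
apply: ge0_le_integral => //.
- by move=> x _; apply: integral_ge0 => y _; exact: defect_kernel_ge0.
- exact: measurable_defect_section.
- apply: emeasurable_funD; first exact: (measurable_conv _ rhoP).
  exact/measurable_EFinP.
move=> x _.
have -> : (`|f x|)%:E = \int[mu]_y ((`|f x|)%:E * (rho (x - y)%R)%:E).
  rewrite ge0_integralZl_EFin// ?(mollifier_int_reflect _ rhoP) ?mule1//.
  - by move=> y _; rewrite lee_fin.
  - exact/measurable_EFinP.
rewrite /conv -ge0_integralD//; last 4 first.
- by move=> y _; rewrite lee_fin mulr_ge0.
- by apply/measurable_EFinP; exact: measurable_funM.
- by move=> y _; rewrite -EFinM lee_fin mulr_ge0.
- by apply: measurable_funeM; exact/measurable_EFinP.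
apply: ge0_le_integral => //.
- by move=> y _; exact: defect_kernel_ge0.
- exact: measurable_defect_kernel1.
- apply: emeasurable_funD; first by apply/measurable_EFinP; exact: measurable_funM.
  by apply: measurable_funeM; exact/measurable_EFinP.
move=> y _; rewrite -EFinM -EFinD lee_fin -mulrDl [leRHS]mulrC ler_wpM2l//.
exact: ler_normB.
Qed.

(** Unless [x] lies in the outer box but not in the inner one, the indicator is constant on the
    support of [rho (x - y)]; otherwise the inner integral is at most 1. Sides longer than [2 * r]
    keep the inner box nondegenerate, so its volume is the product. *)
Lemma defect_rbox (a b : V) : (forall i, 2 * r < b ord0 i - a ord0 i)%R -> (0 < r)%R ->
  defect rho \1_(rbox a b) <=
  (\prod_i (b ord0 i - a ord0 i + 2 * r) - \prod_i (b ord0 i - a ord0 i - 2 * r))%:E.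
Proof.
move=> abr r0.
pose I : set V := rbox (a + const_mx r)%R (b - const_mx r)%R.
pose O : set V := rbox (a - const_mx r)%R (b + const_mx r)%R.
have mI : measurable I by exact: measurable_rbox.
have mO : measurable O by exact: measurable_rbox.
have IO : I `<=` O.
  by move=> x xI i; have := xI i; rewrite !mxE => /andP[? ?]; apply/andP; split; lra.
have muI : mu I = (\prod_i (b ord0 i - a ord0 i - 2 * r))%:E.
  rewrite mu_leb => [|i]; last by rewrite !mxE; have := abr i; lra.
  by congr EFin; apply: eq_bigr => i _; rewrite !mxE; ring.
have muO : mu O = (\prod_i (b ord0 i - a ord0 i + 2 * r))%:E.
  rewrite mu_leb => [|i]; last by rewrite !mxE; have := abr i; lra.
  by congr EFin; apply: eq_bigr => i _; rewrite !mxE; ring.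
rewrite EFinB -muI -muO.
have muOoo : mu O < +oo by rewrite muO ltry.
have <- : mu (O `\` I) = mu O - mu I.
  by rewrite measureD; [rewrite setIidr|..].
have mD : measurable (O `\` I) by exact: measurableD.
have -> : mu (O `\` I) = \int[mu]_x (\1_(O `\` I) x)%:E by rewrite integral_indic// setIT.
have mf : measurable_fun setT (\1_(rbox a b) : V -> R).
  by apply: measurable_indic; exact: measurable_rbox.
apply: ge0_le_integral => //.
- by move=> x _; apply: integral_ge0 => y _; exact: defect_kernel_ge0.
- exact: measurable_defect_section.
- by apply/measurable_EFinP; exact: measurable_indic.
move=> x _; rewrite [in leRHS]indicE; case: (boolP (x \in O `\` I)) => [_|].
  rewrite -[leRHS](mollifier_int_reflect x rhoP); apply: ge0_le_integral => //.
  - by move=> y _; exact: defect_kernel_ge0.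
  - exact: measurable_defect_kernel1.
  - apply/measurable_EFinP; apply: (measurableT_comp mrho); apply: measurable_rVD => //.
    exact: measurable_rVN.
  move=> y _; rewrite lee_fin -[leRHS]mulr1 ler_wpM2l// !indicE.
  by case: (_ \in _); case: (_ \in _); rewrite ?subrr ?normr0// ?subr0 ?sub0r ?normrN ?normr1.
rewrite notin_setE => nD; rewrite (eq_integral (cst 0)) ?integral0// => y _ /=.
have [->|/(mollifier_supp rhoP) xy] := eqVneq (rho (x - y)%R) 0%R; first by rewrite mul0r.
have {}xy i : (- r < x ord0 i - y ord0 i < r)%R by have := xy i; rewrite !mxE ltr_norml.
suff -> : (\1_(rbox a b) y : R) = \1_(rbox a b) x by rewrite subrr normr0 mulr0.
rewrite !indicE; congr ((_ : bool)%:R).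
have [Ix|nIx] := pselect (I x).
  rewrite !mem_set// => i; have := Ix i; have := xy i; rewrite !mxE => /andP[? ?] /andP[? ?];
    by apply/andP; split; lra.
have nOx : ~ O x by move=> Ox; exact: nD.
rewrite !memNset// => xab; apply: nOx => i; have := xab i; have := xy i; rewrite !mxE;
  by move=> /andP[? ?] /andP[? ?]; apply/andP; split; lra.
Qed.

End one_mollifier.

Section mollifier_sequence.
Variables (r : nat -> R) (rho : nat -> V -> R).
Hypotheses (r_gt0 : forall n, (0 < r n)%R) (r0 : r n @[n --> \oo] --> (0 : R)%R).
Hypothesis rhoP : forall n, mollifier mu (r n) (rho n).

Definition small_defect (f : V -> R) := forall e : R, (0 < e)%R ->
  \forall n \near \oo, defect (rho n) f <= e%:E.

Lemma small_defect_triangle (f g k : V -> R) : measurable_fun setT f ->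
  measurable_fun setT g -> measurable_fun setT k ->
  (forall x y, `|f y - f x| <= `|g y - g x| + `|k y - k x|)%R ->
  small_defect g -> small_defect k -> small_defect f.
Proof.
move=> mf mg mk fgk gs ks e e0.
have e2 : (0 < e / 2)%R by rewrite divr_gt0.
apply: filterS2 (gs _ e2) (ks _ e2) => n gn kn.
apply: (le_trans (defect_triangle (rhoP n) mf mg mk fgk)).
have -> : e%:E = (e / 2)%:E + (e / 2)%:E by rewrite -EFinD -splitr.
exact: (leeD gn kn).
Qed.

(** The defect of [f - g] is at most twice its L^1 norm, which explains [e / 4]; thus the property
    is closed under L^1 limits. *)
Lemma small_defect_approx (f : V -> R) : measurable_fun setT f ->
  (forall e : R, (0 < e)%R -> exists g, [/\ measurable_fun setT g, small_defect g &
    \int[mu]_x (`|f x - g x|)%:E <= e%:E]) -> small_defect f.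
Proof.
move=> mf fe e e0; have e4 : (0 < e / 4)%R by rewrite divr_gt0.
have [g [mg gs fg]] := fe _ e4.
have e2 : (0 < e / 2)%R by rewrite divr_gt0.
have mfg : measurable_fun setT (fun x => f x - g x)%R by exact: measurable_funB.
apply: filterS (gs _ e2) => n gn.
apply: (le_trans (@defect_triangle _ _ (rhoP n) f g (fun x => f x - g x)%R mf mg mfg _)).
  move=> x y; rewrite (_ : f y - f x = (g y - g x) + ((f y - g y) - (f x - g x)))%R ?ler_normD//.
  ring.
have -> : e%:E = (e / 2)%:E + (e / 2)%:E by rewrite -EFinD -splitr.
apply: (leeD gn).
apply: (le_trans (defect_le_norm (rhoP n) mfg)).
apply: (@le_trans _ _ (2%:E * (e / 4)%:E)); first by rewrite lee_wpmul2l// lee_fin.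
by rewrite -EFinM lee_fin; lra.
Qed.

Lemma small_defect_rbox (a b : V) : small_defect \1_(rbox a b).
Proof.
move=> e e0.
have [ab|/rbox_eq0 ->] := pselect (forall i, (a ord0 i < b ord0 i)%R); last first.
  near=> n; rewrite /defect integral0_eq ?lee_fin ?(ltW e0)// => x _.
  by rewrite integral0_eq// => y _; rewrite !indic0/= subrr normr0 mulr0.
(* Both volumes are values of one polynomial, at [2 * r n] and at its opposite, hence have the same
   limit. *)
pose q (s : R) := (\prod_i (b ord0 i - a ord0 i + s))%R.
have qc : continuous q.
  have -> : q = horner (\prod_i ((b ord0 i - a ord0 i)%:P + 'X))%R.
    by apply/funext => s; rewrite horner_prod; apply: eq_bigr => i _; rewrite !hornerE.
  exact: continuous_horner.
have rr : (2 * r n)%R @[n --> \oo] --> (0 : R)%R.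
  by rewrite -(mulr0 2%R); apply: cvgM => //; exact: cvg_cst.
have q0 : (fun n => q (2 * r n) - q (- (2 * r n)))%R @ \oo --> (0 : R)%R.
  rewrite -(subrr (q 0%R)); apply: cvgB.
    by apply: (cvg_comp _ _ rr); exact: qc.
  rewrite -[in X in _ --> X]oppr0; apply: (cvg_comp _ _ (cvgN rr)); exact: qc.
have rab : \forall n \near \oo, forall i, (2 * r n < b ord0 i - a ord0 i)%R.
  by apply: filter_forall => i; apply: (cvgr_lt _ rr); rewrite subr_gt0.
near=> n; apply: (@le_trans _ _ (q (2 * r n) - q (- (2 * r n)))%:E)%R.
  apply: (defect_rbox (rhoP n)) => // i.
  by move: i; near: n.
rewrite lee_fin ltW//; near: n; exact: (cvgr_lt _ q0).
Unshelve. all: end_near. Qed.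

Lemma cvge0_lt (F : nat -> \bar R) (e : R) : F @ \oo --> 0 -> (0 < e)%R ->
  \forall n \near \oo, F n < e%:E.
Proof.
move=> /fine_cvgP[Ffin /cvgr_lt F0] e0.
by apply: filterS2 Ffin (F0 _ e0) => n Fn; rewrite /= -lte_fin fineK.
Qed.

(** A pi-lambda argument starting from boxes. Cutting by a cube keeps measures finite, so that
    increasing unions converge in L^1. *)
Lemma small_defect_indic (k : R) (A : set V) : measurable A ->
  small_defect \1_(A `&` cube N k).
Proof.
pose H : set (set V) := [set A | measurable A /\ small_defect \1_(A `&` cube N k)].
have mQ : measurable (cube N k) by exact: measurable_rbox.
have m1 (B : set V) : measurable B -> measurable_fun setT (\1_(B `&` cube N k) : V -> R).
  by move=> mB; apply: measurable_indic; exact: measurableI.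
suff : <<s @rboxes R N >> `<=` H by rewrite rboxes_gen => + mA => /(_ _ mA)[].
apply: lambda_system_subset => //.
- by move=> _ _ [a [b ->]] [c [d ->]]; rewrite rboxI; eexists; eexists.
- split=> [//|||].
  + by split=> //; rewrite setTI; exact: small_defect_rbox.
  + move=> B C CB [mB sB] [mC sC]; split; first exact: measurableD.
    apply: (small_defect_triangle (m1 _ (measurableD mB mC)) (m1 _ mB) (m1 _ mC) _ sB sC).
    have DE (x : V) : \1_((B `\` C) `&` cube N k) x =
        (\1_(B `&` cube N k) x - \1_(C `&` cube N k) x)%R :> R.
      rewrite !indicE in_setI classical_sets.in_setD !in_setI.
      case: (boolP (x \in C)) => [/set_mem xC|]; rewrite ?andbF ?andbT ?subr0//=.
      by rewrite (mem_set (CB _ xC)) subrr.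
    move=> x y; rewrite !DE (_ : _ - _ - (_ - _) =
      (\1_(B `&` cube N k) y - \1_(B `&` cube N k) x) -
      (\1_(C `&` cube N k) y - \1_(C `&` cube N k) x))%R ?ler_normB//.
    ring.
  + move=> F ndF HF.
    have mF n : measurable (F n) by have [] := HF n.
    have mU : measurable (\bigcup_n F n) by exact: bigcup_measurable.
    split=> //; apply: small_defect_approx => [|e e0]; first exact: m1.
    pose D n := (\bigcup_n F n `\` F n) `&` cube N k.
    have mD n : measurable (D n) by apply: measurableI => //; exact: measurableD.
    have D0 : \bigcap_n D n = set0.
      apply/seteqP; split=> // x Dx; have [[[n _ Fnx] _] _] := Dx 0%N I.
      by have [[_ nF] _] := Dx n I; exact: nF.
    have : mu \o D @ \oo --> mu (\bigcap_n D n).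
      apply: nonincreasing_cvg_mu => //.
      * apply: (@le_lt_trans _ _ (mu (cube N k))); last exact: lebesgue_cube_lty.
        by apply: le_measure; rewrite ?inE//; exact: subIsetr.
      * by rewrite D0.
      * move=> m n mn; apply/subsetPset; apply: setSI; apply: setDS.
        exact/subsetPset/ndF.
    rewrite D0 measure0 => /cvge0_lt /(_ e0)[n _ /(_ n (leqnn n)) /= Dn].
    have [_ sn] := HF n.
    exists \1_(F n `&` cube N k); split=> //; first exact: m1.
    rewrite (eq_integral (fun x => (\1_(D n) x)%:E)).
      by rewrite integral_indic// setIT ltW.
    move=> x _; congr EFin; rewrite /D !indicE [in RHS]in_setI classical_sets.in_setD !in_setI.
    have [xF|_] := boolP (x \in F n); last by rewrite /= andbT subr0 ger0_norm.
    have -> : x \in \bigcup_n F n by apply/mem_set; exists n => //; exact: set_mem.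
    by rewrite subrr normr0.
- by move=> _ [a [b ->]]; split; [exact: measurable_rbox|rewrite rboxI; exact: small_defect_rbox].
Qed.

Lemma small_defectZ (c : R) (f : V -> R) : measurable_fun setT f ->
  small_defect f -> small_defect (fun x => c * f x)%R.
Proof.
move=> mf sf e e0.
have c1 : (0 < `|c| + 1)%R by rewrite ltr_wpDl.
apply: filterS (sf _ (divr_gt0 e0 c1)) => n fn.
apply: (@le_trans _ _ ((`|c| + 1)%:E * defect (rho n) f)); last first.
  apply: (le_trans (lee_wpmul2l _ fn)); first by rewrite lee_fin ltW.
  by rewrite -EFinM lee_fin mulrC divfK// gt_eqF.
rewrite /defect -ge0_integralZl_EFin ?(ltW c1)//; last 2 first.
- by move=> x _; apply: integral_ge0 => y _; exact: (defect_kernel_ge0 (rhoP n)).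
- exact: (measurable_defect_section (rhoP n)).
have mcf : measurable_fun setT (fun x => c * f x)%R by exact: measurable_funM.
apply: ge0_le_integral => //.
- by move=> x _; apply: integral_ge0 => y _; exact: (defect_kernel_ge0 (rhoP n) (fun x => c * f x)%R).
- exact: (measurable_defect_section (rhoP n) mcf).
- by apply: measurable_funeM; exact: (measurable_defect_section (rhoP n)).
move=> x _; rewrite -ge0_integralZl_EFin ?(ltW c1)//; last 2 first.
- by move=> y _; exact: (defect_kernel_ge0 (rhoP n)).
- exact: (measurable_defect_kernel1 (rhoP n)).
apply: ge0_le_integral => //.
- by move=> y _; exact: (defect_kernel_ge0 (rhoP n) (fun x => c * f x)%R).
- exact: (measurable_defect_kernel1 (rhoP n) x mcf).
- by apply: measurable_funeM; exact: (measurable_defect_kernel1 (rhoP n)).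
move=> y _; rewrite -EFinM lee_fin -mulrBr normrM mulrCA.
by rewrite ler_wpM2r ?mulr_ge0 ?(mollifier_ge0 (rhoP n))// lerDl.
Qed.

Lemma small_defect_sum m (f : 'I_m -> V -> R) : (forall i, measurable_fun setT (f i)) ->
  (forall i, small_defect (f i)) -> small_defect (fun x => \sum_(i < m) f i x)%R.
Proof.
elim: m f => [|m IH] f mf sf.
  apply: (_ : small_defect (fun x => \sum_(i < 0) f i x)%R) => e e0.
  near=> n; rewrite /defect integral0_eq ?lee_fin ?(ltW e0)// => x _.
  by rewrite integral0_eq// => y _; rewrite !big_ord0 subrr normr0 mulr0.
have ms : measurable_fun setT (fun x => \sum_(i < m) f (lift ord0 i) x)%R.
  by apply: measurable_sum => i.
apply: (small_defect_triangle _ (mf ord0) ms _ (sf ord0) (IH _ _ _)) => // [|x y].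
  by apply: measurable_sum => i.
rewrite !big_ord_recl opprD addrACA ler_normD//.
Unshelve. all: end_near. Qed.

Import HBSimple.

Lemma small_defect_integrable (k : R) (f : V -> R) : measurable_fun setT f ->
  mu.-integrable (cube N k) (EFin \o f) -> small_defect (fun x => f x * \1_(cube N k) x)%R.
Proof.
move=> mf fk; have mQ : measurable (cube N k) by exact: measurable_rbox.
have m1Q : measurable_fun setT (\1_(cube N k) : V -> R) by exact: measurable_indic.
apply: small_defect_approx => [|e e0]; first exact: measurable_funM.
have [g_ [_ _ /cvge0_lt /(_ e0)[n _ /(_ n (leqnn n)) /= gn]]] :=
  approximation_sfun_integrable mQ fk.
pose g := g_ n.
exists (fun x => g x * \1_(cube N k) x)%R; split.
- by apply: measurable_funM => //; exact: measurable_funPT.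
- pose s : seq R := finmap.enum_fset (fset_set (g @` setT)).
  rewrite (_ : (fun x => _) = fun x => (\sum_(i < size s) s`_i *
      \1_(g @^-1` [set s`_i] `&` cube N k) x)%R); last first.
    apply/funext => x; rewrite [g x]fimfunEord mulr_suml; apply: eq_bigr => i _.
    by rewrite indicI/= mulrA.
  apply: small_defect_sum => i.
    apply: measurable_funM => //; apply: measurable_indic; apply: measurableI => //.
  apply: small_defectZ; last exact: small_defect_indic.
  by apply: measurable_indic; exact: measurableI.
- rewrite (eq_integral (fun x => ((fun x => `|(f x)%:E - (g x)%:E|) \_ (cube N k)) x)).
    by rewrite -integral_mkcond ltW.
  move=> x _; rewrite patchE indicE; case: ifPn => xQ.
    by rewrite !mulr1.
  by rewrite !mulr0 subrr normr0.
Qed.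

End mollifier_sequence.
End mollifier_defect.

(** * Mollifications that converge almost everywhere *)

Section mollified_ae_cvg.
Context (R : realType) (N : nat).
Local Notation V := 'rV[R]_N.
Variable mu : {sigma_finite_measure set V -> \bar R}.
Hypothesis mu_leb : is_lebesgue_borel mu.
Variable u : V -> R.
Hypotheses (mu_u : measurable_fun setT u)
  (uK : forall k : R, mu.-integrable (cube N k) (EFin \o u)).

Let uQ (n : nat) (x : V) : R := (u x * \1_(cube N n%:R) x)%R.

Let muQ n : measurable_fun setT (uQ n).
Proof. by apply: measurable_funM => //; apply: measurable_indic; exact: measurable_rbox. Qed.

(** Defects are made summable. As [u] is only locally integrable, the [n]-th mollifier is adapted to
    [u] cut off to the [n]-th cube; radii at most 1 hide the cut-off from any fixed point for large
    [n]. *)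
Let fast_mollifiers : exists rho : nat -> V -> R, forall n : nat,
  (exists2 r, 0 < r <= 1 & mollifier mu r (rho n))%R /\
  defect mu (rho n) (uQ n) <= (1 / (2 ^ n.+1)%:R)%:E.
Proof.
pose r n : R := (n.+1%:R^-1)%R.
have rgt0 n : (0 < r n)%R by rewrite invr_gt0.
have [rho rhoP] := choice (fun n => exists_mollifier mu_leb (rgt0 n)).
have r0 : r n @[n --> \oo] --> (0 : R)%R by exact: cvg_harmonic.
suff H (n : nat) : exists m, defect mu (rho m) (uQ n) <= (1 / (2 ^ n.+1)%:R)%:E.
  have [m mP] := choice H.
  exists (fun n => rho (m n)) => n; split=> //; exists (r (m n)) => //.
  by rewrite rgt0/= invf_le1// ler1n.
have e0 : (0 < 1 / (2 ^ n.+1)%:R :> R)%R by rewrite divr_gt0// ltr0n expn_gt0.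
have [m _ /(_ m (leqnn m)) /= Hm] :=
  small_defect_integrable mu_leb rgt0 r0 rhoP mu_u (uK n%:R) e0.
by exists m.
Qed.

(** The series of inner defect integrals is integrable, hence finite off a null set. There its terms
    tend to 0, and they dominate the error at [x] once the cube contains [x] with a margin of 1. *)
Lemma mollified_ae_cvg : exists rho : nat -> V -> R,
  (forall n, exists r, mollifier mu r (rho n)) /\
  exists M, [/\ measurable M, mu M = 0 &
    forall x, ~ M x -> mollified mu u (rho n) x @[n --> \oo] --> u x].
Proof.
have [rho rhoP] := fast_mollifiers; exists rho.
have molP n : exists r, mollifier mu r (rho n) by have [[r _ ?] _] := rhoP n; exists r.
split=> //.
pose t (n : nat) (x : V) : \bar R :=
  \int[mu]_y (rho n (x - y)%R * `|uQ n y - uQ n x|)%:E.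
have t0 n x : 0 <= t n x.
  apply: integral_ge0 => y _; have [r rP] := molP n.
  by rewrite lee_fin mulr_ge0// (mollifier_ge0 rP).
have mt n : measurable_fun setT (t n).
  by have [r rP] := molP n; exact: (measurable_defect_section rP).
have Soo : \int[mu]_x \sum_(n <oo) t n x < +oo.
  rewrite integral_nneseries//.
  apply: (@le_lt_trans _ _ (\sum_(n <oo) (1 / (2 ^ n.+1)%:R)%:E)).
    apply: lee_nneseries => [n _|n _]; first by rewrite integral_ge0.
    by have [] := rhoP n.
  by apply: le_lt_trans (epsilon_trick0 xpredT ler01) _; rewrite ltry.
have mS : measurable_fun setT (fun x => \sum_(n <oo) t n x).
  by apply: ge0_emeasurable_sum.
have S0 x : 0 <= \sum_(n <oo) t n x by exact: nneseries_ge0.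
have iS : mu.-integrable setT (fun x => \sum_(n <oo) t n x).
  by apply/integrableP; split=> //; under eq_integral do rewrite gee0_abs//.
have [M [mM M0 SM]] := integrable_ae measurableT iS.
exists M; split=> // x nMx.
have Sx : \sum_(n <oo) t n x < +oo.
  rewrite -ge0_fin_numE//; apply: contrapT => nS; apply: nMx; apply: SM => /= H.
  exact/nS/H.
have tl := nneseries_tail_cvg Sx (fun k _ => t0 k x).
apply/cvgrPdist_lt => e e0; near=> n.
have tn : t n x < e%:E.
  apply: (@le_lt_trans _ _ (\sum_(n <= k <oo) t k x)).
    have := @nneseries_lim_ge _ (t ^~ x) xpredT n n.+1 (fun k _ _ => t0 k x).
    by rewrite big_nat1.
  by near: n; exact: cvge0_lt tl e0.
have [[r /andP[r0 r1] rP] _] := rhoP n.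
rewrite -lte_fin; apply: le_lt_trans tn.
have xn : forall i, (`|x ord0 i| + 1 < n%:R)%R.
  by near: n; apply: filter_forall => i; exact: nbhs_infty_gtr.
have rho0 := mollifier_ge0 rP.
have mrx : measurable_fun setT (fun y : V => rho n (x - y)%R).
  by apply: smooth_measurable; exact: smooth_reflect (mollifier_smooth rP).
have irho : mu.-integrable setT (fun y : V => (rho n (x - y)%R)%:E).
  apply/integrableP; split; first exact/measurable_EFinP.
  under eq_integral do rewrite gee0_abs ?lee_fin//.
  by rewrite (mollifier_int_reflect mu_leb x rP) ltry.
have iu := integrable_mollified mu_u uK rP x.
have -> : (`|u x - mollified mu u (rho n) x|)%:E =
    `|\int[mu]_y ((u x * rho n (x - y)%R)%:E - (u y * rho n (x - y)%R)%:E)|.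
  rewrite integralB_EFin//; last first.
    exact: (integrableZl measurableT (u x) irho).
  under eq_integral do rewrite EFinM.
  rewrite integralZl// (mollifier_int_reflect mu_leb x rP) mule1.
  by rewrite -[X in _ - X]fineK//; exact: integrable_fin_num.
have mI : measurable_fun setT (fun y : V => (u x * rho n (x - y)%R)%:E - (u y * rho n (x - y)%R)%:E).
  apply: emeasurable_funB; apply/measurable_EFinP; exact: measurable_funM.
apply: (le_trans (le_abse_integral _ _ mI)) => //.
apply: ge0_le_integral => //.
- exact: measurableT_comp.
- exact: (measurable_defect_kernel1 rP).
move=> y _; rewrite -EFinB -mulrBl lee_fin normrM (ger0_norm (rho0 _)) mulrC.
have [->|/(mollifier_supp rP) xy] := eqVneq (rho n (x - y)%R) 0%R; first by rewrite !mul0r.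
have Qx : cube N n%:R x.
  by apply/cubeP => i; have := xn i; rewrite -ltrBrDr ltr_norml => /andP[? ?]; apply/andP; split; lra.
have Qy : cube N n%:R y.
  apply/cubeP => i; have := xy i; rewrite !mxE ltr_norml => /andP[? ?].
  by have := xn i; rewrite -ltrBrDr ltr_norml => /andP[? ?]; apply/andP; split; lra.
by rewrite /uQ !indicE !mem_set// !mulr1 distrC.
Unshelve. all: end_near. Qed.

End mollified_ae_cvg.

(** * Passage to the limit *)

Section limn_einf_bounds.
Context (R : realType).
Implicit Types (a : nat -> \bar R) (c : \bar R).

Lemma limn_einf_le a c : (forall n, a n <= c) -> limn_einf a <= c.
Proof.
move=> ac; rewrite limn_einf_lim; apply: lime_le; first exact: is_cvg_einfs.
near=> n; apply: le_trans (ac n).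
by apply: ereal_inf_lbound; exists n => /=.
Unshelve. all: end_near. Qed.

Lemma limn_einf_ge a c : (\forall n \near \oo, c <= a n) -> c <= limn_einf a.
Proof.
move=> [m _ ca]; rewrite limn_einf_lim; apply: lime_ge; first exact: is_cvg_einfs.
exists m => // n /= mn; apply: le_ereal_inf_tmp => _ [k /= nk <-].
by apply: ca => /=; exact: leq_trans nk.
Qed.

End limn_einf_bounds.

(** * The estimate at a fixed level *)

Section weak_type_core.
Context (R : realType) (N : nat).
Local Notation V := 'rV[R]_N.
Local Notation lambda := (@lebesgue_measure R).
Variable mu : {sigma_finite_measure set V -> \bar R}.
Hypotheses (mu_leb : is_lebesgue_borel mu) (N_gt0 : (0 < N)%N).
Variables g C : R.
Hypotheses (C_ge0 : (0 <= C)%R) (gC : one_dim_bound g C).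
Variable tau : {sigma_finite_measure set V -> \bar R}.
Variables (u : V -> R) (D : 'I_N -> V -> R).
Hypotheses (mu_u : measurable_fun setT u) (mD : forall i, measurable_fun setT (D i)).
Hypotheses (uK : forall k : R, mu.-integrable (cube N k) (EFin \o u))
  (DK : forall (k : R) i, tau.-integrable (cube N k) (EFin \o D i)).
Hypothesis weak : forall phi, smooth_alg phi -> (forall x, 0 <= phi x)%R ->
  test_fun phi -> forall i,
  \int[mu]_x (u x * dpar [:: i] phi x)%:E = - \int[tau]_x (D i x * phi x)%:E.
Variables (p : R) (p1 : (1 <= p)%R).
Hypothesis p_tau : p = 1%R \/ tau = mu.

Let w (y : V) : R := enorm (\row_i D i y).

(** The Borel integrand of [nu_gamma] on the level set. The indicators of the complement of [M]
    ensure that, wherever it is nonzero, the mollifications converge at both points. *)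
Definition quotient_kernel (M : set V) (l : R) (x y : V) : R :=
  (\1_(~` M) x * \1_(~` M) y *
   ((x != y) && (l < `|u x - u y| / enorm (x - y) `^ (1 + g / p)))%:R *
   enorm (x - y) `^ (g - N%:R))%R.

Lemma quotient_kernel_ge0 M l x y : (0 <= quotient_kernel M l x y)%R.
Proof. by rewrite !mulr_ge0 ?powR_ge0. Qed.

Lemma measurable_quotient_kernel (M : set V) (l : R) : measurable M ->
  measurable_fun setT (fun z : V * V => quotient_kernel M l z.1 z.2).
Proof.
move=> mM; have mMC : measurable_fun setT (\1_(~` M) : V -> R).
  by apply: measurable_indic; exact: measurableC.
have mxy : measurable_fun setT (fun z : V * V => enorm (z.1 - z.2)%R).
  apply: (measurableT_comp (@measurable_enorm R N)).
  by apply: measurable_rVD => //; exact: measurable_rVN.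
apply: measurable_funM; last exact: (measurableT_comp (measurable_powR _)).
apply: measurable_funM; first by apply: measurable_funM; exact: measurableT_comp.
have mb : measurable_fun setT (fun z : V * V => (z.1 != z.2) &&
    (l < `|u z.1 - u z.2| / enorm (z.1 - z.2) `^ (1 + g / p))%R).
  apply: measurable_and.
    apply: (eq_measurable_fun (fun z : V * V => 0 < enorm (z.1 - z.2)%R)%R).
      by move=> z _; rewrite enorm_gt0 subr_eq0.
    exact: measurable_fun_ltr.
  apply: measurable_fun_ltr => //; apply: measurable_funM.
    apply: measurableT_comp => //.
    by apply: measurable_funB; exact: measurableT_comp.
  under eq_fun do rewrite -powRN.
  exact: (measurableT_comp (measurable_powR _)).
set b := (X in measurable_fun setT X) in mb.
rewrite (_ : (fun z => _) = (\1_[set z | b z] : V * V -> R)).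
  by apply: measurable_indic; exact: measurable_set_bool.
apply/funext => z; rewrite indicE; congr ((_ : bool)%:R); rewrite -/(b z).
by apply/idP/idP => [bz|/set_mem//]; exact: mem_set.
Qed.

Section one_level.
Variables (rho : nat -> V -> R) (M : set V).
Hypotheses (rhoP : forall n, exists r, mollifier mu r (rho n)) (mM : measurable M).
Hypothesis ucvg : forall x, ~ M x -> mollified mu u (rho n) x @[n --> \oo] --> u x.
Variables (l : R) (l_gt0 : (0 < l)%R).

Let f (n : nat) (z : V) : \bar R :=
  (l `^ (- p))%:E * conv tau (fun y => w y `^ p)%R (rho n) z.

Let mw : measurable_fun setT w.
Proof. exact: measurable_enorm_row. Qed.

Let mwp : measurable_fun setT (fun y => w y `^ p)%R.
Proof. exact: (measurableT_comp (measurable_powR _)). Qed.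

Let wp0 y : (0 <= w y `^ p)%R. Proof. exact: powR_ge0. Qed.

Let f0 n z : 0 <= f n z.
Proof.
have [r rP] := rhoP n.
by rewrite mule_ge0 ?lee_fin ?powR_ge0// (conv_ge0 _ rP).
Qed.

Let mf n : measurable_fun setT (f n).
Proof.
have [r rP] := rhoP n.
by apply: measurable_funeM; exact: (measurable_conv _ rP).
Qed.

Let B (n : nat) (z : V * V) : \bar R :=
  (\1_[set z | bad_segment g (f n) z.1 z.2] z * enorm z.2 `^ (g - N%:R))%:E.

Let mbad n : measurable [set z : V * V | bad_segment g (f n) z.1 z.2].
Proof. exact: measurable_set_bool (measurable_bad_segment g (mf n) (f0 n)). Qed.

Let mB n : measurable_fun setT (B n).
Proof.
apply/measurable_EFinP; apply: measurable_funM; first exact: measurable_indic.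
apply: (measurableT_comp (measurable_powR _)).
exact: (measurableT_comp (@measurable_enorm R N)).
Qed.

Let B0 n z : 0 <= B n z.
Proof. by rewrite lee_fin mulr_ge0 ?powR_ge0. Qed.

Let bound : \bar R := (sphere_area mu * (2 * C))%:E *
  ((l `^ (- p))%:E * \int[tau]_y (w y `^ p)%:E).

(** The radial estimate applied to the [n]-th mollified density; the bound is independent of [n]
    since total mass is preserved. *)
Let integral_B n : \int[mu \x mu]_z B n z <= bound.
Proof.
have [r rP] := rhoP n.
rewrite (@fubini_tonelli1 _ _ _ _ _ mu mu (B n) (mB n) (B0 n)).
rewrite (@fubini_tonelli _ _ _ _ _ mu mu (B n) (mB n) (B0 n)).
have fE : \int[mu]_z f n z = (l `^ (- p))%:E * \int[tau]_y (w y `^ p)%:E.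
  rewrite /f ge0_integralZl_EFin ?powR_ge0//; last 2 first.
  - by move=> z _; exact: (conv_ge0 _ rP).
  - exact: (measurable_conv _ rP).
  by rewrite (integral_conv mu_leb tau rP).
rewrite /bound -fE; apply: le_trans (radial_estimate mu_leb N_gt0 C_ge0 gC (mf n) (f0 n)).
rewrite le_eqVlt; apply/orP; left; apply/eqP; apply: eq_integral => h _ /=.
have mbh : measurable [set x | bad_segment g (f n) x h].
  by have := measurable_ysection h (mbad n); congr measurable;
    apply/seteqP; split=> x; rewrite /ysection/= inE.
rewrite -[X in mu X]setIT -integral_indic// -ge0_integralZl_EFin ?powR_ge0//; last first.
  by apply/measurable_EFinP; exact: measurable_indic.
apply: eq_integral => x _; rewrite -EFinM; congr EFin; rewrite mulrC; congr (_ * _)%R.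
Qed.

(** The level inequality is strict, so the mollified quotients satisfy it for all large [n]; each of
    them makes the segment bad and contributes the same power of [|h|]. *)
Let quotient_le_B x h : (quotient_kernel M l x (x + h)%R)%:E <= limn_einf (fun n => B n (x, h)).
Proof.
have L0 : 0 <= limn_einf (fun n => B n (x, h)) by apply: limn_einf_ge; exact: nearW.
rewrite /quotient_kernel !indicE.
have [Mx|nMx] := pselect (M x); first by rewrite memNset ?mul0r//; exact.
have [Mxh|nMxh] := pselect (M (x + h)%R).
  rewrite (_ : (x + h)%R \in ~` M = false) ?mulr0 ?mul0r//.
  by apply: memNset => /(_ Mxh).
rewrite !mem_set// !mul1r.
have hE : (x - (x + h) = - h)%R by rewrite opprD addrA subrr add0r.
have enormN : enorm (x - (x + h))%R = enorm h.
  by rewrite hE /enorm; congr Num.sqrt; apply: eq_bigr => i _; rewrite mxE sqrrN.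
rewrite enormN; case: (boolP (_ && _)) => [/andP[xh lq]|_]; last by rewrite mul0r.
have h0 : h != 0%R by apply: contraNneq xh => ->; rewrite addr0.
rewrite mul1r; apply: limn_einf_ge.
pose v n := mollified mu u (rho n).
have vcvg : (`|v n (x + h)%R - v n x| / enorm h `^ (1 + g / p))%R @[n --> \oo] -->
    (`|u x - u (x + h)| / enorm h `^ (1 + g / p))%R.
  apply: cvgM; last exact: cvg_cst.
  by rewrite distrC; apply: cvg_norm; apply: cvgB; exact: ucvg.
apply: filterS (cvgr_gt _ vcvg _ lq) => n ln.
rewrite /B/= indicE mem_set ?mul1r//=.
have [r rP] := rhoP n.
apply: (bad_segment_increment rP p1 _ mw _ l_gt0 h0 _ ln).
- by case: p_tau => [->|->]; [left|right=> z; rewrite (mollifier_int_reflect mu_leb z rP)].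
- by move=> y; exact: enorm_ge0.
- exact: (mollified_increment mu_u mD uK DK weak rP).
Qed.

(** The substitution [y = x + h] brings the kernel to the variables of the radial estimate; Fatou
    applies on the product space, and [l^p] cancels the [l^-p] in the density. *)
Lemma weak_type_level :
  (l `^ p)%:E * \int[mu]_x \int[mu]_y (quotient_kernel M l x y)%:E <=
  (sphere_area mu * (2 * C))%:E * \int[tau]_y (w y `^ p)%:E.
Proof.
have mK := measurable_quotient_kernel l mM.
have mKh : measurable_fun setT (fun z : V * V => (quotient_kernel M l z.1 (z.1 + z.2)%R)%:E).
  apply/measurable_EFinP.
  have ms : measurable_fun setT (fun z : V * V => (z.1, (z.1 + z.2)%R)).
    by apply: measurable_fun_pair => //; exact: measurable_rVD.
  exact: (measurableT_comp mK ms).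
have Kh0 (z : V * V) : 0 <= (quotient_kernel M l z.1 (z.1 + z.2)%R)%:E.
  by rewrite lee_fin quotient_kernel_ge0.
have -> : \int[mu]_x \int[mu]_y (quotient_kernel M l x y)%:E =
    \int[mu \x mu]_z (quotient_kernel M l z.1 (z.1 + z.2)%R)%:E.
  rewrite (@fubini_tonelli1 _ _ _ _ _ mu mu _ mKh Kh0).
  apply: eq_integral => x _; rewrite /fubini_F/=.
  under [RHS]eq_integral do rewrite addrC.
  have mKx : measurable_fun setT (fun y => (quotient_kernel M l x y)%:E).
    apply/measurable_EFinP; exact: (measurableT_comp mK (pair1_measurable x)).
  have Kx0 y : 0 <= (quotient_kernel M l x y)%:E by rewrite lee_fin quotient_kernel_ge0.
  exact: (esym (ge0_integral_shift mu_leb x mKx Kx0)).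
have mL : measurable_fun setT (fun z => limn_einf (fun n => B n z)).
  apply: measurableT_comp => //; apply: measurable_fun_limn_esup => n.
  exact: (measurableT_comp (@oppe_measurable R setT) (mB n)).
have le_bound : \int[mu \x mu]_z (quotient_kernel M l z.1 (z.1 + z.2)%R)%:E <= bound.
  apply: (@le_trans _ _ (\int[mu \x mu]_z limn_einf (fun n => B n z))).
    apply: ge0_le_integral; [exact: measurableT|..].
    - by move=> z _; rewrite lee_fin quotient_kernel_ge0.
    - exact: mKh.
    - exact: mL.
    - by move=> [x h] _; exact: quotient_le_B.
  apply: (le_trans (fatou (mu \x mu) measurableT mB (fun n z _ => B0 n z))).
  exact: limn_einf_le integral_B.
apply: (le_trans (lee_wpmul2l _ le_bound)); first by rewrite lee_fin powR_ge0.
rewrite /bound muleCA; apply: lee_wpmul2l.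
  by rewrite lee_fin mulr_ge0// /sphere_area ?mulr_ge0// fine_ge0.
rewrite muleA -EFinM -powRD; last by rewrite (gt_eqF l_gt0) implybT.
by rewrite subrr powRr0 mul1e.
Qed.

End one_level.
End weak_type_core.

(** Tonelli asks for a sigma-finite structure, while the theorem quantifies over plain measures. An
    equality of measures, rather than pointwise agreement, allows rewriting inside whole
    statements. *)
Lemma sigma_finite_measureP d (T : measurableType d) (R : realType) (m : {measure set T -> \bar R}) :
  sigma_finite setT m ->
  exists m' : {sigma_finite_measure set T -> \bar R}, m = m'.
Proof.
case: m => m [c1 c2] sf.
pose M : {measure set T -> \bar R} := Measure.Pack (Measure.Class c2).
pose F := Measure_isSigmaFinite.Build _ _ _ M sf.
pose m' : {sigma_finite_measure set T -> \bar R} :=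
  HB.pack_for {sigma_finite_measure set T -> \bar R} m c1 c2 F.
by exists m'.
Qed.

(** * Reduction to Borel functions *)

Section borel_reduction.
Context (R : realType) (N : nat).
Local Notation V := 'rV[R]_N.
Variable mu : {sigma_finite_measure set V -> \bar R}.
Hypotheses (mu_leb : is_lebesgue_borel mu) (N_gt0 : (0 < N)%N).
Variables (p : R) (u u' : V -> R) (M0 : set V).
Hypotheses (p1 : (1 <= p)%R) (mu_u : measurable_fun setT u') (mM0 : measurable M0)
  (muM0 : mu M0 = 0) (uu' : forall x, ~ M0 x -> u x = u' x).

(** One variable at a time: for [x] outside [M] the inner integrand agrees with a Borel one off [M],
    so the outer integrand agrees off [M] too. *)
Lemma nu_gammaE (g l : R) (M : set V) : measurable M -> mu M = 0 -> M0 `<=` M ->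
  nu_gamma mu g (Eset l (g / p) u) =
  \int[mu]_x \int[mu]_y (quotient_kernel g u' p M l x y)%:E.
Proof.
move=> mM muM M0M.
have mK := @measurable_quotient_kernel _ _ g u' mu_u p M l mM.
have mKE : measurable_fun setT (fun z : V * V => (quotient_kernel g u' p M l z.1 z.2)%:E).
  exact/measurable_EFinP.
have KE0 (z : V * V) : 0 <= (quotient_kernel g u' p M l z.1 z.2)%:E.
  by rewrite lee_fin quotient_kernel_ge0.
rewrite /nu_gamma; apply: (integral_leb_ae mM muM); last first.
  exact: (@measurable_fun_fubini_tonelli_F _ _ _ _ _ mu _ mKE KE0).
move=> x nMx; apply: (integral_leb_ae mM muM); last first.
  exact: (measurableT_comp mKE (pair1_measurable x)).
move=> y nMy; congr EFin.
rewrite /quotient_kernel !indicE !(mem_set (_ : (~` M) _))// !mul1r.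
rewrite -!uu'; [|by move=> /M0M..].
congr ((_ : bool)%:R * _)%R; apply/idP/idP => [/set_mem/= [/set_mem[/= -> ->]]//|].
by move=> /andP[xy lxy]; apply/mem_set; split=> //=; apply/mem_set; split.
Qed.

Variables (tau : {sigma_finite_measure set V -> \bar R}) (D : 'I_N -> V -> R).
Hypothesis mD : forall i, measurable_fun setT (D i).
Hypotheses (uK : forall k : R, mu.-integrable (cube N k) (EFin \o u'))
  (DK : forall (k : R) i, tau.-integrable (cube N k) (EFin \o D i)).
Hypothesis weak : forall phi, smooth_alg phi -> (forall x, 0 <= phi x)%R ->
  test_fun phi -> forall i,
  \int[mu]_x (u' x * dpar [:: i] phi x)%:E = - \int[tau]_x (D i x * phi x)%:E.
Hypothesis p_tau : p = 1%R \/ tau = mu.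

Lemma weak_quantity_le (g C : R) : (0 <= C)%R -> one_dim_bound g C ->
  weak_quantity mu p g u <=
  (sphere_area mu * (2 * C))%:E * \int[tau]_y (enorm (\row_i D i y) `^ p)%:E.
Proof.
move=> C0 gC.
have [rho [rhoP [M1 [mM1 muM1 ucvg]]]] := mollified_ae_cvg mu_leb mu_u uK.
apply: ge_ereal_sup => _ [l /= l0 <-].
have mM : measurable (M0 `|` M1) by exact: measurableU.
have muM : mu (M0 `|` M1) = 0 by rewrite measureU0.
rewrite (nu_gammaE _ _ mM muM); last exact: subsetUl.
apply: (weak_type_level mu_leb N_gt0 C0 gC mu_u mD uK DK weak p1 p_tau rhoP mM _ l0).
by move=> x nMx; apply: ucvg => M1x; apply: nMx; right.
Qed.

End borel_reduction.

Section local_borel_versions.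
Context (R : realType) (N : nat).
Local Notation V := 'rV[R]_N.
Variable mu : {sigma_finite_measure set V -> \bar R}.
Hypotheses (mu_leb : is_lebesgue_borel mu) (N_gt0 : (0 < N)%N).
Local Notation lebT := (caratheodory_type (mu_ext mu)).
Local Notation L := (leb mu).

Lemma measurable_dbox (a : V) (b : R) : measurable (dbox a b).
Proof.
rewrite (_ : dbox a b = \bigcap_(i in [set: 'I_N])
  ((fun x : V => x ord0 i) @^-1` `[(a ord0 i - b)%R, (a ord0 i + b)%R]%classic)).
  apply: fin_bigcap_measurable => // i _.
  rewrite -[X in measurable X]setTI; exact: measurable_coord.
apply/seteqP; split=> [x xab i _|x xab i] /=.
  by rewrite in_itv/= -ler_distlC.
by have := xab i Logic.I; rewrite /= in_itv/= -ler_distlC.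
Qed.

Lemma loc_integrable_borel (u : V -> R) : loc_integrable mu u ->
  exists u' M, [/\ measurable_fun setT u', measurable M, mu M = 0 &
    forall x, ~ M x -> u x = u' x] /\
    forall k : R, mu.-integrable (cube N k) (EFin \o u').
Proof.
move=> [mu_u uK]; have [u' [M [mu' mM M0 uu']]] := borel_version mu_leb mu_u.
exists u', M; split=> // k; apply/integrableP; split.
  exact/measurable_EFinP/measurable_funTS.
have mQ : measurable (cube N k) by exact: measurable_rbox.
have mQL := measurable_leb mu mQ.
rewrite integral_mkcond -(@integral_leb_ae _ _ mu ((fun x => (`|u x|)%:E) \_ (cube N k)) _ M)//.
- rewrite -integral_mkcond.
  have /integrableP[_] := uK _ (@dbox_compact R N 0%R k).
  apply: le_lt_trans.
  have mK : measurable (dbox (0%R : V) k : set lebT).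
    by apply: measurable_leb; exact: measurable_dbox.
  apply: (@ge0_subset_integral _ lebT R L (cube N k) (dbox 0%R k) mQL mK) => [|x _|x /cubeP xk i].
  + apply: (@measurable_funTS _ _ lebT).
    apply/(@measurable_EFinP _ lebT).
    exact: (@measurableT_comp _ _ _ lebT _ _ _ _ _ (@normr_measurable R setT) mu_u).
  + by rewrite lee_fin.
  + by have /andP[? ?] := xk i; rewrite mxE sub0r normrN ler_norml; apply/andP; split => //; exact: ltW.
- by move=> x nMx; rewrite !patchE /= uu'.
- apply/(measurable_restrictT _ mQ); apply: measurable_funTS.
  by apply/measurable_EFinP; exact: measurableT_comp.
Qed.

Lemma integral_borel_test (u u' : V -> R) (M : set V) phi : measurable M -> mu M = 0 ->
  measurable_fun setT u' -> (forall x, ~ M x -> u x = u' x) -> smooth_alg phi ->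
  \int[L]_x (u x * phi x)%:E = \int[mu]_x (u' x * phi x)%:E.
Proof.
move=> mM M0 mu' uu' sphi; apply: (integral_leb_ae mM M0) => [x nMx|].
  by rewrite uu'.
by apply/measurable_EFinP; apply: measurable_funM => //; exact: smooth_measurable.
Qed.

Lemma weak_quantity_W1p (p : R) u D (g C : R) : (1 <= p)%R -> W1p_grad mu p u D ->
  (0 <= C)%R -> one_dim_bound g C ->
  weak_quantity mu p g u <= (sphere_area mu * (2 * C))%:E * grad_Lp_p mu p D.
Proof.
move=> p1 [[lu [mD weak]] Doo] C0 gC.
have [u' [M0 [[mu' mM0 M00 uu'] uK]]] := loc_integrable_borel lu.
have [D' HD] := choice (fun i => borel_version mu_leb (mD i)).
have [M1 HM] := choice HD.
pose M := \big[setU/set0]_(i < N) M1 i.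
have [mM M00'] : measurable M /\ mu M = 0.
  apply: (big_ind (fun A => measurable A /\ mu A = 0)).
  - by rewrite measure0.
  - by move=> A B [mA A0] [mB B0]; split; [exact: measurableU|rewrite measureU0].
  - by move=> i _; have [] := HM i.
have mD' i : measurable_fun setT (D' i) by have [] := HM i.
have DD' i x : ~ M x -> D i x = D' i x.
  by move=> nMx; have [_ _ _] := HM i; apply => M1x; apply: nMx;
    rewrite /M -bigcup_seq/=; exists i => //=; rewrite mem_index_enum.
have mE : measurable_fun setT (fun y => (enorm (\row_i D' i y) `^ p)%:E).
  apply/measurable_EFinP; apply: (measurableT_comp (measurable_powR _)).
  exact: measurable_enorm_row.
have gradE : grad_Lp_p mu p D = \int[mu]_y (enorm (\row_i D' i y) `^ p)%:E.
  apply: (integral_leb_ae mM M00') => [x nMx|].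
    by congr (enorm _ `^ _)%:E; apply/rowP => i; rewrite !mxE DD'.
  exact: mE.
rewrite gradE.
apply: (weak_quantity_le mu_leb N_gt0 p1 mu' mM0 M00 uu' mD' uK) => //; last by right.
- move=> k i; apply/integrableP; split; first exact/measurable_EFinP/measurable_funTS.
  have mQ : measurable (cube N k) by exact: measurable_rbox.
  (* As [1 <= p], each component is at most [1 + |D'|^p], which is integrable on cubes. *)
  apply: (@le_lt_trans _ _ (\int[mu]_(y in cube N k) (cst 1 y + (enorm (\row_i D' i y) `^ p)%:E))).
    apply: ge0_le_integral => //.
    - by apply/measurable_EFinP/measurableT_comp => //; exact: measurable_funTS.
    - by apply: emeasurable_funD => //; exact: measurable_funTS.
    move=> y _; rewrite /= -EFinD lee_fin.
    have Dy : (`|D' i y| <= enorm (\row_i D' i y))%R.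
      by have := le_enorm (\row_i D' i y) i; rewrite mxE.
    have [y1|y1] := leP (enorm (\row_i D' i y)) 1%R.
      by rewrite (le_trans Dy)// (le_trans y1)// lerDl powR_ge0.
    rewrite (le_trans Dy)// ler_wpDl// -[leLHS]powRr1 ?enorm_ge0//.
    by rewrite ler_powR// ltW.
  rewrite ge0_integralD//; last 2 first.
  - by move=> y _; rewrite lee_fin powR_ge0.
  - exact: measurable_funTS.
  rewrite integral_cst// mul1e lte_add_pinfty ?(lebesgue_cube_lty mu_leb)//.
  apply: le_lt_trans Doo; rewrite gradE; apply: ge0_subset_integral => //.
  by move=> y _; rewrite lee_fin powR_ge0.
- move=> phi sphi phi0 tphi i; have := weak _ tphi i.
  rewrite (integral_borel_test mM0 M00 mu' uu' (smooth_dpar i sphi)).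
  by rewrite (integral_borel_test mM M00' (mD' i) (fun x => @DD' i x) sphi).
Qed.

End local_borel_versions.

(** * Total variation and densities *)

Section vector_total_variation.
Context (R : realType) (N : nat).
Local Notation V := 'rV[R]_N.

(** The perturbation is measured by the sum of its coordinates, the form in which coordinatewise L^1
    approximations supply it. *)
Lemma enorm_triangle (a b : V) : (enorm (a + b) <= enorm a + \sum_i `|b ord0 i|)%R.
Proof.
set A := enorm a; set S := (\sum_i `|b ord0 i|)%R.
have A0 : (0 <= A)%R by exact: enorm_ge0.
have S0 : (0 <= S)%R by apply: sumr_ge0.
have bS i : (`|b ord0 i| <= S)%R.
  by rewrite /S (bigD1 i)//= lerDl sumr_ge0.
rewrite -(ger0_norm (addr_ge0 A0 S0)) -sqrtr_sqr ler_sqrt ?sqr_ge0//.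
have A2 : (\sum_i a ord0 i ^+ 2 = A ^+ 2)%R by rewrite sqr_sqrtr ?enorm_sum_ge0.
have -> : ((A + S) ^+ 2 = \sum_i (a ord0 i ^+ 2 + (2 * A + S) * `|b ord0 i|))%R.
  by rewrite big_split/= -mulr_sumr A2 -/S; ring.
apply: ler_sum => i _; rewrite mxE.
have := le_enorm a i; rewrite -/A => aA.
have -> : ((a ord0 i + b ord0 i) ^+ 2 =
    a ord0 i ^+ 2 + (2 * (a ord0 i * b ord0 i) + b ord0 i ^+ 2))%R by ring.
rewrite lerD2l [leRHS]mulrDl lerD//.
  rewrite -mulrA ler_wpM2l// (le_trans (ler_norm _))// normrM ler_wpM2r//.
by rewrite -(real_normK (num_real (b ord0 i))) expr2 ler_wpM2r.
Qed.

Context d (X : measurableType d) (tau : {measure set X -> \bar R}).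
Hypothesis tau_fin : tau setT < +oo.
Variable D : 'I_N -> X -> R.
Hypothesis iD : forall i, tau.-integrable setT (EFin \o D i).

Let mD i : measurable_fun setT (D i).
Proof. by apply/measurable_EFinP; exact: measurable_int (iD i). Qed.

Let w (x : X) : R := enorm (\row_i D i x).

Let mw : measurable_fun setT w.
Proof. exact: measurable_enorm_row. Qed.

(** The constant vector [c] is compared with [D] twice: pointwise under the norm, and after
    integration, where [tau A * c] stands against the integral of [D]. Each comparison costs the
    same error, hence the 2. *)
Lemma enorm_integral_cell (A : set X) (c : V) : measurable A ->
  \int[tau]_(x in A) (w x)%:E <=
  (enorm (\row_i fine (\int[tau]_(x in A) (D i x)%:E)))%:E +
  2%:E * \sum_i \int[tau]_(x in A) (`|D i x - c ord0 i|)%:E.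
Proof.
move=> mA.
have Afin : tau A < +oo.
  by apply: le_lt_trans tau_fin; apply: le_measure; rewrite ?inE.
have Afn : tau A \is a fin_num by rewrite ge0_fin_numE.
set t := fine (tau A); have t0 : (0 <= t)%R by exact: fine_ge0.
have ic i : tau.-integrable A (fun=> (c ord0 i)%:E).
  apply/integrableP; split; first exact: measurable_cst.
  rewrite (eq_integral (cst `|c ord0 i|%:E))// integral_cst//.
  by rewrite lte_mul_pinfty// lee_fin.
have iDA i : tau.-integrable A (EFin \o D i) by exact: integrableS (iD i).
have iDc i : tau.-integrable A (fun x => (D i x - c ord0 i)%:E).
  exact: (integrableB mA (iDA i) (ic i)).
have mDc i : measurable_fun A (fun x => (`|D i x - c ord0 i|)%:E).
  by apply/measurable_EFinP; apply: measurableT_comp => //; apply/measurable_EFinP;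
    exact: measurable_int (iDc i).
pose I i := \int[tau]_(x in A) (D i x)%:E.
pose J i := \int[tau]_(x in A) (`|D i x - c ord0 i|)%:E.
have If i : I i \is a fin_num by exact: integrable_fin_num (iDA i).
have Jf i : J i \is a fin_num.
  exact: integrable_fin_num (integrable_abse (iDc i)).
have ctI i : (`|t * c ord0 i - fine (I i)| <= fine (J i))%R.
  rewrite -lee_fin fineK//.
  have -> : (`|t * c ord0 i - fine (I i)|)%:E = `|\int[tau]_(x in A) (D i x - c ord0 i)%:E|.
    rewrite distrC integralB_EFin//; last exact: ic.
    rewrite integral_cst// -[LHS]/(`|(fine (I i) - t * c ord0 i)%:E|) EFinB fineK//.
    by rewrite EFinM /t fineK// muleC.
  apply: le_trans (le_abse_integral _ _ _) _ => //.
  exact: measurable_int (iDc i).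
have JE : \sum_i J i = (\sum_i fine (J i))%:E.
  by rewrite -sumEFin; apply: eq_bigr => i _; rewrite fineK.
rewrite -[\sum_i _]/(\sum_i J i).
apply: (@le_trans _ _ ((enorm c)%:E * tau A + \sum_i J i)).
  rewrite -(integral_cst _ mA) /J -ge0_integral_sum//.
  rewrite -ge0_integralD//; last 3 first.
  - by move=> x _; rewrite lee_fin enorm_ge0.
  - by move=> x _; exact: sume_ge0.
  - exact: emeasurable_sum.
  apply: ge0_le_integral => //.
  - by move=> x _; rewrite lee_fin enorm_ge0.
  - by apply/measurable_EFinP; exact: measurable_funTS.
  - by apply: emeasurable_funD => //; exact: emeasurable_sum.
  move=> x _; rewrite sumEFin -EFinD lee_fin.
  rewrite /w (_ : \row_i D i x = c + (\row_i D i x - c))%R; last by rewrite addrC subrK.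
  apply: le_trans (enorm_triangle _ _) _; rewrite lerD2l.
  by apply: ler_sum => i _; rewrite !mxE.
rewrite JE -[tau A]fineK// -/t -EFinM -!EFinM -!EFinD lee_fin mulr2n mulrDl mul1r addrA lerD2r.
rewrite mulrC -enormZ//.
rewrite (_ : t *: c = \row_i fine (I i) + (t *: c - \row_i fine (I i)))%R; last first.
  by rewrite addrC subrK.
apply: le_trans (enorm_triangle _ _) _; rewrite lerD2l.
by apply: ler_sum => i _; rewrite !mxE.
Qed.

Lemma integral_fibers m (F : X -> 'I_m) (f : X -> \bar R) :
  (forall t, measurable (F @^-1` [set t])) -> measurable_fun setT f ->
  (forall x, 0 <= f x) ->
  \int[tau]_x f x = \sum_(t < m) \int[tau]_(x in F @^-1` [set t]) f x.
Proof.
move=> mF mf f0.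
have UT : \big[setU/set0]_(t <- index_enum 'I_m) (F @^-1` [set t]) = setT.
  rewrite -bigcup_seq; apply/seteqP; split=> // x _.
  by exists (F x) => //=; rewrite mem_index_enum.
rewrite -UT ge0_integral_bigsetU//.
- exact: index_enum_uniq.
- by move=> s t _ _ [x [/= -> ->]].
- exact: measurable_funTS.
Qed.

Import HBSimple.

Lemma measurable_simple_fiber (h : {sfun X >-> R}) (Y : set R) : measurable (h @^-1` Y).
Proof.
rewrite (_ : h @^-1` Y = h @^-1` (Y `&` range h)); last first.
  by apply/seteqP; split=> [x Yx|x []//]; split=> //; exists x.
rewrite -[X in measurable X]setTI; apply: (@measurable_funPT _ _ _ _ h) => //.
apply: countable_measurable => //; apply: finite_set_countable.
exact/finite_setIr/fimfunP.
Qed.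

(** The components are approximated in L^1 by simple functions. On the joint fibres of these, [D] is
    nearly constant, so norm and integral nearly commute on each cell. *)
Lemma enorm_integral_partition (B : \bar R) :
  (forall m (F : X -> 'I_m), (forall t, measurable (F @^-1` [set t])) ->
    \sum_(t < m) (enorm (\row_i fine (\int[tau]_(x in F @^-1` [set t]) (D i x)%:E)))%:E <= B) ->
  \int[tau]_x (w x)%:E <= B.
Proof.
move=> HB; apply/lee_addgt0Pr => e e0.
(* The total error is [2 * N * eta]; the successor of [N] avoids a zero denominator. *)
pose eta : R := (e / (2 * N.+1%:R))%R.
have eta0 : (0 < eta)%R by rewrite divr_gt0// mulr_gt0.
have approx i : exists g : {sfun X >-> R}, \int[tau]_x (`|D i x - g x|)%:E < eta%:E.
  have [g_ [_ _ /cvge0_lt /(_ eta0)[n _ /(_ n (leqnn n)) /= gn]]] :=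
    approximation_sfun_integrable measurableT (iD i).
  by exists (g_ n).
have [g gP] := choice approx.
pose S : seq R := flatten [seq finmap.enum_fset (fset_set (range (g i))) | i <- enum 'I_N].
have gS i x : g i x \in S.
  apply/flattenP; exists (finmap.enum_fset (fset_set (range (g i)))).
    by apply/mapP; exists i => //; rewrite mem_enum.
  by rewrite in_fset_set; [apply/mem_set; exists x|exact: fimfunP].
(* A cell is named by the positions in [S] of the [N] approximate values; all values occur in [S],
   so the spare last position is never taken. *)
pose FF (x : X) : {ffun 'I_N -> 'I_(size S).+1} := [ffun i => inord (index (g i x) S)].
pose F (x : X) : 'I_#|{ffun 'I_N -> 'I_(size S).+1}| := enum_rank (FF x).
pose c (t : 'I_#|{ffun 'I_N -> 'I_(size S).+1}|) : V := \row_i nth 0%R S (enum_val t i).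
have Fc x i : g i x = c (F x) ord0 i.
  rewrite mxE enum_rankK ffunE inordK ?nth_index//.
  by rewrite ltnS index_size.
have mF t : measurable (F @^-1` [set t]).
  rewrite (_ : _ @^-1` _ = \bigcap_(i in [set: 'I_N])
      (g i @^-1` [set y | inord (index y S) = enum_val t i :> 'I_(size S).+1])).
    by apply: fin_bigcap_measurable => // i _; exact: measurable_simple_fiber.
  apply/seteqP; split=> [x /= <- i _ /=|x Hx /=].
    by rewrite enum_rankK ffunE.
  rewrite -[t]enum_valK; congr enum_rank; apply/ffunP => i.
  by rewrite ffunE; exact: Hx.
have mDg i : measurable_fun setT (fun x => (`|D i x - g i x|)%:E).
  apply/measurable_EFinP; apply: measurableT_comp => //; apply: measurable_funB => //.
rewrite (@integral_fibers _ _ (EFin \o w) mF); last 2 first.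
  exact/measurable_EFinP.
  by move=> x; rewrite lee_fin enorm_ge0.
apply: (@le_trans _ _ (\sum_(t < #|{ffun 'I_N -> 'I_(size S).+1}|)
  ((enorm (\row_i fine (\int[tau]_(x in F @^-1` [set t]) (D i x)%:E)))%:E +
   2%:E * \sum_i \int[tau]_(x in F @^-1` [set t]) (`|D i x - g i x|)%:E))).
  apply: lee_sum => t _; apply: le_trans (enorm_integral_cell (c t) (mF t)) _.
  rewrite leeD2l// lee_wpmul2l// lee_sum// => i _.
  rewrite le_eqVlt; apply/orP; left; apply/eqP; apply: eq_integral => x /set_mem/= Ft.
  by rewrite Fc Ft.
rewrite big_split/= leeD ?HB// -ge0_sume_distrr; last first.
  by move=> t _; apply: sume_ge0 => i _; exact: integral_ge0.
rewrite exchange_big/=.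
apply: (@le_trans _ _ (2%:E * \sum_(i < N) eta%:E)).
  rewrite lee_wpmul2l// lee_sum// => i _.
  by rewrite -(integral_fibers mF (mDg i))// ltW.
rewrite sumEFin -EFinM lee_fin sumr_const card_ord /eta.
have N0 : (0 < N.+1%:R :> R)%R by [].
have -> : (2 * (e / (2 * N.+1%:R) *+ N) = e * (N%:R / N.+1%:R))%R.
  by rewrite -(mulr_natr _ N); field; rewrite nat1r gt_eqF.
by rewrite ler_piMr ?(ltW e0)// ler_pdivrMr// mul1r ler_nat.
Qed.

End vector_total_variation.

(** * Functions of bounded variation *)

Section bounded_variation.
Context (R : realType) (N : nat).
Local Notation V := 'rV[R]_N.
Variable mu : {sigma_finite_measure set V -> \bar R}.
Hypotheses (mu_leb : is_lebesgue_borel mu) (N_gt0 : (0 < N)%N).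
Variables (mp mn : 'I_N -> {finite_measure set V -> \bar R}).

(** The sum of all the [mp i] and [mn i]. The family is extended by zero measures to natural
    indices, to be summed with [msum]. *)
Lemma common_dominating_measure : exists tau : {sigma_finite_measure set V -> \bar R},
  [/\ tau setT < +oo, forall i, mp i `<< tau & forall i, mn i `<< tau].
Proof.
pose m (n : nat) : {measure set V -> \bar R} :=
  if insub n is Some i then measure_add (mp i) (mn i) else mzero.
have mE (i : 'I_N) A : m i A = mp i A + mn i A by rewrite /m valK; exact: measure_addE.
have fin : msum m N setT < +oo.
  apply: lte_sum_pinfty => i _; rewrite mE lte_add_pinfty//.
    by rewrite -ge0_fin_numE// fin_num_measure.
  by rewrite -ge0_fin_numE// fin_num_measure.
have sf : sigma_finite setT (msum m N).
  by exists (fun=> setT) => [|n]; [rewrite bigcup_const//; exists 0%N|split].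
have [tau tauE] := sigma_finite_measureP sf.
have tE A : msum m N A = tau A.
  exact: (congr1 (fun nu : {measure set V -> \bar R} => nu A) tauE).
have tau0 A (i : 'I_N) : tau A = 0 -> mp i A + mn i A = 0.
  rewrite -tE => A0; apply/eqP; rewrite -mE eq_le measure_ge0 andbT -A0.
  rewrite /= /msum (bigD1 i)//= leeDl//; apply: sume_ge0 => j _; exact: measure_ge0.
exists tau; split; first by rewrite -tE.
- move=> i; apply/null_content_dominatesP => A mA /(tau0 _ i) /eqP.
  by rewrite padde_eq0// => /andP[/eqP].
- move=> i; apply/null_content_dominatesP => A mA /(tau0 _ i) /eqP.
  by rewrite padde_eq0// => /andP[_ /eqP].
Qed.

(** The Radon-Nikodym change of variables is for nonnegative integrands. This is why the weak
    gradient hypothesis is carried for nonnegative test functions, which reflected mollifiers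
    are. *)
Lemma finite_measure_density (nu : {finite_measure set V -> \bar R})
    (tau : {sigma_finite_measure set V -> \bar R}) : nu `<< tau ->
  exists f : V -> R, [/\ tau.-integrable setT (EFin \o f),
    forall A, measurable A -> nu A = \int[tau]_(x in A) (f x)%:E &
    forall phi : V -> R, (forall x, 0 <= phi x)%R -> nu.-integrable setT (EFin \o phi) ->
      tau.-integrable setT (fun x => (f x * phi x)%:E) /\
      \int[nu]_x (phi x)%:E = \int[tau]_x (f x * phi x)%:E].
Proof.
move=> nutau; pose g := Radon_Nikodym_SigmaFinite.f nu tau.
have gE x : (fine (g x))%:E = g x.
  by rewrite fineK//; exact: Radon_Nikodym_SigmaFinite.f_fin_num.
exists (fine \o g); split.
- rewrite (_ : EFin \o _ = g); first exact: Radon_Nikodym_SigmaFinite.f_integrable.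
  by apply/funext => x; exact: gE.
- move=> A mA; rewrite (Radon_Nikodym_SigmaFinite.f_integral nutau mA).
  by apply: eq_integral => x _; rewrite /= gE.
- move=> phi phi0 iphi.
  have E : (fun x => ((fine \o g) x * phi x)%:E) = (fun x => (phi x)%:E * g x).
    by apply/funext => x; rewrite /= EFinM gE muleC.
  have phiE0 x : 0 <= (EFin \o phi) x by rewrite lee_fin.
  rewrite E; split; first exact: (Radon_Nikodym_SigmaFinite.integrableM nutau phiE0).
  by rewrite -(Radon_Nikodym_SigmaFinite.change_of_variables nutau phiE0 measurableT
    (measurable_int _ iphi)).
Qed.

(** [mp i] and [mn i] may share mass. Subtracting their densities before taking the norm lets the
    common part cancel, so that the integral of the norm is controlled by [grad_TV] and not by the
    sum of the total masses. *)
Lemma weak_quantity_BV u (g C : R) : BV_grad mu u mp mn ->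
  (0 <= C)%R -> one_dim_bound g C ->
  weak_quantity mu 1 g u <= (sphere_area mu * (2 * C))%:E * grad_TV mp mn.
Proof.
move=> [lu weak] C0 gC.
have [u' [M0 [[mu' mM0 M00 uu'] uK]]] := loc_integrable_borel mu_leb lu.
have [tau [tau_fin mptau mntau]] := common_dominating_measure.
have [fp fpP] := choice (fun i => finite_measure_density (mptau i)).
have [fn fnP] := choice (fun i => finite_measure_density (mntau i)).
pose D i x := (fp i x - fn i x)%R.
have iD i : tau.-integrable setT (EFin \o D i).
  have [ip _ _] := fpP i; have [iN _ _] := fnP i.
  exact: (integrableB measurableT ip iN).
have mD i : measurable_fun setT (D i).
  by apply/measurable_EFinP; exact: measurable_int (iD i).
have DA i A : measurable A -> \int[tau]_(x in A) (D i x)%:E = mp i A - mn i A.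
  move=> mA; have [ip pE _] := fpP i; have [iN nE _] := fnP i.
  rewrite pE// nE// -integralB_EFin//; [exact: integrableS ip|exact: integrableS iN].
have testE phi i : smooth_alg phi -> (forall x, 0 <= phi x)%R ->
    \int[tau]_x (D i x * phi x)%:E = \int[mp i]_x (phi x)%:E - \int[mn i]_x (phi x)%:E.
  move=> sphi phi0.
  have iphi (nu : {finite_measure set V -> \bar R}) : nu.-integrable setT (EFin \o phi).
    have [K phiK] := smooth_bounded sphi.
    apply: measurable_bounded_integrable => //.
    - by rewrite -ge0_fin_numE// fin_num_measure.
    - exact: smooth_measurable.
    - exists K; split; first exact: num_real.
      by move=> L KL x _ /=; rewrite (le_trans (phiK x))// ltW.
  have [_ _ /(_ phi phi0 (iphi _))[ip ->]] := fpP i.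
  have [_ _ /(_ phi phi0 (iphi _))[iN ->]] := fnP i.
  rewrite -integralB_EFin//; apply: eq_integral => x _.
  by rewrite -EFinB -mulrBl.
apply: le_trans (weak_quantity_le mu_leb N_gt0 (lexx 1%R) mu' mM0 M00 uu' mD uK _ _ _ C0 gC) _.
- by move=> k i; apply: integrableS (iD i) => //; exact: measurable_rbox.
- move=> phi sphi phi0 tphi i; rewrite testE// -weak//.
  by rewrite (integral_borel_test mM0 M00 mu' uu' (smooth_dpar i sphi)).
- by left.
apply: lee_wpmul2l.
  by rewrite lee_fin mulr_ge0 ?mulr_ge0// /sphere_area mulr_ge0// fine_ge0.
under eq_integral do rewrite powRr1 ?enorm_ge0//.
apply: (enorm_integral_partition tau_fin iD) => m F mF.
apply: ereal_sup_ubound => /=.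
(* The finite partition into fibres is continued by empty sets beyond index [m]. *)
exists m, (fun k => [set x | F x = k :> nat]); split.
- move=> k; have [km|mk] := ltnP k m.
    rewrite (_ : [set x | _] = F @^-1` [set Ordinal km])//.
    by apply/seteqP; split=> [x /= Fx|x /= -> //]; exact/val_inj.
  rewrite (_ : [set x | _] = set0)//; apply/seteqP; split=> // x /= Fx.
  by move: mk; rewrite -Fx leqNgt ltn_ord.
- by move=> k l _ _ [x [/= <- <-]].
- apply/seteqP; split=> // x _; exists (F x) => //=; exact: ltn_ord.
- apply: eq_bigr => t _; congr (enorm _)%:E; apply/rowP => i; rewrite !mxE DA//.
  have -> : F @^-1` [set t] = [set x | F x = t :> nat].
    by apply/seteqP; split=> [x /= ->//|x /= Fx]; exact/val_inj.
  by [].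
Qed.

End bounded_variation.

(* Constants and assembly *)
Local Close Scope ereal_scope.

Theorem theorem2p2 (R : realType) :
  exists C : R, 0 < C /\
  forall (N : nat) (mu : {measure set 'rV[R]_N -> \bar R}),
    (0 < N)%N -> is_lebesgue_borel mu ->
    (forall (p : R) (u : 'rV[R]_N -> R) (g : 'I_N -> 'rV[R]_N -> R),
       1 <= p -> W1p_grad mu p u g ->
       (forall gamma : R, 0 < gamma ->
          (weak_quantity mu p gamma u <=
           (C * sphere_area mu * 5 `^ gamma / gamma)%:E * grad_Lp_p mu p g)%E) /\
       (forall gamma : R, gamma < -1 ->
          (weak_quantity mu p gamma u <=
           (C * sphere_area mu / `|gamma| * (1 + 1 / `|gamma + 1|))%:E
             * grad_Lp_p mu p g)%E)) /\
    (forall (u : 'rV[R]_N -> R)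
            (mp mn : 'I_N -> {finite_measure set 'rV[R]_N -> \bar R}),
       BV_grad mu u mp mn ->
       (forall gamma : R, 0 < gamma ->
          (weak_quantity mu 1 gamma u <=
           (C * sphere_area mu * 5 `^ gamma / gamma)%:E * grad_TV mp mn)%E) /\
       (forall gamma : R, gamma < -1 ->
          (weak_quantity mu 1 gamma u <=
           (C * sphere_area mu / `|gamma| * (1 + 1 / `|gamma + 1|))%:E
             * grad_TV mp mn)%E)).
Proof.
(* Here [2 * 3 = 6] and [2^g] would suffice. *)
have bound_pos (g s : R) (G : \bar R) : 0 < g -> 0 <= s -> (0 <= G)%E ->
    ((s * (2 * (3 * 2 `^ g / g)))%:E * G <= (8 * s * 5 `^ g / g)%:E * G)%E.
  move=> g0 s0 G0; apply: lee_wpmul2r => //; rewrite lee_fin.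
  have p25 : 2 `^ g <= 5 `^ g.
    by apply: ge0_ler_powR; rewrite ?nnegrE ?(ltW g0)//; lra.
  have -> : s * (2 * (3 * 2 `^ g / g)) = (6 * 2 `^ g) * (s / g) by ring.
  have -> : 8 * s * 5 `^ g / g = (8 * 5 `^ g) * (s / g) by ring.
  rewrite ler_wpM2r ?divr_ge0 ?(ltW g0)//.
  by have := powR_ge0 5 g; lra.
(* Since [|g| = |g+1| + 1], the factor [1 + 1/|g+1|] is [|g|/|g+1|] and both sides coincide; this
   fixes the constant 8. *)
have bound_neg (g s : R) (G : \bar R) : g < -1 -> 0 <= s -> (0 <= G)%E ->
    ((s * (2 * (4 / - (g + 1))))%:E * G <=
     (8 * s / `|g| * (1 + 1 / `|g + 1|))%:E * G)%E.
  move=> g1 s0 G0; apply: lee_wpmul2r => //; rewrite lee_fin le_eqVlt.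
  have g0 : g < 0 by lra.
  have g10 : g + 1 < 0 by lra.
  rewrite (ltr0_norm g0) (ltr0_norm g10); apply/orP; left; apply/eqP.
  by field; rewrite !lt_eqF.
exists 8; split=> // N mu0 N_gt0 mu_leb.
have [mu muE] := sigma_finite_measureP (lebesgue_sigma_finite mu_leb).
rewrite {mu0}muE in mu_leb *.
have s0 : 0 <= sphere_area mu by rewrite mulr_ge0// fine_ge0.
split=> [p u D p1 uD|u mp mn uBV].
- have G0 : (0 <= grad_Lp_p mu p D)%E.
    by apply: integral_ge0 => x _; rewrite lee_fin powR_ge0.
  split=> g g0.
  + apply: le_trans (weak_quantity_W1p mu_leb N_gt0 p1 uD _ (one_dim_bound_pos g0)) _.
      by rewrite divr_ge0 ?mulr_ge0 ?powR_ge0 ?(ltW g0).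
    exact: bound_pos.
  + apply: le_trans (weak_quantity_W1p mu_leb N_gt0 p1 uD _ (one_dim_bound_neg g0)) _.
      by rewrite divr_ge0//; lra.
    exact: bound_neg.
- have G0 : (0 <= grad_TV mp mn)%E.
    (* The partition with the single cell [setT] shows that the supremum is nonnegative. *)
    pose A (k : nat) : set 'rV[R]_N := if k is 0%N then setT else set0.
    apply: (@le_trans _ _ (\sum_(k < 1) (enorm (\row_i fine (mp i (A k) - mn i (A k))))%:E)%E).
      by apply: sume_ge0 => k _; rewrite lee_fin enorm_ge0.
    apply: ereal_sup_ubound; exists 1%N, A; split=> //.
    + by case=> [|k]; [exact: measurableT|exact: measurable0].
    + by move=> [|k] [|l] _ _ [x []].
    + by apply/seteqP; split=> // x _; exists 0%N.
  split=> g g0.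
  + apply: le_trans (weak_quantity_BV mu_leb N_gt0 uBV _ (one_dim_bound_pos g0)) _.
      by rewrite divr_ge0 ?mulr_ge0 ?powR_ge0 ?(ltW g0).
    exact: bound_pos.
  + apply: le_trans (weak_quantity_BV mu_leb N_gt0 uBV _ (one_dim_bound_neg g0)) _.
      by rewrite divr_ge0//; lra.
    exact: bound_neg.
Qed.
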